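(* Let $g,h\in\mathbb{R}$ with $h\neq 0$, let $N\geq 1$, and let $v:\mathbb{Z}\to\mathbb{R}$ be bounded with $\lim_{n\to\pm\infty}v(n)=0$. Then the self-adjoint operator $H^{(N)}$ on $\ell^2(\mathbb{Z}^N)$ has pure point spectrum, i.e. $\ell^2(\mathbb{Z}^N)$ is spanned (as a closed linear span) by eigenvectors of $H^{(N)}$.
   Context: Let $(e_j)_{j\in\mathbb{Z}}$ be the canonical basis of $\ell^2(\mathbb{Z})$, $Xe_j=je_j$, $\Delta e_j=-(e_{j-1}+e_{j+1})$, and $H_0=g\Delta-2hX$, self-adjoint on the domain of $X$. On $\ell^2(\mathbb{Z}^N)=\bigotimes_{k=1}^N\ell^2(\mathbb{Z})$, with position basis $|x_1,\dots,x_N\rangle=e_{x_1}\otimes\cdots\otimes e_{x_N}$, let $H_0^{(N)}=\sum_{k=1}^N 1\otimes\cdots\otimes H_0\otimes\cdots\otimes 1$ ($H_0$ in the $k$-th factor; self-adjoint closure), and $H^{(N)}=H_0^{(N)}+\sum_{1\le i<j\le N}V_{ij}$, where $V_{ij}$ is the bounded operator of multiplication by $v(x_i-x_j)$ in the position basis. *)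

(* Defs.v *)
From HB Require Import structures.
From mathcomp Require Import all_boot all_order all_algebra.
From mathcomp Require Import all_classical all_reals all_analysis.
From mathcomp Require Import complex.
Set Implicit Arguments. Unset Strict Implicit. Unset Printing Implicit Defensive.
Import Order.TTheory GRing.Theory Num.Theory.
Local Open Scope ring_scope.
Local Open Scope complex_scope.

Definition cfg (N : nat) := {ffun 'I_N -> int}.

Definition shift (N : nat) (x : cfg N) (k : 'I_N) (d : int) : cfg N :=
  [ffun j => if j == k then x j + d else x j].

Section Defs.
Variable R : realType.

Definition sqnormc (z : R[i]) : R := complex.Re z ^+ 2 + complex.Im z ^+ 2.

Definition in_l2 (N : nat) (psi : cfg N -> R[i]) : Prop :=
  (\esum_(x in [set: cfg N]) (sqnormc (psi x))%:E < +oo)%E.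

Definition totpos (N : nat) (x : cfg N) : int := \sum_(k < N) x k.

(* Domain of the self-adjoint H^(N): since Delta and V are bounded, it is the
   domain of the self-adjoint closure of sum_k X_k, i.e. the maximal domain of
   multiplication by x_1 + ... + x_N. *)
Definition domH (N : nat) (psi : cfg N -> R[i]) : Prop :=
  in_l2 psi /\ in_l2 (fun x => ((totpos x)%:~R : R)%:C * psi x).

(* (H^(N) psi)(x) in the position basis, with H_0 = g Delta - 2 h X,
   (Delta f)(j) = -(f(j-1) + f(j+1)), V = sum_{i<j} v(x_i - x_j). *)
Definition Hact (N : nat) (g h : R) (v : int -> R) (psi : cfg N -> R[i])
  (x : cfg N) : R[i] :=
  g%:C * (\sum_(k < N) - (psi (shift x k (-1)) + psi (shift x k 1)))
  - (2 * h * (totpos x)%:~R)%:C * psi x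
  + (\sum_(i < N) \sum_(j < N | (i < j)%N) v (x i - x j))%:C * psi x.

Definition eigvec (N : nat) (g h : R) (v : int -> R) (psi : cfg N -> R[i]) : Prop :=
  domH psi /\ (exists x, psi x != 0) /\
  exists E : R[i], forall x, Hact g h v psi x = E * psi x.

Definition pure_point (N : nat) (g h : R) (v : int -> R) : Prop :=
  forall phi : cfg N -> R[i], in_l2 phi ->
  forall eps : R, 0 < eps ->
  exists (m : nat) (c : 'I_m -> R[i]) (psis : 'I_m -> cfg N -> R[i]),
    (forall i, eigvec g h v (psis i)) /\
    (\esum_(x in [set: cfg N])
        (sqnormc (phi x - \sum_(i < m) c i * psis i x))%:E < eps%:E)%E.

End Defs.

(* Main.v *)
Require Import Defs.
From HB Require Import structures.
From mathcomp Require Import all_boot all_order all_algebra.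
From mathcomp Require Import all_classical all_reals all_analysis.
From mathcomp Require Import complex.
From mathcomp Require Import finmap zify ring lra.
Import Order.TTheory GRing.Theory Num.Theory.
Import numFieldNormedType.Exports.
Local Open Scope classical_set_scope.
Local Open Scope ring_scope.
Set Implicit Arguments.
Unset Strict Implicit.
Unset Printing Implicit Defensive.

(** The spectrum of the N-body operator is shown to be countable by induction on the number of
particles, and a self-adjoint operator with countable spectrum is pure point.  All matrix
entries are real, so one may work over real-valued functions.

Countable spectrum implies pure point: for a bounded self-adjoint A (a resolvent of H at a real
point outside the spectrum), a polynomial that is nonnegative on the spectrum has a nonnegative
value at A.  The polynomials q_n = (1 - (x - s)^2 / l)^(2n) are nonnegative, equal 1 at s, and
q_n(A) converges strongly to the projection onto the eigenspace of s.  Covering the compact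
countable spectrum by finitely many sets { q_s > 1/2 }, with <q_s(A) f, f> small compared to a
summable sequence, forces a vector f orthogonal to all eigenvectors to vanish.

Countability of the spectrum is an HVZ argument.  If A is a proper nonempty cluster, the
Hamiltonian without interaction between A and its complement is a sum of two commuting cluster
Hamiltonians; an eigenbasis of the first one shows that its spectrum lies in the sum of the two
cluster spectra (each of them is periodic, by translation of all the particles, which supplies
the compactness), hence is countable.  Away from those spectra H - mu is bounded below on
functions vanishing on a finite set: one localizes to large boxes, and in a box far from the
origin either the total position is large, or two clusters are far apart.  Finally, an interval
of length O(c) contains only finitely many spectral points mu at which H - mu is bounded below
by c off a given finite set, since otherwise a combination of nearly orthogonal approximate
eigenvectors would vanish on that set. *)

(** Countability of the spectrum, rather than pure point spectrum, is what the induction carries: it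
    survives the addition of two cluster spectra and the addition of the points produced by a
    decaying interaction, and it already excludes a continuous part. The assumption h != 0 acts
    twice: the potential dominates the bounded hopping wherever |x_1 + ... + x_N| is large, and each
    cluster spectrum becomes invariant under a nonzero translation. A single particle has no proper
    nonempty cluster, so H - mu is bounded below off a finite set for every mu. For several
    particles the level sets of the total position are infinite, the resolvent need not be compact,
    and the clusters come in.

    No spectral measure is used: mu is in the spectrum when no inequality c |f|^2 <= |(H - mu) f|^2
    with c > 0 holds on finitely supported f. Estimates stay with squared norms and mostly use |u +
    v|^2 <= 2 |u|^2 + 2 |v|^2, which is where most factors 2, 4 and 8 in the constants come from. *)

Record hilbert (R : realType) (V : lmodType R) := Hilbert {
  dot :> V -> V -> R;
  dotC : forall u v, dot u v = dot v u;
  dotDl : forall u v w, dot (u + v) w = dot u w + dot v w;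
  dotZl : forall a u w, dot (a *: u) w = a * dot u w;
  dot_ge0 : forall u, 0 <= dot u u;
  dot_eq0 : forall u, dot u u = 0 -> u = 0;
  dot_complete : forall u : nat -> V,
    (forall e, 0 < e -> exists N, forall m n, (N <= m)%N -> (N <= n)%N ->
       dot (u m - u n) (u m - u n) <= e) ->
    exists l, forall e, 0 < e -> exists N, forall n, (N <= n)%N ->
       dot (u n - l) (u n - l) <= e }.

(** * Real Hilbert spaces and orthogonal projection *)

Section Hilbert.
Context (R : realType) (V : lmodType R) (H : hilbert V).

Definition sq (u : V) : R := H u u.

Definition hcvg (u : nat -> V) (l : V) := forall e, 0 < e ->
  exists N, forall n, (N <= n)%N -> sq (u n - l) <= e.

Lemma dotDr u v w : H w (u + v) = H w u + H w v.
Proof. by rewrite dotC dotDl !(dotC H w). Qed.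
Lemma dotZr a u w : H w (a *: u) = a * H w u.
Proof. by rewrite dotC dotZl (dotC H w). Qed.
Lemma dotNl u w : H (- u) w = - H u w.
Proof. by rewrite -scaleN1r dotZl mulN1r. Qed.
Lemma dotNr u w : H w (- u) = - H w u.
Proof. by rewrite dotC dotNl dotC. Qed.
Lemma dotBl u v w : H (u - v) w = H u w - H v w.
Proof. by rewrite dotDl dotNl. Qed.
Lemma dotBr u v w : H w (u - v) = H w u - H w v.
Proof. by rewrite dotDr dotNr. Qed.
Lemma dot0l w : H 0 w = 0.
Proof. by rewrite -(scale0r w) dotZl mul0r. Qed.
Lemma dot0r w : H w 0 = 0.
Proof. by rewrite dotC dot0l. Qed.
Lemma dot_suml I (r : seq I) (P : pred I) (F : I -> V) w :
  H (\sum_(i <- r | P i) F i) w = \sum_(i <- r | P i) H (F i) w.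
Proof. by elim/big_rec2: _ => [|i a b _ <-]; rewrite ?dot0l ?dotDl. Qed.

Lemma sq_ge0 u : 0 <= sq u. Proof. exact: dot_ge0. Qed.
Lemma sqZ a u : sq (a *: u) = a ^+ 2 * sq u.
Proof. by rewrite /sq dotZl dotZr mulrA expr2. Qed.
Lemma sqD u v : sq (u + v) = sq u + 2 * H u v + sq v.
Proof. by rewrite /sq !dotDl !dotDr (dotC H v u); ring. Qed.
Lemma sqB u v : sq (u - v) = sq u - 2 * H u v + sq v.
Proof. by rewrite sqD dotNr /sq dotNl dotNr; ring. Qed.
Lemma sqN u : sq (- u) = sq u.
Proof. by rewrite /sq dotNl dotNr opprK. Qed.
Lemma sq_distC u v : sq (u - v) = sq (v - u).
Proof. by rewrite -sqN opprB. Qed.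
Lemma sq0 : sq 0 = 0. Proof. exact: dot0l. Qed.
Lemma sq_eq0 u : sq u = 0 -> u = 0. Proof. exact: dot_eq0. Qed.
Lemma sq_gt0 u : u != 0 -> 0 < sq u.
Proof.
move=> u0; rewrite lt_neqAle sq_ge0 andbT eq_sym.
by apply: contra u0 => /eqP/sq_eq0 ->.
Qed.

Lemma sqD_le u v : sq (u + v) <= 2 * sq u + 2 * sq v.
Proof. by have := sq_ge0 (u - v); rewrite sqB sqD; lra. Qed.

Lemma sq_triangle u v w : sq (u - w) <= 2 * sq (u - v) + 2 * sq (v - w).
Proof. by rewrite -(subrKA v u); exact: sqD_le. Qed.

(** Stands in for Cauchy-Schwarz so that estimates stay in terms of squared norms; the weight [t] is
    tuned at each use. *)
Lemma dot_young u v t : 0 < t -> `|H u v| <= (t * sq u + t^-1 * sq v) / 2.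
Proof.
move=> t0; have h1 := sq_ge0 (t *: u - v); have h2 := sq_ge0 (t *: u + v).
rewrite sqB sqZ dotZl in h1; rewrite sqD sqZ dotZl in h2.
have e1 : (t * sq u + t^-1 * sq v) / 2 = (t ^+ 2 * sq u + sq v) / (2 * t).
  by field; rewrite gt_eqF.
have t2 : 0 < 2 * t by rewrite mulr_gt0.
rewrite e1 ler_pdivlMr //.
by have [d0|d0] := ger0P (H u v); nra.
Qed.

Lemma sq_small0 u : (forall e, 0 < e -> sq u <= e) -> u = 0.
Proof.
move=> h; apply: sq_eq0; apply/eqP; rewrite eq_le sq_ge0 andbT.
by apply/ler_addgt0Pr => e e0; rewrite add0r; exact: h.
Qed.

Lemma hcvg_uniq u l l' : hcvg u l -> hcvg u l' -> l = l'.
Proof.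
move=> h h'; apply/eqP; rewrite -subr_eq0; apply/eqP/sq_small0 => e e0.
have e4 : 0 < e / 4 by rewrite divr_gt0.
have [N hN] := h _ e4; have [N' hN'] := h' _ e4.
have a := hN (maxn N N') (leq_maxl _ _); have b := hN' (maxn N N') (leq_maxr _ _).
have := sq_triangle l (u (maxn N N')) l'; rewrite (sq_distC l (u _)); lra.
Qed.

Lemma hcvg_dot u l w : hcvg u l -> forall e, 0 < e ->
  exists N, forall n, (N <= n)%N -> `|H (u n) w - H l w| <= e.
Proof.
move=> h e e0.
(* With this weight both Young terms are at most [e] as soon as [sq (u n - l)] is at most [e / t];
   the 1 covers [w = 0]. *)
have t0 : 0 < (sq w + 1) / e by rewrite divr_gt0 // ltr_wpDl // sq_ge0.
have [N hN] := h _ (divr_gt0 e0 t0).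
exists N => n /hN {}hN; rewrite -dotBl.
apply: le_trans (dot_young _ _ t0) _.
have w0 := sq_ge0 w.
have h1 : (sq w + 1) / e * sq (u n - l) <= e.
  by rewrite mulrC -ler_pdivlMr.
have h2 : ((sq w + 1) / e)^-1 * sq w <= e.
  rewrite invf_div mulrAC ler_pdivrMr ?ltr_wpDl //; nra.
lra.
Qed.

Lemma hcvg_bounded (A : {linear V -> V}) M u l :
  (forall v, sq (A v) <= M * sq v) -> hcvg u l -> hcvg (A \o u) (A l).
Proof.
move=> bM h e e0.
have M0 : 0 < `|M| + 1 by rewrite ltr_wpDl.
have [N hN] := h _ (divr_gt0 e0 M0).
exists N => n /hN {}hN /=; rewrite -linearB; apply: le_trans (bM _) _.
rewrite ler_pdivlMr // in hN.
apply: le_trans hN; rewrite mulrC ler_wpM2l ?sq_ge0 //.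
by rewrite (le_trans (ler_norm _)) // lerDl.
Qed.

(* Minimizing sequences for the distance to M are Cauchy by the parallelogram law. *)
Lemma projection (M : V -> Prop) (phi : V) : M 0 ->
  (forall a u v, M u -> M v -> M (a *: u + v)) ->
  exists (m : nat -> V) (xi : V), [/\ forall n, M (m n), hcvg m xi &
    forall k, M k -> H (phi - xi) k = 0].
Proof.
move=> M0 Mlin.
pose D := [set sq (phi - m) | m in [set m | M m]].
have hD : has_inf D.
  split; first by exists (sq (phi - 0)); exists 0.
  by exists 0 => _ [m _ <-]; exact: sq_ge0.
have dle m : M m -> inf D <= sq (phi - m).
  by move=> Mm; apply: ge_inf; [exact: hD.2 | exists m].
have ex n : exists m, M m /\ sq (phi - m) <= inf D + n.+1%:R^-1.
  have n0 : 0 < n.+1%:R^-1 :> R by rewrite invr_gt0.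
  have [_ [m Mm <-] lt] := inf_adherent n0 hD.
  by exists m; split => //; exact: ltW.
have {}[m hm] := choice ex.
have inv_small e : 0 < e -> exists N, forall n, (N <= n)%N -> n.+1%:R^-1 <= e :> R.
  move=> e0; exists (Num.truncn e^-1) => n Nn.
  rewrite -[leRHS]invrK lef_pV2 ?posrE ?invr_gt0 //.
  apply: ltW; apply: lt_le_trans (truncnS_gt _) _.
  by rewrite ler_nat ltnS.
have cau e : 0 < e -> exists N, forall i j, (N <= i)%N -> (N <= j)%N ->
    H (m i - m j) (m i - m j) <= e.
  move=> e0; have [N hN] := inv_small (e / 4) ltac:(lra).
  exists N => i j /hN hi /hN hj.
  have /dle hmid : M (2^-1 *: m i + 2^-1 *: m j).
    have := Mlin 2^-1 (m i) (2^-1 *: m j) (hm i).1.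
    by apply; rewrite -[_ *: _]addr0; apply: Mlin; [exact: (hm j).1|].
  have -> : H (m i - m j) (m i - m j) = 2 * sq (phi - m i) + 2 * sq (phi - m j)
    - 4 * sq (phi - (2^-1 *: m i + 2^-1 *: m j)).
    rewrite /sq !(dotDl, dotDr, dotNl, dotNr, dotZl, dotZr) ?opprD ?(dotDl, dotDr, dotNl, dotNr, dotZl, dotZr).
    by rewrite (dotC H (m j) (m i)) (dotC H (m i) phi) (dotC H (m j) phi); field.
  have hi' : sq (phi - m i) <= inf D + e / 4 by rewrite (le_trans (hm i).2) ?lerD2l.
  have hj' : sq (phi - m j) <= inf D + e / 4 by rewrite (le_trans (hm j).2) ?lerD2l.
  lra.
have [xi hxi] := dot_complete cau.
exists m, xi; split => //; first by move=> n; exact: (hm n).1.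
move=> k Mk.
(* First variation: [t *: k + m n] stays in [M], so its squared distance to [phi] is at least
   [inf D]; the inequality for [xi] follows by letting [n] grow. *)
have key t : 2 * t * H (phi - xi) k <= t ^+ 2 * sq k.
  apply/ler_addgt0Pr => e e0.
  have tn0 : 0 < `|t| + 1 by rewrite ltr_wpDl.
  have [N hN] := inv_small (e / 2) ltac:(lra).
  have e4 : 0 < e / (4 * (`|t| + 1)) by rewrite divr_gt0 // mulr_gt0.
  have [N' hN'] := hcvg_dot k hxi e4.
  pose n := maxn N N'.
  have h1 := hN n (leq_maxl _ _); have h2 := hN' n (leq_maxr _ _).
  have := dle _ (Mlin t k (m n) Mk (hm n).1).
  rewrite [t *: k + _]addrC opprD addrA sqB sqZ dotZr => h3.
  have h4 : sq (phi - m n) <= inf D + e / 2 by rewrite (le_trans (hm n).2) ?lerD2l.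
  have h5 : `|2 * t * (H (m n) k - H xi k)| <= e / 2.
    rewrite !normrM ger0_norm //.
    have : `|t| * `|H (m n) k - H xi k| <= `|t| * (e / (4 * (`|t| + 1))).
      by rewrite ler_wpM2l.
    have : `|t| * (e / (4 * (`|t| + 1))) <= e / 4.
      rewrite mulrA ler_pdivrMr ?mulr_gt0 //.
      have : 0 <= `|t| by []. nra.
    lra.
  rewrite ler_norml in h5; move: h5 => /andP[h5 h6].
  rewrite !dotBl in h3 *; lra.
apply/eqP; rewrite -normr_eq0 -[_ == 0]negbK; apply/negP => nz.
set b := H _ _ in key nz.
have b2 : 0 < b ^+ 2 by rewrite exprn_even_gt0 // -normr_eq0.
have k0 := sq_ge0 k.
(* This [t] turns [key] into 2 b^2 / (|k|^2 + 1) <= b^2 / (|k|^2 + 1), impossible for [b]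
   nonzero. *)
have := key (b / (sq k + 1)).
have -> : 2 * (b / (sq k + 1)) * b = 2 * b ^+ 2 / (sq k + 1) by field; rewrite gt_eqF ?ltr_wpDl.
have -> : (b / (sq k + 1)) ^+ 2 * sq k = b ^+ 2 / (sq k + 1) * (sq k / (sq k + 1)).
  by field; rewrite gt_eqF ?ltr_wpDl.
have q1 : sq k / (sq k + 1) <= 1 by rewrite ler_pdivrMr ?ltr_wpDl //; lra.
have q2 : 0 < b ^+ 2 / (sq k + 1) by rewrite divr_gt0 ?ltr_wpDl.
have -> : 2 * b ^+ 2 / (sq k + 1) = 2 * (b ^+ 2 / (sq k + 1)) by rewrite mulrA.
nra.
Qed.

End Hilbert.

Notation hilbert_sq := sq (only parsing).

(** * Spectral theory of bounded self-adjoint operators *)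

Section Spectral.
Context (R : realType) (V : lmodType R) (H : hilbert V).
Local Notation sq := (sq H).

Definition bounded_op (B : V -> V) := exists K, 0 < K /\ forall v, sq (B v) <= K * sq v.
Definition symmetric_op (B : V -> V) := forall u v, H (B u) v = H u (B v).
(** For a bounded symmetric operator on a Hilbert space this is non-invertibility: a lower bound
    makes the range closed, and symmetry makes it dense. *)
Definition noninv (B : V -> V) := forall c, 0 < c -> exists v, sq (B v) < c * sq v.

Lemma noninvPn (B : V -> V) : ~ noninv B ->
  exists2 c, 0 < c & forall v, c * sq v <= sq (B v).
Proof.
move=> /existsNP[c] /not_implyP[c0 /forallNP h]; exists c => // v.
by rewrite leNgt; apply/negP; exact: h.
Qed.

Lemma noninv_comp (B C : V -> V) : noninv (B \o C) -> noninv B \/ noninv C.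
Proof.
move=> h; apply: contrapT => /not_orP[/noninvPn[b b0 hb] /noninvPn[c c0 hc]].
have [v /=] := h (b * c) (mulr_gt0 b0 c0).
apply/negP; rewrite -leNgt; apply: le_trans (hb _).
by rewrite -mulrA ler_pM2l.
Qed.

Section operator.
Variable A : {linear V -> V}.

Definition pact (p : {poly R}) (v : V) := \sum_(i < size p) p`_i *: iter i A v.

Lemma pactE n (p : {poly R}) v : (size p <= n)%N -> pact p v = \sum_(i < n) p`_i *: iter i A v.
Proof.
move=> le; rewrite /pact (big_ord_widen_cond n predT (fun i => p`_i *: iter i A v)) //.
rewrite [RHS](bigID (fun i : 'I_n => (i < size p)%N)) /= [X in _ + X]big1 ?addr0 //.
by move=> i; rewrite -leqNgt => /leq_sizeP/(_ _ (leqnn _)) ->; rewrite scale0r.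
Qed.

Lemma pactD (p q : {poly R}) v : pact (p + q) v = pact p v + pact q v.
Proof.
pose n := maxn (size p) (size q).
rewrite !(@pactE n) ?leq_maxl ?leq_maxr ?size_polyD // -big_split /=.
by apply: eq_bigr => i _; rewrite coefD scalerDl.
Qed.

Lemma pactZ c p v : pact (c *: p) v = c *: pact p v.
Proof.
rewrite !(@pactE (size p)) ?size_scale_leq // scaler_sumr.
by apply: eq_bigr => i _; rewrite coefZ scalerA.
Qed.

Lemma pact_linear p a u v : pact p (a *: u + v) = a *: pact p u + pact p v.
Proof.
have it i : iter i A (a *: u + v) = a *: iter i A u + iter i A v.
  by elim: i => //= i ->; rewrite linearP.
rewrite /pact scaler_sumr -big_split; apply: eq_bigr => i _ /=.
by rewrite it scalerDr !scalerA (mulrC a).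
Qed.

HB.instance Definition _ p := GRing.isLinear.Build R V V *:%R (pact p)
  (fun a u v => pact_linear p a u v).

Lemma pactC c v : pact c%:P v = c *: v.
Proof. by rewrite (@pactE 1) ?size_polyC_leq1 // big_ord1 coefC. Qed.

Lemma pactMX p v : pact (p * 'X) v = pact p (A v).
Proof.
rewrite (@pactE (size p).+1); last by rewrite (leq_trans (size_polyMleq _ _)) ?size_polyX ?addn2.
rewrite big_ord_recl coefMX /= scale0r add0r; apply: eq_bigr => i _.
by rewrite coefMX /= -iterSr.
Qed.

Lemma pactX v : pact 'X v = A v.
Proof. by rewrite -['X]mul1r pactMX pactC scale1r. Qed.

Lemma pactM p q v : pact (p * q) v = pact p (pact q v).
Proof.
elim/poly_ind: q v => [|q c IH] v; first by rewrite mulr0 -polyC0 !pactC !scale0r linear0.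
rewrite mulrDr !pactD linearD mulrA !pactMX IH; congr (_ + _).
by rewrite mulrC mul_polyC pactZ pactC linearZ.
Qed.

Lemma pactB (p q : {poly R}) v : pact (p - q) v = pact p v - pact q v.
Proof. by rewrite pactD -[- q]scaleN1r pactZ scaleN1r. Qed.

Hypotheses (symA : symmetric_op A) (bdA : bounded_op A).

Lemma pact_sym p : symmetric_op (pact p).
Proof.
move=> u v; elim/poly_ind: p u v => [|p c IH] u v.
  by rewrite -polyC0 !pactC !scale0r dot0l dot0r.
rewrite !pactD !pactMX !pactC dotDl dotDr IH dotZl dotZr; congr (_ + _).
by rewrite symA -!pactX -!pactM mulrC.
Qed.

Lemma pact_bounded p : bounded_op (pact p).
Proof.
have [a [a0 ha]] := bdA; elim/poly_ind: p => [|p c [K [K0 hK]]].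
  by exists 1; split => // v; rewrite -polyC0 pactC scale0r sq0 mul1r sq_ge0.
exists (2 * (K * a) + 2 * c ^+ 2); split; first by apply: ltr_wpDr; rewrite ?mulr_gt0 // mulr_ge0 ?sqr_ge0.
move=> v; rewrite pactD pactMX pactC; apply: le_trans (sqD_le _ _ _) _.
have h1 := hK (A v); have h2 : K * sq (A v) <= K * (a * sq v) by rewrite ler_pM2l.
by rewrite sqZ; lra.
Qed.

Definition aspec := [set t | noninv (fun v => A v - t *: v)].

Lemma noninv_pact_eq p (B : V -> V) : (forall v, pact p v = B v) -> noninv (pact p) -> noninv B.
Proof. by move=> e h c /h[v]; exists v; rewrite -e. Qed.

Lemma noninv_constN (c : R) : c != 0 -> ~ noninv (pact c%:P).
Proof.
move=> c0 /(_ (c ^+ 2))[]; first by rewrite exprn_even_gt0.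
by move=> v; rewrite pactC sqZ ltxx.
Qed.

(* A - z is bounded below by |Im z| for a non-real root z of the polynomial. *)
Lemma noninv_root r : r != 0 -> noninv (pact r) -> exists2 t, root r t & aspec t.
Proof.
move: {2}(size r) (leqnn (size r)) => n; elim: n r => [|n IH] r.
  by rewrite leqn0 size_poly_eq0 => /eqP ->; rewrite eqxx.
move=> szr r0 nr.
have [/size1_polyC e|sz1] := leqP (size r) 1.
  rewrite e in nr; case: (noninv_constN _ nr).
  by apply: contra r0 => /eqP c0; rewrite e c0.
have : size (map_poly (real_complex R) r) != 1%N.
  by rewrite size_map_poly; case: (size r) sz1 => [|[]].
move=> /closed_rootP[z]; case: z => a b rz.
(* Once a nonconstant factor [d] has been split off, the induction hypothesis applies to the
   cofactor [q], whose roots are roots of [r]. *)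
have quad q d : r = q * d -> (1 < size d)%N -> noninv (pact q) ->
    exists2 t : R, root r t & aspec t.
  move=> e sd nq.
  have q0 : q != 0 by apply: contra r0 => /eqP q0; rewrite e q0 mul0r.
  have d0 : d != 0 by rewrite -size_poly_eq0; case: (size d) sd.
  have [|t rt st] := IH q _ q0 nq.
    move: szr; rewrite e size_mul //; case: (size d) sd => [|[|k]] //= _.
    rewrite addnS /= addnS ltnS => /(leq_trans _); apply; exact: leq_addr.
  by exists t => //; rewrite e rootM rt.
have [b0|b0] := eqVneq b 0.
  have ra : root r a.
    move: rz; rewrite b0 -(fmorph_root (real_complex R)) //.
  have /factor_theorem[q e] := ra.
  have /noninv_comp[nq|na] : noninv (pact q \o pact ('X - a%:P)).
    by apply: noninv_pact_eq nr => v; rewrite e pactM.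
  - by apply: quad e _ nq; rewrite size_XsubC.
  - by exists a => //; apply: noninv_pact_eq na => v; rewrite pactB pactX pactC.
(* The real quadratic with roots a + ib and a - ib. It divides [r] because the remainder has degree
   at most 1, real coefficients and a non-real root. *)
pose d := ('X - a%:P) ^+ 2 + (b ^+ 2)%:P.
have sd : size d = 3%N.
  rewrite /d size_polyDl ?size_exp_XsubC //.
  by rewrite (leq_ltn_trans (size_polyC_leq1 _)).
have dd : (d %| r)%R.
  have dz : (map_poly (real_complex R) d).[(a +i* b)%C] = 0.
    rewrite /d rmorphD /= map_polyC rmorphXn rmorphB /= map_polyX map_polyC !hornerE /=.
    rewrite [X in X + _]expr2; apply/eqP; rewrite eq_complex /=; apply/andP; split; apply/eqP; ring.
  have sm : (size (r %% d)%R <= 2)%N.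
    by rewrite -ltnS -sd ltn_modp -size_poly_eq0 sd.
  have : (map_poly (real_complex R) (r %% d)).[(a +i* b)%C] = 0.
    have := rz; rewrite {1}(divp_eq r d) rmorphD rmorphM /= rootE hornerD hornerM dz mulr0 add0r.
    by move/eqP.
  rewrite (_ : r %% d = ((r %% d)`_1)%:P * 'X + ((r %% d)`_0)%:P); last first.
    apply/polyP => i; rewrite coefD coefMX !coefC.
    case: i => [|[|i]] /=; rewrite ?add0r ?addr0 //.
    by rewrite nth_default // (leq_trans sm).
  rewrite rmorphD rmorphM /= map_polyX !map_polyC /= !hornerE /= => /eqP.
  rewrite eq_complex /= => /andP[/eqP h1 /eqP h2].
  have c1 : (r %% d)`_1 = 0.
    apply/eqP; have /eqP : (r %% d)`_1 * b = 0 by move: h2; rewrite mul0r !addr0.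
    by rewrite mulf_eq0 (negPf b0) orbF.
  have c0 : (r %% d)`_0 = 0 by move: h1; rewrite c1 !mul0r subr0 add0r.
  apply/modp_eq0P/polyP => i; rewrite coef0.
  case: i => [|[|i]] //; by rewrite nth_default // (leq_trans sm).
have e : r = (r %/ d) * d by rewrite divpK.
have /noninv_comp[nq|/(_ (b ^+ 4))[|v]] : noninv (pact (r %/ d) \o pact d).
  by apply: noninv_pact_eq nr => v; rewrite {1}e pactM.
- by apply: quad e _ nq; rewrite sd.
- by rewrite exprn_even_gt0.
(* By symmetry the cross term of |T^2 v + b^2 v|^2 is 2 b^2 |T v|^2 >= 0, so [pact d] is bounded
   below by b^4 and cannot be the non-invertible factor. *)
rewrite /d pactD expr2 pactM pactC.
set T := pact _; have -> : sq (T (T v) + b ^+ 2 *: v) =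
   sq (T (T v)) + 2 * b ^+ 2 * sq (T v) + b ^+ 4 * sq v.
  rewrite sqD sqZ dotZr (pact_sym ('X - a%:P) (T v) v) -/T -/(sq (T v)); ring.
have := sq_ge0 H (T (T v)); have := sq_ge0 H (T v); have := sqr_ge0 b; nra.
Qed.

(** [m] is the infimum of the quadratic form of p(A) on the unit sphere. Since Q = p(A) - m is
    nonnegative and bounded, |Q v|^2 is controlled by the form of Q at v, so near-minimizers are
    approximate null vectors of Q. *)
Lemma noninv_inf (p : {poly R}) (phi : V) : phi != 0 ->
  exists2 m, m * sq phi <= H (pact p phi) phi & noninv (pact (p - m%:P)).
Proof.
move=> phi0.
pose D := [set H (pact p v) v | v in [set v | sq v = 1]].
have [K [K0 hK]] := pact_bounded p.
have unit v : v != 0 -> sq ((Num.sqrt (sq v))^-1 *: v) = 1.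
  move=> v0; rewrite sqZ exprVn sqr_sqrtr ?sq_ge0 // mulVf // gt_eqF // sq_gt0 //.
have hD : has_inf D.
  split; first by exists (H (pact p ((Num.sqrt (sq phi))^-1 *: phi)) ((Num.sqrt (sq phi))^-1 *: phi)); eexists; [exact: unit phi0|].
  exists (- ((K + 1) / 2)) => _ [v /= v1 <-].
  have := dot_young H (pact p v) v ltr01; rewrite invr1 !mul1r ler_norml => /andP[h _].
  apply: le_trans h; rewrite lerN2; apply: ler_wpM2r => //.
  by rewrite lerD // ?v1 // (le_trans (hK _)) // v1 mulr1.
pose m := inf D.
have lem v : m * sq v <= H (pact p v) v.
  have [->|v0] := eqVneq v 0; first by rewrite sq0 mulr0 dot0r.
  have : m <= H (pact p ((Num.sqrt (sq v))^-1 *: v)) ((Num.sqrt (sq v))^-1 *: v).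
    by apply: ge_inf; [exact: hD.2 | eexists; [exact: unit v0|]].
  rewrite linearZ /= dotZl dotZr mulrA -expr2 exprVn sqr_sqrtr ?sq_ge0 //.
  by rewrite mulrC ler_pdivlMr ?sq_gt0.
exists m => // c c0.
pose Q := pact (p - m%:P).
have QE v : Q v = pact p v - m *: v by rewrite /Q pactB pactC.
have Qpos v : 0 <= H (Q v) v by rewrite QE dotBl dotZl subr_ge0 lem.
have [L [L0 hL]] := pact_bounded (p - m%:P).
(* Expand the nonnegative form of Q at v - Q v / (L + 1). *)
have key v : sq (Q v) <= (L + 1) * H (Q v) v.
  have L1 : 0 < L + 1 by rewrite ltr_wpDr.
  have := Qpos (v - (L + 1)^-1 *: Q v).
  rewrite {1}/Q linearB linearZ /= -/Q dotBl !dotBr !dotZl !dotZr.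
  rewrite (pact_sym (p - m%:P) (Q v) v) -/Q -/(sq (Q v)).
  have : H (Q (Q v)) (Q v) <= (L + 1) * sq (Q v).
    have := dot_young H (Q (Q v)) (Q v) ltr01; rewrite invr1 !mul1r => h.
    have := hL (Q v); rewrite -/Q => h'.
    have := ler_norm (H (Q (Q v)) (Q v)); have := sq_ge0 H (Q v).
    have := mulr_ge0 (ltW L0) (sq_ge0 H (Q v)); lra.
  set F := H (Q v) v; set s := sq (Q v); set G := H (Q (Q v)) _ => h1 h2.
  have h3 : (L + 1)^-1 * ((L + 1)^-1 * G) <= (L + 1)^-1 * s.
    by rewrite ler_pM2l ?invr_gt0 // mulrC ler_pdivrMr // mulrC.
  have h4 : (L + 1)^-1 * s <= F by lra.
  by rewrite mulrC ler_pdivrMr // in h4; rewrite mulrC.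
have cL : 0 < c / (L + 1) by rewrite divr_gt0 // ltr_wpDr.
have [_ [v /= v1 <-] lt] := inf_adherent cL hD.
exists v; rewrite v1 mulr1 (le_lt_trans (key v)) //.
rewrite mulrC -ltr_pdivlMr ?ltr_wpDr // QE dotBl dotZl -/(sq v) v1 mulr1.
by rewrite ltrBlDl.
Qed.

Lemma aspec_nonempty (phi : V) : phi != 0 -> aspec !=set0.
Proof.
move=> /(noninv_inf 'X)[m _ /noninv_root[]]; first by rewrite polyXsubC_eq0.
by move=> t _ ?; exists t.
Qed.

(** Replaces the spectral mapping theorem: the infimum [m] of the form of p(A) is a value of [p] on
    the spectrum, because p - m has a root there. If p is the constant [m], the spectrum only has to
    be nonempty. *)
Lemma pact_ge0 p phi : (forall t, aspec t -> 0 <= p.[t]) -> 0 <= H (pact p phi) phi.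
Proof.
move=> pos; have [->|phi0] := eqVneq phi 0; first by rewrite dot0r.
have [m le nm] := noninv_inf p phi0.
have m0 : 0 <= m.
  have [/eqP|r0] := eqVneq (p - m%:P) 0.
    rewrite subr_eq0 => /eqP pm; have [t /pos] := aspec_nonempty phi0.
    by rewrite pm hornerC.
  have [t rt /pos] := noninv_root r0 nm.
  by move: rt; rewrite rootE !hornerE subr_eq0 => /eqP ->.
by apply: le_trans le; rewrite mulr_ge0 ?sq_ge0.
Qed.

End operator.
End Spectral.

(** * Projections onto eigenspaces and density of eigenvectors *)

Section Eigenprojections.
Context (R : realType) (V : lmodType R) (H : hilbert V) (A : {linear V -> V}).
Hypotheses (symA : symmetric_op H A) (bdA : bounded_op H A).
Local Notation sq := (sq H).
Local Notation pact := (pact A).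

Definition is_eproj s phi psi :=
  A psi = s *: psi /\ forall chi, A chi = s *: chi -> H (phi - psi) chi = 0.

Lemma eproj_exists s phi : exists psi, is_eproj s phi psi.
Proof.
have [K [K0 hK]] := bdA.
have [||m [xi [hm cm ort]]] := @projection _ _ H (fun u => A u = s *: u) phi.
- by rewrite linear0 scaler0.
- by move=> a u v /= hu hv; rewrite linearP hu hv scalerDr !scalerA mulrC.
exists xi; split => //.
apply: (hcvg_uniq (hcvg_bounded hK cm)).
have hs : forall v, sq ((s \*: idfun) v) <= s ^+ 2 * sq v by move=> v; rewrite /= sqZ.
have := hcvg_bounded hs cm; rewrite /hcvg /= => h e /h[N hN].
by exists N => n /hN; rewrite hm.
Qed.

Lemma eproj_uniq s phi psi psi' : is_eproj s phi psi -> is_eproj s phi psi' -> psi = psi'.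
Proof.
move=> [e1 o1] [e2 o2]; apply/eqP; rewrite -subr_eq0; apply/eqP/(@sq_eq0 _ _ H).
have ed : A (psi - psi') = s *: (psi - psi') by rewrite linearB e1 e2 scalerBr.
have := o1 _ ed; have := o2 _ ed; rewrite /hilbert_sq !dotBl; lra.
Qed.

Lemma eig_orth s t u v : s != t -> A u = s *: u -> A v = t *: v -> H u v = 0.
Proof.
move=> st eu ev; have := symA u v; rewrite eu ev dotZl dotZr => /eqP.
by rewrite -subr_eq0 -mulrBl mulf_eq0 subr_eq0 (negPf st) => /eqP.
Qed.

Definition eproj s phi := projT1 (cid (eproj_exists s phi)).
Lemma eprojP s phi : is_eproj s phi (eproj s phi).
Proof. exact: projT2 (cid (eproj_exists s phi)). Qed.
Lemma eproj_eig s phi : A (eproj s phi) = s *: eproj s phi.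
Proof. exact: (eprojP s phi).1. Qed.

Lemma dot_eproj s phi chi : A chi = s *: chi -> H (eproj s phi) chi = H phi chi.
Proof. by move=> /(eprojP s phi).2; rewrite dotBl; lra. Qed.

Lemma eproj_sym s : symmetric_op H (eproj s).
Proof.
move=> u v; rewrite -(dot_eproj u (eproj_eig s v)) dotC.
by rewrite -(dot_eproj v (eproj_eig s u)) dotC.
Qed.

Lemma eproj_sq s phi : H phi (eproj s phi) = sq (eproj s phi).
Proof. by rewrite -(dot_eproj phi (eproj_eig s phi)). Qed.

Lemma eigenvalue_aspec s u : u != 0 -> A u = s *: u -> aspec H A s.
Proof.
by move=> u0 eu c c0; exists u; rewrite eu subrr sq0 mulr_gt0 // sq_gt0.
Qed.

(* q is a high power of 1 - (x - s)^2 / l, which is 1 at s and converges on the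
   spectrum to the indicator of s. *)
Lemma peak_poly s phi e : 0 < e -> exists q : {poly R},
  [/\ forall t, 0 <= q.[t], q.[s] = 1 &
      H (pact q phi) phi <= sq (eproj s phi) + e].
Proof.
move=> e0; have [K [K0 hK]] := bdA.
(* [l] bounds the squared norm of T = A - s, so that c(A) = 1 - T^2 / l is a contraction which fixes
   exactly the kernel of T. *)
pose l := 2 * K + 2 * s ^+ 2.
have l0 : 0 < l by apply: ltr_wpDr; rewrite ?mulr_gt0 // mulr_ge0 ?sqr_ge0.
pose T := pact ('X - s%:P).
have TE v : T v = A v - s *: v by rewrite /T pactB pactX pactC.
have hT v : sq (T v) <= l * sq v.
  rewrite TE -scaleNr; apply: le_trans (sqD_le _ _ _) _; rewrite sqZ sqrrN.
  by have := hK v; rewrite /l; lra.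
pose c := 1%:P - l^-1 *: ('X - s%:P) ^+ 2 : {poly R}.
have CE v : pact c v = v - l^-1 *: T (T v).
  by rewrite /c pactB pactC scale1r pactZ expr2 pactM.
have contr v : sq (pact c v) <= sq v - l^-1 * sq (T v).
  rewrite CE sqB dotZr sqZ -(pact_sym symA) -/T -/(sq (T v)).
  have h : l^-1 * (l^-1 * sq (T (T v))) <= l^-1 * sq (T v).
    by rewrite ler_pM2l ?invr_gt0 // mulrC ler_pdivrMr // mulrC.
  by rewrite expr2; lra.
have fix_c v : A v = s *: v -> forall n, pact (c ^+ n) v = v.
  move=> ev; elim=> [|n IH]; first by rewrite expr0 pactC scale1r.
  rewrite exprSr pactM CE (TE v) ev subrr /T linear0 scaler0 subr0 //.
pose phi' := phi - eproj s phi.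
have ort chi : A chi = s *: chi -> H phi' chi = 0 by exact: (eprojP s phi).2.
pose u k := pact (c ^+ k) phi'.
pose b k := sq (u k).
have bS k : b k.+1 <= b k.
  rewrite /b /u exprS pactM; apply: le_trans (contr _) _.
  by rewrite gerBl mulr_ge0 ?sq_ge0 ?invr_ge0 1?ltW.
have bmon m n : (m <= n)%N -> b n <= b m.
  elim: n => [|n IH]; first by rewrite leqn0 => /eqP ->.
  by rewrite leq_eqVlt => /orP[/eqP ->//|/IH h]; apply: le_trans (bS n) h.
pose D := [set b k | k in setT].
have hD : has_inf D.
  by split; [exists (b 0); exists 0%N | exists 0 => _ [k _ <-]; exact: sq_ge0].
have Dle k : inf D <= b k by apply: ge_inf; [exact: hD.2 | exists k].
(* By symmetry the inner product of two even iterates depends only on the sum of their indices;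
   convergence of the decreasing sequence [b] thus makes the even iterates Cauchy. *)
have uu m n : H (u (n + n)%N) (u (m + m)%N) = b (n + m)%N.
  rewrite /b /hilbert_sq /u (pact_sym symA) -pactM [RHS](pact_sym symA) -pactM -!exprD.
  by rewrite addnACA.
have cau d : 0 < d -> exists N, forall i j, (N <= i)%N -> (N <= j)%N ->
    H (u (i + i)%N - u (j + j)%N) (u (i + i)%N - u (j + j)%N) <= d.
  move=> d0; have [|_ [N _ <-] hN] := @inf_adherent _ D (d / 2) _ hD; first by rewrite divr_gt0.
  exists N => i j Ni Nj; rewrite -/(sq _) sqB uu -/(b _) -/(b _).
  have := bmon _ _ (leq_trans Ni (leq_addr i i)).
  have := bmon _ _ (leq_trans Nj (leq_addr j j)); have := Dle (i + j)%N; lra.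
have [psi cpsi] := dot_complete cau.
have cpsi' : hcvg H (fun n => u (n + n)%N) psi by [].
have [K2 [_ hK2]] := pact_bounded bdA (c ^+ 2).
have psifix : pact (c ^+ 2) psi = psi.
  apply: (hcvg_uniq (hcvg_bounded hK2 cpsi')) => d /cpsi'[N hN].
  exists N => n Nn; have := hN n.+1 (leqW Nn).
  by rewrite addSn addnS /u -addn2 exprD mulrC pactM.
(* [psi] is fixed by c(A)^2, so both contraction estimates are equalities and their loss, a multiple
   of |T psi|^2, vanishes. *)
have Tpsi : T psi = 0.
  apply: (@sq_eq0 _ _ H); apply/eqP; rewrite eq_le sq_ge0 andbT.
  have := contr (pact c psi); rewrite -pactM -expr2 psifix => h.
  have := contr psi; have := mulr_ge0 (ltW (_ : 0 < l^-1)) (sq_ge0 H (T (pact c psi))).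
  rewrite invr_gt0 => /(_ l0) h1 h2.
  have : l^-1 * sq (T psi) <= 0 by lra.
  by rewrite pmulr_rle0 ?invr_gt0.
(* [psi] is an eigenvector at [s] and a limit of vectors orthogonal to all such eigenvectors, hence
   orthogonal to itself. *)
have psi0 : psi = 0.
  apply: (@sq_small0 _ _ H) => d d0.
  have epsi : A psi = s *: psi by apply/eqP; rewrite -subr_eq0 -TE Tpsi.
  have [N hN] := hcvg_dot psi cpsi' d0.
  have := hN N (leqnn N); rewrite /u (pact_sym symA) fix_c // ort // sub0r normrN.
  by apply: le_trans; exact: ler_norm.
have [N hN] := cpsi' _ e0.
have := hN N (leqnn N); rewrite psi0 subr0 => small.
pose n := (N + N)%N.
(* A square is nonnegative everywhere, and by symmetry its form at [phi] is |c(A)^n phi|^2, which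
   splits orthogonally into the eigencomponent and [u n]. *)
exists (c ^+ n * c ^+ n); split.
- by move=> t; rewrite hornerM -expr2 sqr_ge0.
- have cs : c.[s] = 1 by rewrite /c hornerD hornerN hornerC hornerZ horner_exp hornerXsubC; ring.
  by rewrite hornerM horner_exp cs !expr1n mulr1.
rewrite pactM (pact_sym symA).
have -> : phi = eproj s phi + phi' by rewrite /phi' addrC subrK.
rewrite linearD /= fix_c ?eproj_eig // -/(u n).
rewrite -[H _ _]/(sq _) sqD.
have -> : H (eproj s phi) (u n) = 0.
  by rewrite dotC /u (pact_sym symA) fix_c ?eproj_eig // ort // eproj_eig.
have eE : eproj s (eproj s phi + phi') = eproj s phi by rewrite /phi' addrC subrK.
by rewrite eE mulr0 addr0 lerD2l.
Qed.

Lemma aspec_bounded : exists M, forall t, aspec H A t -> `|t| <= M.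
Proof.
have [K [K0 hK]] := bdA; exists (1 + 2 * K) => t st.
rewrite leNgt; apply/negP => lt.
have t2 : 1 + 2 * K < t ^+ 2.
  rewrite -real_normK ?num_real // (lt_trans lt) // expr2 ltr_pMr; lra.
have [v] := st ((t ^+ 2 - 2 * K) / 2) ltac:(rewrite divr_gt0 //; lra).
have := sq_triangle H (t *: v) (A v) 0; rewrite !subr0 sqZ sq_distC.
have := hK v; lra.
Qed.

Lemma resolvent_open t : ~ aspec H A t ->
  exists2 d, 0 < d & forall t', `|t - t'| < d -> ~ aspec H A t'.
Proof.
move=> /noninvPn[c c0 hc].
have c4 : 0 < c / 4 by rewrite divr_gt0.
exists (Num.min 1 (c / 4)); first by rewrite lt_min ltr01.
move=> t'; rewrite lt_min => /andP[d1 d2] /(_ _ c4)[v].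
apply/negP; rewrite -leNgt.
have := sq_triangle H (A v) (t' *: v) (t *: v); rewrite -scalerBl.
rewrite sqZ; have := hc v.
have : (t' - t) ^+ 2 <= c / 4.
  rewrite -real_normK ?num_real // distrC expr2.
  by have := normr_ge0 (t - t'); nra.
have := sq_ge0 H v; nra.
Qed.

Section approximation.
Hypothesis cA : countable (aspec H A).

Lemma sq_eproj_sum phi (ss : seq R) : uniq ss ->
  sq (phi - \sum_(s <- ss) eproj s phi) = sq phi - \sum_(s <- ss) sq (eproj s phi).
Proof.
move=> us; rewrite sqB.
have -> : H phi (\sum_(s <- ss) eproj s phi) = \sum_(s <- ss) sq (eproj s phi).
  by rewrite dotC dot_suml; apply: eq_bigr => s _; rewrite dotC eproj_sq.
have -> : sq (\sum_(s <- ss) eproj s phi) = \sum_(s <- ss) sq (eproj s phi).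
  rewrite /hilbert_sq dot_suml big_seq [RHS]big_seq; apply: eq_bigr => s sss.
  rewrite dotC dot_suml (bigD1_seq s) //= big1 ?addr0 // => t ts.
  by apply: (eig_orth ts); exact: eproj_eig.
lra.
Qed.

Lemma sum_half_powers (ns : seq nat) : uniq ns -> \sum_(n <- ns) 2^-1 ^+ n.+1 <= 1 :> R.
Proof.
move=> un; pose M := (\max_(n <- ns) n).+1.
have : {subset ns <= index_iota 0 M}.
  by move=> n nn; rewrite mem_index_iota /= ltnS; exact: leq_bigmax_seq.
move=> sub.
have /le_trans : \sum_(n <- ns) 2^-1 ^+ n.+1 <= \sum_(0 <= n < M) 2^-1 ^+ n.+1 :> R.
  rewrite [leRHS](bigID (mem ns)) /= -[leLHS]addr0; apply: lerD.
    rewrite -[leRHS]big_filter le_eqVlt; apply/orP; left; apply/eqP; apply: perm_big.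
    apply: uniq_perm => // [|n]; first by rewrite filter_uniq // iota_uniq.
    by rewrite mem_filter; case: (boolP (n \in ns)) => //= /sub ->.
  by apply: sumr_ge0 => n _; rewrite exprn_ge0 // invr_ge0.
apply.
have -> : \sum_(0 <= n < M) 2^-1 ^+ n.+1 = 1 - 2^-1 ^+ M :> R.
  elim: M {sub} => [|m IH]; first by rewrite big_nil expr0 subrr.
  by rewrite big_nat_recr //= IH exprS; field.
by rewrite gerBl exprn_ge0 // invr_ge0.
Qed.

(** Take finitely many points whose projections carry all but e/4 of the supremum of captured mass.
    The remainder [phi'] then has mass at most e/4 on every finite set of spectral points, and the
    covering yields |phi'|^2 <= 2 (e/4 + e/4). *)
Theorem eproj_approx phi e : 0 < e -> exists ss : seq R,
  [/\ uniq ss, forall s, s \in ss -> aspec H A s &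
     sq (phi - \sum_(s <- ss) eproj s phi) <= e].
Proof.
move=> e0.
pose good (ss : seq R) := uniq ss /\ forall s, s \in ss -> aspec H A s.
pose D := [set \sum_(s <- ss) sq (eproj s phi) | ss in [set ss | good ss]].
have hD : has_sup D.
  split; first by exists (\sum_(s <- [::]) sq (eproj s phi)); exists [::].
  exists (sq phi) => _ [ss [us _] <-].
  by have := sq_ge0 H (phi - \sum_(s <- ss) eproj s phi); rewrite sq_eproj_sum // subr_ge0.
have d0 : 0 < e / 4 by rewrite divr_gt0.
set d := e / 4 in d0.
have [_ [ss0 [us0 as0] <-] lt] := sup_adherent d0 hD.
exists ss0; split => //.
set phi' := phi - _.
have pE s : eproj s phi' = if s \in ss0 then 0 else eproj s phi.
  apply: eproj_uniq (eprojP s phi') _; split.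
    by case: ifP; rewrite ?linear0 ?scaler0 ?eproj_eig.
  move=> chi echi; have h : \sum_(t <- ss0) H (eproj t phi) chi =
      if s \in ss0 then H phi chi else 0.
    case: ifPn => sin.
      rewrite (bigD1_seq s) //= big1 ?addr0 ?dot_eproj // => t ts.
      by apply: eig_orth ts (eproj_eig t phi) echi.
    rewrite big_seq big1 // => t tin.
    apply: eig_orth _ (eproj_eig t phi) echi.
    by apply: contraNneq sin => <-.
  rewrite dotBl [H phi' chi]dotBl dot_suml h.
  by case: ifP; rewrite ?dot0l ?dot_eproj //; lra.
have sumle ss : good ss -> \sum_(s <- ss) sq (eproj s phi') <= d.
  move=> [us ass]; have : D (\sum_(s <- ss0 ++ [seq s <- ss | s \notin ss0]) sq (eproj s phi)).
    exists (ss0 ++ [seq s <- ss | s \notin ss0]) => //; split.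
      rewrite cat_uniq us0 filter_uniq // andbT /=; apply/hasPn => s.
      by rewrite mem_filter => /andP[].
    by move=> s; rewrite mem_cat mem_filter => /orP[/as0//|/andP[_ /ass]].
  move=> /(ub_le_sup hD.2); rewrite big_cat /= big_filter.
  have -> : \sum_(s <- ss | s \notin ss0) sq (eproj s phi) = \sum_(s <- ss) sq (eproj s phi').
    rewrite big_mkcond; apply: eq_bigr => s _; rewrite pE.
    by case: ifP => /= h; rewrite ?sq0; move: h => /=; case: (s \in ss0); rewrite ?sq0.
  lra.
(* Countability supplies the weights 2^-(f s + 1), whose sum over any finite set of spectral points
   is at most 1. *)
have /countable_injP[f finj] := cA.
have /choice[q hq] : forall s, exists q : {poly R}, [/\ forall t, 0 <= q.[t], q.[s] = 1 &
    H (pact q phi') phi' <= sq (eproj s phi') + d * 2^-1 ^+ (f s).+1].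
  by move=> s; apply: peak_poly; rewrite mulr_gt0 // exprn_gt0 // invr_gt0.
(* For [s] outside the spectrum the set consists of balls free of spectral points, so the sets cover
   a whole compact interval and not just the spectrum. Such an [s] contributes no spectral point and
   is filtered out of [ss]. *)
pose U s := [set t | aspec H A s /\ 2^-1 < (q s).[t]] `|`
            [set t | ~ aspec H A s /\ exists2 r : R, 0 < r & (`|s - t| < r /\ 
               forall t', `|s - t'| < r -> ~ aspec H A t')].
have Uopen s : open (U s).
  apply: openU.
    have [as_|nas] := pselect (aspec H A s).
      rewrite (_ : [set _ | _] = horner (q s) @^-1` [set t | 2^-1 < t]).
        by apply: open_comp => [x _|]; [exact: continuous_horner | exact: open_gt].
      by apply/seteqP; split => t /= => [[]|].
    by rewrite (_ : [set _ | _] = set0) ?open0 //; apply/seteqP; split => t // [].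
  rewrite (_ : [set _ | _] = \bigcup_(r in [set r | 0 < r /\ ~ aspec H A s /\
      forall t', `|s - t'| < r -> ~ aspec H A t']) ball s r).
    by apply: bigcup_open => r [r0 _]; exact: ball_open.
  apply/seteqP; split => t /=.
    by move=> [ns [r r0 [lt1 h]]]; exists r.
  by move=> [r /= [r0 [ns h]] lt1]; split => //; exists r.
have [M hM] := aspec_bounded.
have := @segment_compact R (- M) M; rewrite compact_cover => /(_ R setT U) [//||D' _ cov].
  move=> t _; exists t => //.
  have [as_|nas] := pselect (aspec H A t).
    by left; split => //; have [_ -> _] := hq t; rewrite invf_lt1 ?ltr1n.
  by right; split => //; have [r r0 hr] := resolvent_open nas; exists r => //; rewrite subrr normr0.
pose ss := [seq s <- finmap.enum_fset D' | `[< aspec H A s >]].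
have gss : good ss.
  split; first by rewrite filter_uniq // finmap.fset_uniq.
  by move=> s; rewrite mem_filter => /andP[/asboolP].
(* Every spectral point has some [q s] above 1/2 while the others are nonnegative, so the form of
   twice the sum dominates |phi'|^2. *)
have /pact_ge0 : forall t, aspec H A t -> 0 <= (2 *: \sum_(s <- ss) q s - 1%:P).[t].
  move=> t st; have [s /= sD' Ust] : cover [set` D'] U t.
    by apply: cov; rewrite /= in_itv /= -ler_norml; exact: hM.
  have {Ust}[as_ gt] : aspec H A s /\ 2^-1 < (q s).[t].
    by case: Ust => // -[_ [r _ [lt1 /(_ _ lt1)]]].
  have sss : s \in ss by rewrite mem_filter asboolT.
  rewrite !hornerE horner_sum (bigD1_seq s) //=; last exact: gss.1.
  have : 0 <= \sum_(i <- ss | i != s) (q i).[t].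
    by apply: sumr_ge0 => i _; have [h _ _] := hq i.
  lra.
move=> /(_ symA bdA phi'); rewrite pactB pactZ pactC scale1r dotBl dotZl.
have -> : pact (\sum_(s <- ss) q s) phi' = \sum_(s <- ss) pact (q s) phi'.
  elim/big_rec2: _ => [|s u p _ <-]; first by rewrite -polyC0 pactC scale0r.
  by rewrite pactD.
rewrite dot_suml -/(sq phi') => key.
have : \sum_(s <- ss) H (pact (q s) phi') phi' <=
       \sum_(s <- ss) (sq (eproj s phi') + d * 2^-1 ^+ (f s).+1).
  by apply: ler_sum => s _; have [_ _] := hq s.
rewrite big_split /= -mulr_sumr.
have := sumle _ gss.
have : \sum_(s <- ss) 2^-1 ^+ (f s).+1 <= 1 :> R.
  rewrite -(big_map f xpredT (fun n => 2^-1 ^+ n.+1)); apply: sum_half_powers.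
  rewrite map_inj_in_uniq; first exact: gss.1.
  by move=> x y /gss.2 hx /gss.2 hy; apply: finj; exact: mem_set.
rewrite -(ler_pM2l d0) mulr1.
move: key; rewrite /d; lra.
Qed.

End approximation.
End Eigenprojections.

(** * The Hilbert space of square-summable functions *)

Section Sums.
Context (R : realType) (T : choiceType).
Implicit Types (f g h k : T -> R).

Lemma esumZ (D : set T) (c : R) (a : T -> \bar R) : 0 <= c -> (forall x, (0 <= a x)%E) ->
  \esum_(x in D) (c%:E * a x)%E = (c%:E * \esum_(x in D) a x)%E.
Proof.
move=> c0 a0; rewrite /esum -ereal_supZl //; last first.
  by apply/set0P; exists 0%E; exists set0; [exact: fsets_set0 | rewrite fsbig_set0].
congr ereal_sup; apply/seteqP; split => [_ [A [fA AD] <-]|_ [_ [A [fA AD] <-] <-]] /=.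
  by exists (\sum_(x \in A) a x)%E; [exists A | rewrite ge0_mule_fsumr].
by exists A => //; rewrite ge0_mule_fsumr.
Qed.

Definition absum h := (\esum_(x in [set: T]) `|h x|%:E < +oo)%E.
(* Meaningful only when absum h: fine sends an infinite sum to 0. *)
Definition tsum h : R :=
  fine (\esum_(x in [set: T]) (Num.max (h x) 0)%:E) -
  fine (\esum_(x in [set: T]) (Num.max (- h x) 0)%:E).

Lemma le_absum h k : (forall x, `|h x| <= `|k x|) -> absum k -> absum h.
Proof. by move=> le; apply: le_lt_trans; apply: le_esum => x _; rewrite lee_fin. Qed.

Lemma absumD h k : absum h -> absum k -> absum (fun x => h x + k x).
Proof.
move=> sh sk; have : (\esum_(x in [set: T]) (`|h x|%:E + `|k x|%:E) < +oo)%E.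
  by rewrite esumD ?lte_add_pinfty // => x _; rewrite lee_fin.
by apply: le_lt_trans; apply: le_esum => x _; rewrite -EFinD lee_fin ler_normD.
Qed.

Lemma esum_fin (a : T -> \bar R) : (forall x, 0 <= a x)%E ->
  (\esum_(x in [set: T]) a x < +oo)%E -> \esum_(x in [set: T]) a x \is a fin_num.
Proof. by move=> a0 lt; rewrite ge0_fin_numE //; apply: esum_ge0. Qed.

Lemma absumZ c h : absum h -> absum (fun x => c * h x).
Proof.
rewrite /absum => sh; rewrite (eq_esum (b := fun x => (`|c|%:E * `|h x|%:E)%E)); last first.
  by move=> x _; rewrite normrM EFinM.
rewrite esumZ //.
by rewrite -(fineK (esum_fin _ sh)) -?EFinM ?ltry // => x; rewrite lee_fin.
Qed.

Lemma absum_pos h : absum h -> absum (fun x => Num.max (h x) 0).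
Proof.
apply: le_absum => x; rewrite ger0_norm ?le_max ?lexx ?orbT //.
by rewrite ge_max ler_norm normr_ge0.
Qed.

Lemma absum_neg h : absum h -> absum (fun x => Num.max (- h x) 0).
Proof. by move=> sh; apply: absum_pos; apply: le_absum sh => x; rewrite normrN. Qed.

Lemma ge0_esum_fin h : (forall x, 0 <= h x) -> absum h ->
  \esum_(x in [set: T]) (h x)%:E \is a fin_num.
Proof.
move=> h0 sh; apply: esum_fin => [x|]; first by rewrite lee_fin.
by apply: le_lt_trans sh; apply: le_esum => x _; rewrite lee_fin ler_norm.
Qed.

Lemma ge0_tsumE h : (forall x, 0 <= h x) -> tsum h = fine (\esum_(x in [set: T]) (h x)%:E).
Proof.
move=> h0; rewrite /tsum [X in _ - fine X]esum1 ?subr0; last first.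
  by move=> x _; rewrite max_r // oppr_le0.
by congr fine; apply: eq_esum => x _; rewrite max_l.
Qed.

Lemma ge0_tsum_esum h : (forall x, 0 <= h x) -> absum h ->
  (tsum h)%:E = \esum_(x in [set: T]) (h x)%:E.
Proof. by move=> h0 sh; rewrite ge0_tsumE // fineK // ge0_esum_fin. Qed.

Lemma tsum_ge0 h : (forall x, 0 <= h x) -> 0 <= tsum h.
Proof.
by move=> h0; rewrite ge0_tsumE // fine_ge0 // esum_ge0 // => x _; rewrite lee_fin.
Qed.

Lemma ge0_tsumD h k : (forall x, 0 <= h x) -> (forall x, 0 <= k x) -> absum h -> absum k ->
  tsum (fun x => h x + k x) = tsum h + tsum k.
Proof.
move=> h0 k0 sh sk; rewrite !ge0_tsumE //; last by move=> x; rewrite addr_ge0.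
under eq_esum do rewrite EFinD.
rewrite esumD => [|x _|x _]; rewrite ?lee_fin //.
by rewrite fineD // ge0_esum_fin.
Qed.

Lemma tsum_posneg h : tsum h = tsum (fun x => Num.max (h x) 0) - tsum (fun x => Num.max (- h x) 0).
Proof. by rewrite [in LHS]/tsum !ge0_tsumE // => x; rewrite le_max lexx orbT. Qed.

Lemma eq_tsum h k : (forall x, h x = k x) -> tsum h = tsum k.
Proof. by move=> /funext ->. Qed.

(** Both (h - k)^+ + k and (h - k)^- + h equal max(h, k), which reduces the claim to nonnegative
    families. *)
Lemma tsum_diff h k : (forall x, 0 <= h x) -> (forall x, 0 <= k x) -> absum h -> absum k ->
  tsum (fun x => h x - k x) = tsum h - tsum k.
Proof.
move=> h0 k0 sh sk; rewrite tsum_posneg.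
have sd : absum (fun x => h x - k x).
  by apply: absumD => //; apply: le_absum sk => x; rewrite normrN.
have p0 (u : T -> R) x : 0 <= Num.max (u x) 0 by rewrite le_max lexx orbT.
have := ge0_tsumD (p0 (fun x => h x - k x)) k0 (absum_pos sd) sk.
have := ge0_tsumD (p0 (fun x => - (h x - k x))) h0 (absum_neg sd) sh.
rewrite (eq_tsum (k := fun x => Num.max (h x - k x) 0 + k x)); last first.
  by move=> x; rewrite /Num.max; case: ltP => ?; case: ltP => ?; lra.
move=> ->; lra.
Qed.

Lemma tsumD h k : absum h -> absum k -> tsum (fun x => h x + k x) = tsum h + tsum k.
Proof.
move=> sh sk; have p0 (u : T -> R) x : 0 <= Num.max (u x) 0 by rewrite le_max lexx orbT.
rewrite (tsum_posneg h) (tsum_posneg k).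
rewrite (eq_tsum (k := fun x => (Num.max (h x) 0 + Num.max (k x) 0) -
    (Num.max (- h x) 0 + Num.max (- k x) 0))); last first.
  by move=> x; rewrite /Num.max; do 4 (case: ltP => ?); lra.
have [ph pk nh nk] := And4 (absum_pos sh) (absum_pos sk) (absum_neg sh) (absum_neg sk).
have q0 (u : T -> R) x : 0 <= Num.max (- u x) 0 by rewrite le_max lexx orbT.
rewrite tsum_diff; [ | by move=> x; rewrite addr_ge0 | by move=> x; rewrite addr_ge0
  | exact: absumD | exact: absumD].
by rewrite !ge0_tsumD //; lra.
Qed.

Lemma tsumN h : tsum (fun x => - h x) = - tsum h.
Proof. by rewrite /tsum opprB; congr (_ - fine _); apply: eq_esum => x _; rewrite opprK. Qed.

Lemma tsumZ c h : absum h -> tsum (fun x => c * h x) = c * tsum h.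
Proof.
move=> sh; have p0 (u : T -> R) x : 0 <= Num.max (u x) 0 by rewrite le_max lexx orbT.
have ge0 b k : 0 <= b -> (forall x, 0 <= k x) -> absum k -> tsum (fun x => b * k x) = b * tsum k.
  move=> b0 k0 sk; rewrite !ge0_tsumE // => [|x]; last by rewrite mulr_ge0.
  under eq_esum do rewrite EFinM.
  by rewrite esumZ // fineM // ge0_esum_fin.
have pos b : 0 <= b -> tsum (fun x => b * h x) = b * tsum h.
  move=> b0; rewrite (tsum_posneg h) mulrBr.
  rewrite -(ge0 b _ b0 (p0 h) (absum_pos sh)) -(ge0 b _ b0 (p0 (fun x => - h x)) (absum_neg sh)).
  rewrite (tsum_posneg (fun x => b * h x)); congr (_ - _); apply: eq_tsum => x.
    by rewrite maxr_pMr // mulr0.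
  by rewrite maxr_pMr // mulr0 mulrN.
have [c0|c0] := leP 0 c; first exact: pos.
rewrite -[c]opprK [in RHS]mulNr -pos ?oppr_ge0 ?ltW // -tsumN.
by apply: eq_tsum => x; rewrite !mulNr opprK.
Qed.

Lemma le_tsum h k : absum h -> absum k -> (forall x, h x <= k x) -> tsum h <= tsum k.
Proof.
move=> sh sk le; have -> : k = fun x => h x + (k x - h x).
  by apply/funext => x; rewrite addrC subrK.
have sd : absum (fun x => k x - h x).
  by apply: absumD => //; apply: le_absum sh => x; rewrite normrN.
by rewrite tsumD // lerDl tsum_ge0 // => x; rewrite subr_ge0.
Qed.

Lemma absum_fsupp h : finite_set [set x | h x != 0] -> absum h.
Proof.
move=> fh; rewrite /absum (esumID [set x | h x != 0]) //.
rewrite [X in (_ + X)%E]esum1 ?adde0; last first.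
  by move=> x [_ /=]; have [->|] := eqVneq (h x) 0; rewrite ?normr0.
rewrite setTI esum_fset //.
by rewrite fsbig_finite //= sumEFin ltry.
Qed.

Lemma tsum_single a h : (forall x, x != a -> h x = 0) -> tsum h = h a.
Proof.
have nn k : (forall x, 0 <= k x) -> (forall x, x != a -> k x = 0) -> tsum k = k a.
  move=> k0 z; rewrite ge0_tsumE // (esumID [set a]) //; last by move=> x _; rewrite lee_fin.
  rewrite setTI esum_set1 ?lee_fin // [X in (_ + X)%E]esum1 ?adde0 //.
  by move=> x [_ /= /eqP/z ->].
move=> z; rewrite tsum_posneg !nn; last 4 first.
- by move=> x; rewrite le_max lexx orbT.
- by move=> x /z ->; rewrite oppr0 maxxx.
- by move=> x; rewrite le_max lexx orbT.
- by move=> x /z ->; rewrite maxxx.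
by rewrite /Num.max; do 2 (case: ltP => ?); lra.
Qed.

Lemma tsum_le_bound h M : (forall x, 0 <= h x) ->
  (forall A : set T, finite_set A -> \sum_(x \in A) h x <= M) ->
  absum h /\ tsum h <= M.
Proof.
move=> h0 hM.
have le : (\esum_(x in [set: T]) (h x)%:E <= M%:E)%E.
  apply: ub_ereal_sup => _ [A [fA _] <-].
  by rewrite fsbig_finite //= sumEFin lee_fin -fsbig_finite // hM.
have sh : absum h.
  apply: le_lt_trans (ltry M); apply: le_trans le.
  by apply: le_esum => x _; rewrite ger0_norm.
by split => //; rewrite -lee_fin ge0_tsum_esum.
Qed.

Lemma ge0_le_fsum_tsum h (A : set T) : (forall x, 0 <= h x) -> absum h -> finite_set A ->
  \sum_(x \in A) h x <= tsum h.
Proof.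
move=> h0 sh fA; rewrite -lee_fin ge0_tsum_esum //; apply: ereal_sup_ubound.
by exists A => //; rewrite !fsbig_finite //= sumEFin.
Qed.

Lemma ge0_le_tsum h a : (forall x, 0 <= h x) -> absum h -> h a <= tsum h.
Proof.
by move=> h0 sh; have := ge0_le_fsum_tsum h0 sh (finite_set1 a); rewrite fsbig_set1.
Qed.

Lemma tsum_tail h e : (forall x, 0 <= h x) -> absum h -> 0 < e ->
  exists2 A : set T, finite_set A & forall B, A `<=` B -> tsum (fun x => if x \in B then 0 else h x) <= e.
Proof.
move=> h0 sh e0.
have [|_ [A [fA _] <-] lt] := ub_ereal_sup_adherent e0 (_ : ereal_sup
   [set (\sum_(x \in A) (h x)%:E)%E | A in fsets [set: T]] \is a fin_num).
  exact: ge0_esum_fin.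
exists A => // B AB.
pose h1 x := if x \in B then h x else 0.
pose h2 x := if x \in B then 0 else h x.
have [s1 s2] : absum h1 /\ absum h2.
  by split; apply: le_absum sh => x; rewrite /h1 /h2; case: ifP; rewrite ?normr0.
have eh : tsum h = tsum h1 + tsum h2.
  rewrite -tsumD //; apply: eq_tsum => x; rewrite /h1 /h2.
  by case: ifP; rewrite ?addr0 ?add0r.
have : \sum_(x \in A) h1 x <= tsum h1.
  by apply: ge0_le_fsum_tsum => // x; rewrite /h1; case: ifP.
have -> : \sum_(x \in A) h1 x = \sum_(x \in A) h x.
  by apply: eq_fsbigr => x /set_mem/AB Bx; rewrite /h1 mem_set.
move: lt; rewrite [X in (X - _ < _)%E](_ : _ = (tsum h)%:E); last by rewrite ge0_tsum_esum.
by rewrite fsbig_finite //= sumEFin -EFinB lte_fin -fsbig_finite // -/h2 eh; lra.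
Qed.

End Sums.

Lemma tsum_reindex (R : realType) (T T' : choiceType) (e : T -> T') (h : T' -> R) :
  bijective e -> tsum (h \o e) = tsum h.
Proof.
move=> be; rewrite /tsum; congr (fine _ - fine _).
  by rewrite (@reindex_esum _ _ _ [set: T] [set: T'] e) // setTT_bijective.
by rewrite (@reindex_esum _ _ _ [set: T] [set: T'] e) // setTT_bijective.
Qed.

Lemma absum_reindex (R : realType) (T T' : choiceType) (e : T -> T') (h : T' -> R) :
  bijective e -> absum h -> absum (h \o e).
Proof.
move=> be; rewrite /absum (@reindex_esum _ _ _ [set: T] [set: T'] e) // ?setTT_bijective //.
Qed.

Section L2.
Context (R : realType) (T : choiceType).
Implicit Types (f g h : T -> R).

Definition l2 f := absum (fun x => f x ^+ 2).
Definition dotp f g := tsum (fun x => f x * g x).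
Definition n2 f := tsum (fun x => f x ^+ 2).
(** The squared norm in the extended reals, so that sums can be exchanged before summability is
    known. *)
Definition nsq f := \esum_(x in [set: T]) (f x ^+ 2)%:E.
Definition fsupp f := finite_set [set x | f x != 0].

Lemma le_l2 f g : (forall x, `|f x| <= `|g x|) -> l2 g -> l2 f.
Proof.
move=> le; apply: le_absum => x; rewrite !normrX.
by rewrite lerXn2r ?nnegrE.
Qed.

Lemma l2Z a f : l2 f -> l2 (fun x => a * f x).
Proof.
move=> sf; apply: le_absum (absumZ (a ^+ 2) sf) => x.
by rewrite exprMn.
Qed.

Lemma l2D f g : l2 f -> l2 g -> l2 (fun x => f x + g x).
Proof.
move=> sf sg; apply: le_absum (absumD (absumZ 2 sf) (absumZ 2 sg)) => x.
have [hf hg] := (sqr_ge0 (f x), sqr_ge0 (g x)).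
rewrite [leRHS]ger0_norm; last lra.
by rewrite ger0_norm ?sqr_ge0 //; have := sqr_ge0 (f x - g x); lra.
Qed.

Lemma l2N f : l2 f -> l2 (fun x => - f x).
Proof. by apply: le_l2 => x; rewrite normrN. Qed.

Lemma l2B f g : l2 f -> l2 g -> l2 (fun x => f x - g x).
Proof. by move=> sf /l2N; exact: l2D. Qed.

Lemma fsupp_l2 f : fsupp f -> l2 f.
Proof.
move=> ff; apply: absum_fsupp; apply: sub_finite_set ff => x /=.
by rewrite sqrf_eq0.
Qed.

Lemma absum_mul f g : l2 f -> l2 g -> absum (fun x => f x * g x).
Proof.
move=> sf sg; apply: le_absum (absumD sf sg) => x.
rewrite [leRHS]ger0_norm ?addr_ge0 ?sqr_ge0 // ler_norml.
have := sqr_ge0 (f x - g x); have := sqr_ge0 (f x + g x).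
have := sqr_ge0 (f x); have := sqr_ge0 (g x); lra.
Qed.

Lemma n2_nsq f : l2 f -> (n2 f)%:E = nsq f.
Proof. by move=> sf; apply: ge0_tsum_esum => // x; exact: sqr_ge0. Qed.

Lemma nsq_ge0 f : (0 <= nsq f)%E.
Proof. by apply: esum_ge0 => x _; rewrite lee_fin sqr_ge0. Qed.

Lemma nsq_l2 f : (nsq f < +oo)%E -> l2 f.
Proof.
apply: le_lt_trans; apply: le_esum => x _.
by rewrite ger0_norm ?sqr_ge0.
Qed.

Lemma n2_ge0 f : 0 <= n2 f.
Proof. by apply: tsum_ge0 => x; exact: sqr_ge0. Qed.

Lemma n2Z a f : l2 f -> n2 (fun x => a * f x) = a ^+ 2 * n2 f.
Proof. by move=> sf; rewrite /n2 -tsumZ //; apply: eq_tsum => x; rewrite exprMn. Qed.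

Lemma n2D_le f g : l2 f -> l2 g -> n2 (fun x => f x + g x) <= 2 * n2 f + 2 * n2 g.
Proof.
move=> sf sg; rewrite /n2 -!tsumZ // -tsumD; [|exact: absumZ|exact: absumZ].
apply: le_tsum => [||x]; first exact: l2D.
  by apply: absumD; exact: absumZ.
by have := sqr_ge0 (f x - g x); lra.
Qed.

Lemma n2B_le f g : l2 f -> l2 g -> n2 (fun x => f x - g x) <= 2 * n2 f + 2 * n2 g.
Proof.
move=> sf sg; apply: le_trans (n2D_le sf (l2N sg)) _; rewrite lerD2l.
by rewrite [n2 (fun _ => - _)](eq_tsum (k := fun x => g x ^+ 2)) // => x; rewrite sqrrN.
Qed.

Lemma sqr_le_n2 f x : l2 f -> f x ^+ 2 <= n2 f.
Proof. by move=> sf; apply: (ge0_le_tsum x (fun y => sqr_ge0 (f y))). Qed.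

Definition l2pred : {pred (T -> R)} := fun f => `[< l2 f >].

Fact l2_submod : submod_closed l2pred.
Proof.
split=> [|a f g /asboolP sf /asboolP sg]; apply/asboolP.
  by apply: fsupp_l2; rewrite /fsupp (_ : [set _ | _] = set0) //; apply/seteqP; split => x //=; rewrite eqxx.
by apply: l2D => //; exact: (l2Z a).
Qed.

HB.instance Definition _ := GRing.isSubmodClosed.Build R (T -> R) l2pred l2_submod.

Record l2sp := L2 { l2fun :> T -> R; l2mem : l2fun \in l2pred }.
HB.instance Definition _ := [isSub for l2fun].
HB.instance Definition _ := [Choice of l2sp by <:].
HB.instance Definition _ := [SubChoice_isSubLmodule of l2sp by <:].

Lemma l2P (u : l2sp) : l2 u.
Proof. exact/asboolP/(l2mem u). Qed.
Definition mkl2 f (sf : l2 f) : l2sp := L2 (asboolT sf : f \in l2pred).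

Definition l2dot (u v : l2sp) := dotp u v.

(** The limit is pointwise. The Cauchy bound on each finite partial sum passes to the limit, which
    gives square summability and the norm estimate together. *)
Lemma l2_complete (u : nat -> l2sp) :
  (forall e, 0 < e -> exists N, forall m n, (N <= m)%N -> (N <= n)%N ->
       l2dot (u m - u n) (u m - u n) <= e) ->
  exists l, forall e, 0 < e -> exists N, forall n, (N <= n)%N ->
       l2dot (u n - l) (u n - l) <= e.
Proof.
have dE (v w : l2sp) : l2dot (v - w) (v - w) = n2 (fun x => v x - w x).
  by apply: eq_tsum => x; rewrite expr2.
move=> cau.
have cvx x : cvgn (fun n => u n x).
  apply: cauchy_cvg; apply: cauchy_exP => e e0.
  have [N hN] := cau (e ^+ 2 / 4) ltac:(by rewrite divr_gt0 // exprn_gt0).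
  exists (u N x); exists N => // n /= Nn; rewrite /ball /=.
  have := hN N n (leqnn N) Nn; rewrite dE => h.
  have := le_trans (sqr_le_n2 x (l2B (l2P (u N)) (l2P (u n)))) h => {}h.
  rewrite -ltr_sqr ?nnegrE ?(ltW e0) // real_normK ?num_real //.
  by have := exprn_gt0 2 e0; lra.
pose l x := limn (fun n => u n x).
have key e : 0 < e -> exists N, forall n, (N <= n)%N ->
    l2 (fun x => u n x - l x) /\ n2 (fun x => u n x - l x) <= e.
  move=> e0; have [N hN] := cau e e0; exists N => n Nn.
  apply: tsum_le_bound => [x|A fA]; first exact: sqr_ge0.
  rewrite fsbig_finite //=; set s := finmap.enum_fset _.
  have cv : (fun m => \sum_(x <- s) (u n x - u m x) ^+ 2) @ \oo -->
      \sum_(x <- s) (u n x - l x) ^+ 2.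
    elim: s => [|x s IH]; first by under eq_fun do rewrite big_nil; rewrite big_nil; exact: cvg_cst.
    under eq_fun do rewrite big_cons; rewrite big_cons; apply: cvgD => //.
    have c1 : (fun m => u n x - u m x) @ \oo --> u n x - l x.
      by apply: cvgB; [exact: cvg_cst | exact: cvx].
    by under eq_fun do rewrite expr2; rewrite expr2; exact: cvgM.
  rewrite -(cvg_lim _ cv) //; apply: limr_le; first by apply/cvg_ex; eexists; exact: cv.
  exists N => // m /= Nm; apply: le_trans (hN n m Nn Nm); rewrite dE.
  rewrite /s -fsbig_finite //; apply: ge0_le_fsum_tsum => // [x|]; first exact: sqr_ge0.
  exact: l2B (l2P _) (l2P _).
have sl : l2 l.
  have [N /(_ N (leqnn N))[sN _]] := key 1 ltr01.
  have := l2B (l2P (u N)) sN; apply: le_l2 => x.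
  by rewrite opprB addrC subrK.
exists (mkl2 sl) => e /key[N hN]; exists N => n /hN[_]; by rewrite dE.
Qed.

Definition l2_hilbert : hilbert l2sp.
Proof.
refine (@Hilbert R l2sp l2dot _ _ _ _ _ l2_complete).
- by move=> u v; apply: eq_tsum => x; rewrite mulrC.
- move=> u v w; rewrite /l2dot /dotp -tsumD; last 2 first.
  + exact: absum_mul (l2P _) (l2P _).
  + exact: absum_mul (l2P _) (l2P _).
  by apply: eq_tsum => x; rewrite -mulrDl.
- move=> a u w; rewrite /l2dot /dotp -tsumZ; last exact: absum_mul (l2P _) (l2P _).
  by apply: eq_tsum => x; rewrite mulrA.
- by move=> u; apply: tsum_ge0 => x; rewrite -expr2 sqr_ge0.
- move=> u; rewrite /l2dot /dotp => u0; apply/val_inj/funext => x /=.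
  have := sqr_le_n2 x (l2P u); rewrite /n2.
  under eq_tsum do rewrite expr2; rewrite u0 => h.
  by apply/eqP; rewrite -sqrf_eq0 eq_le h sqr_ge0.
Defined.

End L2.

(** Provides a real point off a countable spectrum, hence a bounded symmetric resolvent. A countable
    set is Lebesgue-null, the unit interval is not. *)
Lemma countable_co_nonempty (R : realType) (A : set R) : countable A -> exists x, ~ A x.
Proof.
move=> cA; apply: contrapT => /forallNP h.
have AT : A = setT by apply/seteqP; split => // x _; apply: contrapT => nx; exact: (h x).
have c01 : countable (`[0, 1]%classic : set R).
  by apply: sub_countable cA; apply: subset_card_le; rewrite AT.
have := countable_lebesgue_measure0 c01; rewrite lebesgue_measure_itv /= lte_fin ltr01.
by rewrite oppr0 adde0 => /eqP; rewrite eqe oner_eq0.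
Qed.

Lemma countable_setU (T : Type) (A B : set T) :
  countable A -> countable B -> countable (A `|` B).
Proof.
move=> cA cB; rewrite (_ : _ `|` _ = \bigcup_(b in [set: bool]) (if b then A else B)).
  by apply: bigcup_countable => // -[].
by apply/seteqP; split => [x [Ax|Bx]|x [[] _ h]]; [exists true|exists false|left|right].
Qed.

(** * Bounded symmetric perturbations of multiplication operators *)

(** [K] acts on arbitrary functions, and its linearity is pointwise on all of them, so one operator
    serves finitely supported functions, square-summable functions and fibres of functions on a
    product. [B] bounds the square of the operator norm. *)
Record bdsym (R : realType) (T : choiceType) (K : (T -> R) -> T -> R) (B : R) : Prop := Bdsym {
  bdsym_ge0 : 0 <= B;
  bdsym_lin : forall a f g x, K (fun y => a * f y + g y) x = a * K f x + K g x;
  bdsym_l2 : forall f, l2 f -> l2 (K f);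
  bdsym_bd : forall f, l2 f -> n2 (K f) <= B * n2 f;
  bdsym_sym : forall f g, l2 f -> l2 g -> dotp (K f) g = dotp f (K g) }.

Section Op.
Context (R : realType) (T : choiceType) (K : (T -> R) -> T -> R) (B : R) (d : T -> R).
Implicit Types (f g : T -> R).

Definition Op f x := K f x + d x * f x.
(* The constants bound squared norms: Op - mu is bounded below by sqrt c on the core of finitely
   supported functions. *)
Definition bb (c mu : R) := 0 < c /\
  forall f, fsupp f -> c * n2 f <= n2 (fun x => Op f x - mu * f x).
Definition spec := [set mu | forall c, ~ bb c mu].

Lemma bb_le c c' mu : 0 < c' -> c' <= c -> bb c mu -> bb c' mu.
Proof.
move=> c0 le [_ hc]; split => // f ff; apply: le_trans (hc f ff).
by rewrite ler_wpM2r // n2_ge0.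
Qed.

Hypothesis hK : bdsym K B.

Lemma Op_lin a f g x : Op (fun y => a * f y + g y) x = a * Op f x + Op g x.
Proof. by rewrite /Op (bdsym_lin hK); ring. Qed.

Lemma Op_sub f g x : Op (fun y => f y - g y) x = Op f x - Op g x.
Proof.
have := Op_lin (-1) g f x; rewrite mulN1r addrC => <-.
by congr (Op _ x); apply/funext => y; rewrite mulN1r addrC.
Qed.

Lemma Op0 f x : (forall y, f y = 0) -> Op f x = 0.
Proof.
move=> z; have := Op_sub f f x; rewrite subrr => <-.
by congr (Op _ x); apply/funext => y; rewrite !z subrr.
Qed.

Lemma Op_sum (J : Type) (s : seq J) (a : J -> R) (F : J -> T -> R) x :
  Op (fun y => \sum_(j <- s) a j * F j y) x = \sum_(j <- s) a j * Op (F j) x.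
Proof.
elim: s => [|j s IH]; first by rewrite big_nil Op0 // => y; rewrite big_nil.
rewrite big_cons -IH -Op_lin; congr (Op _ x).
by apply/funext => y; rewrite big_cons.
Qed.

Lemma Op_sym f g : l2 f -> l2 g -> absum (fun x => d x * f x * g x) ->
  dotp (Op f) g = dotp f (Op g).
Proof.
move=> sf sg sd; rewrite /dotp /Op.
rewrite (eq_tsum (k := fun x => K f x * g x + d x * f x * g x)); last by move=> x; ring.
rewrite [RHS](eq_tsum (k := fun x => f x * K g x + d x * f x * g x)); last by move=> x; ring.
have a1 := absum_mul (bdsym_l2 hK sf) sg; have a2 := absum_mul sf (bdsym_l2 hK sg).
by rewrite (tsumD a1 sd) (tsumD a2 sd); congr (_ + _); exact: (bdsym_sym hK).
Qed.

Lemma l2_dmul f : l2 f -> l2 (Op f) -> l2 (fun x => d x * f x).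
Proof.
move=> sf so; have := l2B so (bdsym_l2 hK sf); apply: le_l2 => x.
by rewrite /Op [_ + _ * _]addrC addrK.
Qed.

Lemma fsupp_l2_Op f mu : fsupp f -> l2 (fun x => Op f x - mu * f x).
Proof.
move=> ff; have sf := fsupp_l2 ff.
apply: l2B (l2Z _ sf); apply: l2D; first exact: (bdsym_l2 hK).
apply: fsupp_l2; apply: sub_finite_set ff => x /=.
by apply: contraNN => /eqP ->; rewrite mulr0.
Qed.

(* The truncations of f to large finite sets converge to f in the graph norm. *)
Lemma bb_ext c mu f : bb c mu -> l2 f -> l2 (Op f) ->
  c * n2 f <= 2 * n2 (fun x => Op f x - mu * f x).
Proof.
move=> [c0 hc] sf so; have sd := l2_dmul sf so; have B0 := bdsym_ge0 hK.
apply/ler_addgt0Pr => e e0.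
(* The coefficients of [t] that the tail [f2] contributes to the final estimate, with a margin of
   1. *)
pose M := c + 4 * B + 8 + 8 * mu ^+ 2 + 1.
have m2 := sqr_ge0 mu.
have M0 : 0 < M by rewrite /M; lra.
pose t := e / M; have t0 : 0 < t by rewrite divr_gt0.
have [A1 fA1 hA1] := tsum_tail (fun x => sqr_ge0 (f x)) sf t0.
have [A2 fA2 hA2] := tsum_tail (fun x => sqr_ge0 (d x * f x)) sd t0.
pose A := A1 `|` A2.
have fA : finite_set A by rewrite finite_setU.
pose f1 x := if x \in A then f x else 0.
pose f2 x := if x \in A then 0 else f x.
have ff1 : fsupp f1.
  apply: sub_finite_set fA => x /=; rewrite /f1; case: ifP => [/set_mem//|].
  by rewrite eqxx.
have sf1 := fsupp_l2 ff1.
have sf2 : l2 f2 by apply: le_l2 sf => x; rewrite /f2; case: ifP; rewrite ?normr0.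
have sd2 : l2 (fun x => d x * f2 x).
  by apply: le_l2 sd => x; rewrite /f2; case: ifP; rewrite ?mulr0 ?normr0.
have n2f2 : n2 f2 <= t.
  apply: le_trans (hA1 A (@subsetUl _ _ _)); rewrite le_eqVlt; apply/orP; left; apply/eqP.
  by apply: eq_tsum => x; rewrite /f2; case: ifP; rewrite ?expr0n.
have n2df2 : n2 (fun x => d x * f2 x) <= t.
  apply: le_trans (hA2 A (@subsetUr _ _ _)); rewrite le_eqVlt; apply/orP; left; apply/eqP.
  by apply: eq_tsum => x; rewrite /f2; case: ifP; rewrite ?mulr0 ?expr0n.
have n2f : n2 f = n2 f1 + n2 f2.
  rewrite /n2 -tsumD //; apply: eq_tsum => x; rewrite /f1 /f2.
  by case: ifP; rewrite expr0n /= ?addr0 ?add0r.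
have h1 := hc f1 ff1.
have sOf : l2 (fun x => Op f x - mu * f x) by exact: l2B so (l2Z _ sf).
have sOf2 : l2 (fun x => Op f2 x - mu * f2 x).
  by apply: l2B (l2Z _ sf2); apply: l2D => //; exact: (bdsym_l2 hK).
have h2 : n2 (fun x => Op f1 x - mu * f1 x) <=
    2 * n2 (fun x => Op f x - mu * f x) + 2 * n2 (fun x => Op f2 x - mu * f2 x).
  apply: le_trans (n2B_le sOf sOf2); rewrite le_eqVlt; apply/orP; left; apply/eqP.
  apply: eq_tsum => x; congr (_ ^+ 2).
  have -> : f1 = fun y => f y - f2 y.
    by apply/funext => y; rewrite /f1 /f2; case: ifP; rewrite ?subr0 ?subrr.
  by rewrite Op_sub; ring.
have h3 : n2 (fun x => Op f2 x - mu * f2 x) <= 2 * (B * t) + 2 * (2 * t + 2 * (mu ^+ 2 * t)).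
  rewrite [X in n2 X](_ : _ = fun x => K f2 x + (d x * f2 x - mu * f2 x)); last first.
    by apply/funext => x; rewrite /Op addrA.
  apply: le_trans (n2D_le (bdsym_l2 hK sf2) (l2B sd2 (l2Z _ sf2))) _.
  have := n2B_le sd2 (l2Z mu sf2); rewrite n2Z // => h.
  have h4 := bdsym_bd hK sf2.
  have h5 : B * n2 f2 <= B * t by exact: ler_wpM2l.
  have h6 : mu ^+ 2 * n2 f2 <= mu ^+ 2 * t by exact: ler_wpM2l.
  lra.
have h7 : c * n2 f2 <= c * t by rewrite ler_pM2l.
have : M * t = e by rewrite /t mulrC divfK // gt_eqF.
rewrite /M n2f mulrDr; lra.
Qed.

Lemma eigen_spec f s : l2 f -> (exists x, f x != 0) -> (forall x, Op f x = s * f x) -> spec s.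
Proof.
move=> sf [x fx] ef c bc.
have so : l2 (Op f) by rewrite (_ : Op f = fun x => s * f x); [exact: l2Z | exact/funext].
have := bb_ext bc sf so.
rewrite [n2 (fun x => Op f x - _)](tsum_single (a := x)); last first.
  by move=> y _; rewrite ef subrr expr0n.
rewrite ef subrr expr0n mulr0 => h.
have : 0 < c * n2 f.
  apply: mulr_gt0 bc.1 _; apply: lt_le_trans (sqr_le_n2 x sf).
  by rewrite exprn_even_gt0.
by rewrite ltNge h.
Qed.

Section resolvent.
Variables (c l0 : R).
Hypothesis bl : bb c l0.
Let c0 : 0 < c := bl.1.
Local Notation H := (l2_hilbert R T).

Lemma l2funB (u v : l2sp R T) x : (u - v) x = u x - v x.
Proof. by []. Qed.

Lemma sqE (u : l2sp R T) : sq H u = n2 u.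
Proof. by apply: eq_tsum => x; rewrite expr2. Qed.

(** The range of Op - l0 on finitely supported functions is dense: a vector orthogonal to it is an
    eigenfunction at [l0], which the lower bound forbids. The same bound makes the preimages of an
    approximating sequence Cauchy, and their limit solves the equation at each point. *)
Lemma resolvent_exists (phi : l2sp R T) :
  exists u : l2sp R T, forall x, Op u x - l0 * u x = phi x.
Proof.
have B0 := bdsym_ge0 hK.
pose M (v : l2sp R T) := exists f, fsupp f /\ forall x, v x = Op f x - l0 * f x.
have [||m [xi [hm cm ort]]] := @projection _ _ H M phi.
- exists (fun=> 0); split; last by move=> x; rewrite Op0 // mulr0 subr0.
  by rewrite /fsupp (_ : [set _ | _] = set0) //; apply/seteqP; split => x //=; rewrite eqxx.
- move=> a u v [f [ff hf]] [g [fg hg]]; exists (fun x => a * f x + g x); split.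
    apply: sub_finite_set (_ : finite_set ([set x | f x != 0] `|` [set x | g x != 0])).
      move=> x /=; apply: contra_neqP => /not_orP[/negP/negPn/eqP -> /negP/negPn/eqP ->].
      by rewrite mulr0 addr0.
    by rewrite finite_setU.
  by move=> x; rewrite Op_lin (_ : (a *: u + v) x = a * u x + v x) // hf hg; ring.
have {}[f hf] := choice hm.
have ff n : fsupp (f n) := (hf n).1.
pose w := phi - xi.
(* Test the orthogonality against the basis vector at [a] and move the operator onto [w]. *)
have weak a : Op w a = l0 * w a.
  pose e (x : T) : R := (x == a)%:R.
  have fe : fsupp e.
    apply: sub_finite_set (finite_set1 a) => x /=; rewrite /e.
    by have [//|_] := eqVneq x a; rewrite eqxx.
  pose v := mkl2 (fsupp_l2_Op l0 fe).
  have sing k : tsum (fun x => k x * e x) = k a.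
    rewrite (tsum_single (a := a)); last by move=> x /negPf xa; rewrite /e xa mulr0.
    by rewrite /e eqxx mulr1.
  have : H w v = 0 by apply: ort; exists e.
  have se := fsupp_l2 fe.
  have sO : l2 (Op e).
    have := l2D (fsupp_l2_Op l0 fe) (l2Z l0 se); apply: le_l2 => x.
    by rewrite subrK.
  have we := absum_mul (l2P w) se.
  have -> : H w v = tsum (fun x => w x * Op e x + (- l0) * (w x * e x)).
    by apply: eq_tsum => x; rewrite [v x](_ : _ = Op e x - l0 * e x) //; ring.
  rewrite (tsumD (absum_mul (l2P w) sO) (absumZ _ we)) (tsumZ _ we) sing mulNr -/(dotp w (Op e)).
  have ad : absum (fun x => d x * w x * e x).
    apply: absum_fsupp; apply: sub_finite_set (fe) => x /=.
    by apply: contraNN => /eqP ->; rewrite mulr0.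
  rewrite -(Op_sym (l2P w) se ad).
  by rewrite /dotp sing => /eqP; rewrite subr_eq0 => /eqP.
have w0 : w = 0.
  have [//|/(@sq_gt0 _ _ H _) wp] := eqVneq w 0.
  have : exists x, w x != 0.
    apply: contrapT => /forallNP h; move: wp; rewrite sqE /n2.
    rewrite (eq_tsum (k := fun _ => 0)) => [|x].
      by rewrite ge0_tsumE // esum1 // ltxx.
    by have /negP/negPn/eqP -> := h x; rewrite expr0n.
  by move=> /(eigen_spec (l2P w))/(_ weak)/(_ c).
have phixi : phi = xi by apply/eqP; rewrite -subr_eq0 -/w w0.
pose u n := mkl2 (fsupp_l2 (ff n)).
have mE n x : m n x = Op (f n) x - l0 * f n x := (hf n).2 x.
have cau e : 0 < e -> exists N, forall i j, (N <= i)%N -> (N <= j)%N ->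
    H (u i - u j) (u i - u j) <= e.
  move=> e0; have [N hN] := cm (c * e / 4) ltac:(by rewrite divr_gt0 // mulr_gt0).
  exists N => i j Ni Nj; rewrite -/(sq _ _) -(ler_pM2l c0).
  have ffij : fsupp (fun x => f i x - f j x).
    apply: sub_finite_set (_ : finite_set ([set x | f i x != 0] `|` [set x | f j x != 0])).
      move=> x /=; apply: contra_neqP => /not_orP[/negP/negPn/eqP -> /negP/negPn/eqP ->].
      by rewrite subr0.
    by rewrite finite_setU; split; exact: ff.
  have := bl.2 _ ffij.
  have -> : n2 (fun x => f i x - f j x) = sq H (u i - u j) by rewrite sqE.
  have -> : n2 (fun x => Op (fun y => f i y - f j y) x - l0 * (f i x - f j x)) = sq H (m i - m j).
    by rewrite sqE; apply: eq_tsum => x; rewrite Op_sub l2funB !mE; congr (_ ^+ 2); ring.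
  have := sq_triangle H (m i) xi (m j); rewrite (sq_distC H xi (m j)).
  have := hN i Ni; have := hN j Nj; lra.
have [l hl] := dot_complete cau.
exists l => x; apply/eqP; rewrite -subr_eq0 -sqrf_eq0 eq_le sqr_ge0 andbT.
apply/ler_addgt0Pr => e e0; rewrite add0r.
(* The equation is checked at a fixed [x], where the unbounded [d] enters only through the number
   [d x]. [Q] makes the error at [x] of the approximate preimage cost at most e/2. *)
pose Q := 2 * B + 2 * (d x - l0) ^+ 2 + 1.
have Q0 : 0 < Q by have := sqr_ge0 (d x - l0); rewrite /Q; lra.
have [N1 hN1] := hl (e / (4 * Q)) ltac:(by rewrite divr_gt0 // mulr_gt0).
have [N2 hN2] := cm (e / 4) ltac:(by rewrite divr_gt0).
pose n := maxn N1 N2.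
have h1 := hN1 n (leq_maxl _ _); have h2 := hN2 n (leq_maxr _ _).
rewrite -/(sq _ _) sqE in h1; rewrite sqE -phixi in h2.
have h3 : (m n x - phi x) ^+ 2 <= e / 4 := le_trans (sqr_le_n2 x (l2P (m n - phi))) h2.
have sul := l2P (u n - l).
have h4 := le_trans (sqr_le_n2 x (bdsym_l2 hK sul)) (bdsym_bd hK sul).
have h5 := sqr_le_n2 x sul.
have eK : K (u n - l : l2sp R T) x = K (f n) x - K l x.
  have := Op_sub (u n) l x; rewrite /Op /=.
  rewrite [X in K X x + _](_ : _ = l2fun (u n - l)) // => h; lra.
set g := u n - l in h1 h4 h5 eK.
have gx : g x = f n x - l x by [].
have h6 : B * n2 g <= B * (e / (4 * Q)) by exact: ler_wpM2l.
have h7 : (d x - l0) ^+ 2 * g x ^+ 2 <= (d x - l0) ^+ 2 * (e / (4 * Q)).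
  by apply: ler_wpM2l; [exact: sqr_ge0 | exact: le_trans h5 h1].
have h8 : Q * (e / (4 * Q)) = e / 4 by field; rewrite gt_eqF.
have h9 : 0 < e / (4 * Q) by rewrite divr_gt0 // mulr_gt0.
have -> : Op l x - l0 * l x - phi x = (m n x - phi x) - (K g x + (d x - l0) * g x).
  by rewrite mE eK gx /Op; ring.
have h10 := sqr_ge0 ((m n x - phi x) + (K g x + (d x - l0) * g x)).
have h11 := sqr_ge0 (K g x - (d x - l0) * g x).
rewrite /Q in h8.
have h12 : ((d x - l0) * g x) ^+ 2 = (d x - l0) ^+ 2 * g x ^+ 2 by rewrite exprMn.
set E := e / (4 * Q) in h1 h6 h7 h8 h9.
set p := m n x - phi x in h3 h10 *; set q := (d x - l0) * g x in h10 h11 h12 *.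
set k := K g x in h4 h10 h11 *; nra.
Qed.

Definition resolvent phi := projT1 (cid (resolvent_exists phi)).
Local Notation A := resolvent.

Lemma resolventP phi x : Op (A phi) x - l0 * A phi x = phi x.
Proof. exact: projT2 (cid (resolvent_exists phi)) x. Qed.

Lemma resolventE phi x : Op (A phi) x = phi x + l0 * A phi x.
Proof. by rewrite -resolventP subrK. Qed.

Lemma l2_Op_resolvent phi : l2 (Op (A phi)).
Proof.
rewrite (_ : Op _ = fun x => phi x + l0 * A phi x); last exact/funext/resolventE.
exact: l2D (l2P _) (l2Z _ (l2P _)).
Qed.

Lemma resolvent_bound phi : c * n2 (A phi) <= 2 * n2 phi.
Proof.
apply: le_trans (bb_ext bl (l2P _) (l2_Op_resolvent phi)) _.
by rewrite (_ : (fun x => _) = phi) //; apply/funext => x; rewrite resolventP.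
Qed.

Lemma resolvent_uniq (u phi : l2sp R T) : (forall x, Op u x - l0 * u x = phi x) -> u = A phi.
Proof.
move=> hu; apply/eqP; rewrite -subr_eq0; apply/eqP/(@sq_eq0 _ _ H)/eqP.
rewrite eq_le sq_ge0 andbT sqE -(ler_pM2l c0) mulr0.
have e0 x : Op (u - A phi : l2sp R T) x = l0 * (u - A phi : l2sp R T) x.
  rewrite [Op _ x]Op_sub l2funB; have := resolventP phi x; have := hu x; lra.
have so : l2 (Op (u - A phi : l2sp R T)).
  by rewrite (_ : Op _ = fun x => l0 * (u - A phi : l2sp R T) x); [exact/l2Z/l2P | exact/funext].
apply: le_trans (bb_ext bl (l2P _) so) _.
rewrite (_ : (fun x => _) = fun _ => 0); last by apply/funext => x; rewrite e0 subrr.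
by rewrite /n2 ge0_tsumE ?esum1 ?mulr0 // => x; rewrite expr0n.
Qed.

Lemma resolvent_linear a u v : A (a *: u + v) = a *: A u + A v.
Proof.
apply/esym/resolvent_uniq => x.
rewrite (_ : l2fun (a *: A u + A v) = fun y => a * A u y + A v y) // Op_lin !resolventE.
rewrite (_ : l2fun (a *: u + v) x = a * u x + v x) //; ring.
Qed.

HB.instance Definition _ := GRing.isLinear.Build R (l2sp R T) (l2sp R T) *:%R A resolvent_linear.

Lemma resolvent_sym : symmetric_op H A.
Proof.
move=> u v.
have [su sv] := (l2P (A u), l2P (A v)).
have auv := absum_mul su sv.
have e1 : H (A u) v = dotp (A u) (Op (A v)) - l0 * dotp (A u) (A v).
  rewrite -mulNr -(tsumZ _ auv) -(tsumD (absum_mul su (l2_Op_resolvent v)) (absumZ _ auv)).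
  by apply: eq_tsum => x; rewrite -[v x]resolventP; ring.
have e2 : H u (A v) = dotp (Op (A u)) (A v) - l0 * dotp (A u) (A v).
  rewrite -mulNr -(tsumZ _ auv) -(tsumD (absum_mul (l2_Op_resolvent u) sv) (absumZ _ auv)).
  by apply: eq_tsum => x; rewrite -[u x]resolventP; ring.
by rewrite e1 e2 Op_sym //; exact: absum_mul (l2_dmul su (l2_Op_resolvent u)) sv.
Qed.

Lemma resolvent_bdd : bounded_op H A.
Proof.
exists (2 / c); split=> [|v]; first by rewrite divr_gt0.
by rewrite !sqE mulrAC ler_pdivlMr // mulrC resolvent_bound.
Qed.

(** A phi - t phi = - t (Op - (l0 + 1/t)) A phi, so a lower bound for Op at l0 + 1/t becomes one for
    A at t. *)
Lemma resolvent_spec t : t != 0 -> ~ spec (l0 + t^-1) -> ~ aspec H A t.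
Proof.
move=> t0 /existsNP[c' /contrapT bc']; have c'0 := bc'.1 => at_.
have t2 : 0 < t ^+ 2 by rewrite exprn_even_gt0.
(* Comes from |phi|^2 <= 2 X + 2 t^-2 |A phi|^2 and c' |A phi|^2 <= 2 X, where t^2 X is the squared
   norm of A phi - t phi. *)
pose M := 2 / t ^+ 2 + 4 / (t ^+ 4 * c').
have M0 : 0 < M.
  by apply: addr_gt0; rewrite divr_gt0 // mulr_gt0 // exprn_even_gt0.
have [phi] := at_ M^-1 ltac:(by rewrite invr_gt0).
apply/negP; rewrite -leNgt mulrC ler_pdivrMr // !sqE.
set X := n2 (fun x => Op (A phi) x - (l0 + t^-1) * A phi x).
have -> : n2 (A phi - t *: phi) = t ^+ 2 * X.
  rewrite -n2Z; last exact: l2B (l2_Op_resolvent _) (l2Z _ (l2P _)).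
  rewrite /n2; apply: eq_tsum => x.
  rewrite (_ : l2fun (A phi - t *: phi) x = A phi x - t * phi x) // -[phi x]resolventP.
  by rewrite -[LHS]sqrrN; congr (_ ^+ 2); field.
have h1 : c' * n2 (A phi) <= 2 * X by exact: bb_ext bc' (l2P _) (l2_Op_resolvent phi).
have h2 : n2 phi <= 2 * X + 2 * (t^-1 ^+ 2 * n2 (A phi)).
  rewrite -(n2Z _ (l2P (A phi))).
  have sX := l2B (l2_Op_resolvent phi) (l2Z (l0 + t^-1) (l2P (A phi))).
  apply: le_trans (n2D_le sX (l2Z t^-1 (l2P (A phi)))).
  rewrite le_eqVlt; apply/orP; left; apply/eqP/eq_tsum => x.
  by rewrite -[phi x]resolventP; congr (_ ^+ 2); ring.
have -> : t ^+ 2 * X * M = 2 * X + 2 * (t^-1 ^+ 2 * (2 * X / c')).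
  by rewrite /M; field; rewrite t0 gt_eqF.
apply: le_trans h2 _; rewrite lerD2l ler_pM2l //.
apply: ler_wpM2l; first by rewrite sqr_ge0.
by rewrite ler_pdivlMr // mulrC.
Qed.

Lemma resolvent_eigen t u x : A u = t *: u -> Op u x = (l0 + t^-1) * u x.
Proof.
move=> eu; have h y : A u y = t * u y by rewrite eu.
(* At [t = 0] the inverse is 0 by convention, but the resolvent is injective, so [u] vanishes and
   the equation is trivial. *)
have [t0|t0] := eqVneq t 0.
  have z y : A u y = 0 by rewrite h t0 mul0r.
  have u0 y : u y = 0 by rewrite -resolventP Op0 // z mulr0 subr0.
  by rewrite Op0 // u0 mulr0.
have eA : l2fun (A u) = fun y => t * u y + 0.
  by apply/funext => y; rewrite h addr0.
have := resolventP u x; rewrite eA Op_lin addr0 [Op (fun=> 0) x]Op0 // addr0 => e.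
apply: (mulfI t0); have -> : t * ((l0 + t^-1) * u x) = l0 * (t * u x) + u x by field.
lra.
Qed.

Lemma countable_aspec : countable spec -> countable (aspec H A).
Proof.
move=> cs; have : countable ([set 0] `|` (fun s => (s - l0)^-1) @` spec).
  apply: countable_setU; first exact: countable1.
  by apply: sub_countable cs; exact: card_image_le.
apply: sub_countable; apply: subset_card_le => t at_ /=.
have [->|t0] := eqVneq t 0; first by left.
right; exists (l0 + t^-1); last by rewrite addrC addKr invrK.
by apply: contrapT => /(resolvent_spec t0).
Qed.

End resolvent.

Hypothesis cspec : countable spec.
Local Notation H := (l2_hilbert R T).

Theorem eigenfunctions_dense f e : l2 f -> 0 < e -> exists gs : seq (T -> R),
  (forall i, (i < size gs)%N -> let g := nth (fun=> 0) gs i in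
     [/\ l2 g, exists x, g x != 0 & exists s, forall x, Op g x = s * g x]) /\
  n2 (fun x => f x - \sum_(g <- gs) g x) <= e /\ l2 (fun x => f x - \sum_(g <- gs) g x).
Proof.
move=> sf e0.
have [l0 /existsNP[c /contrapT bl]] := countable_co_nonempty cspec.
have [ss [us _ hs]] := eproj_approx (resolvent_sym bl) (resolvent_bdd bl)
  (countable_aspec bl cspec) (mkl2 sf) e0.
pose P s := eproj (resolvent_bdd bl) s (mkl2 sf).
(* A spectral point of the resolvent need not be an eigenvalue; zero projections are dropped, which
   leaves the sum unchanged. *)
pose gs := [seq l2fun (P s) | s <- ss & P s != 0].
exists gs; split.
  move=> i; rewrite size_map => li; rewrite (nth_map 0) //.
  set s := nth 0 _ i; have : s \in [seq s <- ss | P s != 0] by exact: mem_nth.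
  rewrite mem_filter => /andP[nz _]; split; first exact: l2P.
    apply: contrapT => /forallNP h; move/eqP: nz; apply; apply/val_inj/funext => x.
    by have /negP/negPn/eqP := h x.
  by exists (l0 + s^-1) => x; exact: (resolvent_eigen x (eproj_eig (resolvent_bdd bl) s _)).
have sumE x : \sum_(g <- gs) g x = l2fun (\sum_(s <- ss) P s) x.
  rewrite big_map big_filter.
  rewrite big_mkcond /=; elim: ss {us hs gs} => [|s ss IH]; first by rewrite !big_nil.
  rewrite !big_cons IH (_ : l2fun (P s + _) x = P s x + l2fun (\sum_(j <- ss) P j) x) //.
  by case: eqP => [->|].
have eF : (fun x => f x - \sum_(g <- gs) g x) = l2fun (mkl2 sf - \sum_(s <- ss) P s).
  by apply/funext => x; rewrite sumE.
by rewrite eF; split; [rewrite -sqE | exact: l2P].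
Qed.

(* f (t, a) is the orthogonal projection of the basis vector at a onto an eigenspace. *)
Theorem eigenfunction_frame : exists (f : R * T -> T -> R) (s : R * T -> R),
  [/\ forall k, l2 (f k), forall k x, Op (f k) x = s k * f k x,
      forall k, (exists x, f k x != 0) -> spec (s k) &
      forall g, l2 g -> \esum_(k in [set: R * T]) (dotp (f k) g ^+ 2)%:E = nsq g].
Proof.
have [l0 /existsNP[c /contrapT bl]] := countable_co_nonempty cspec.
have [symA bdA cA] := And3 (resolvent_sym bl) (resolvent_bdd bl) (countable_aspec bl cspec).
pose e (a x : T) : R := (x == a)%:R.
have fe a : fsupp (e a).
  apply: sub_finite_set (finite_set1 a) => x /=; rewrite /e.
  by have [//|_] := eqVneq x a; rewrite eqxx.
pose E a := mkl2 (fsupp_l2 (fe a)).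
pose P := eproj bdA.
have eig t u x : Op (P t u) x = (l0 + t^-1) * P t u x.
  exact: (resolvent_eigen x (eproj_eig bdA t u)).
exists (fun k => l2fun (P k.1 (E k.2))), (fun k => l0 + k.1^-1); split.
- by move=> k; exact: l2P.
- by move=> k x; exact: eig.
- by move=> k nz; apply: eigen_spec nz _; [exact: l2P | exact: eig].
move=> g sg; pose G := mkl2 sg.
(* By symmetry of the projection the coefficient of [g] along P_t e_a is (P_t g)(a). Summing over
   [a] gives |P_t g|^2: a Parseval frame, with no choice of orthonormal basis in the eigenspaces. *)
have coef t a : dotp (P t (E a)) g = P t G a.
  have -> : dotp (P t (E a)) g = H (P t (E a)) G by [].
  rewrite (eproj_sym bdA t) dotC [H _ _](tsum_single (a := a)) /= /e ?eqxx ?mulr1 //.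
  by move=> x /negPf ->; rewrite mulr0.
transitivity (\esum_(t in [set: R]) \esum_(a in [set: T]) (P t G a ^+ 2)%:E)%E.
  rewrite esum_esum => [|t a _ _]; last by rewrite lee_fin sqr_ge0.
  rewrite (_ : [set: R * T] = [set: R] `*`` (fun=> [set: T])); last by apply/seteqP; split.
  by apply: eq_esum => -[t a] _ /=; rewrite coef.
rewrite (eq_esum (b := fun t => (n2 (P t G))%:E)); last first.
  by move=> t _; rewrite n2_nsq //; exact: l2P.
(* One inequality is Bessel for finitely many eigenvalues, the other is [eproj_approx]. *)
rewrite -n2_nsq //; apply/eqP; rewrite eq_le; apply/andP; split.
  apply: ub_ereal_sup => _ [F [fF _] <-].
  rewrite fsbig_finite //= sumEFin lee_fin.
  have := sq_eproj_sum symA bdA G (finmap.fset_uniq (fset_set F)).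
  set D := sq _ _ => e1; have : 0 <= D by exact: sq_ge0.
  rewrite e1 subr_ge0 sqE; apply: le_trans; rewrite le_eqVlt; apply/orP; left; apply/eqP.
  by apply: eq_bigr => t _; rewrite sqE.
apply/lee_addgt0Pr => eps eps0.
have [ss [us _]] := eproj_approx symA bdA cA G eps0.
rewrite sq_eproj_sum // sqE => h.
have : ((\sum_(t <- ss) n2 (P t G))%:E <= \esum_(t in [set: R]) (n2 (P t G))%:E)%E.
  apply: ereal_sup_ubound; exists [set` ss]; first by split => //; exact: finite_seq.
  rewrite -sumEFin; apply/esym; exact: fsbig_seq.
move=> le; apply: le_trans (leeD2r _ le); rewrite -EFinD lee_fin.
have -> : \sum_(t <- ss) n2 (P t G) = \sum_(t <- ss) sq H (P t G).
  by apply: eq_bigr => t _; rewrite sqE.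
rewrite -/P in h; rewrite (_ : n2 g = n2 G) //; lra.
Qed.

End Op.

(** * Finite linear combinations of summable functions *)

Section FiniteSums.
Context (R : realType) (T : choiceType).

Lemma absum0 : absum (fun _ : T => 0 : R).
Proof. by rewrite /absum esum1 // => x _; rewrite normr0. Qed.

Lemma absum_sum (J : Type) (s : seq J) (F : J -> T -> R) :
  (forall j, absum (F j)) -> absum (fun x => \sum_(j <- s) F j x).
Proof.
move=> sF; elim: s => [|j s IH].
  by apply: le_absum absum0 => x; rewrite big_nil.
by under eq_fun do rewrite big_cons; exact: absumD.
Qed.

Lemma tsum0 : tsum (fun _ : T => 0 : R) = 0.
Proof. by rewrite ge0_tsumE ?esum1. Qed.

Lemma tsum_sum (J : Type) (s : seq J) (F : J -> T -> R) :
  (forall j, absum (F j)) -> tsum (fun x => \sum_(j <- s) F j x) = \sum_(j <- s) tsum (F j).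
Proof.
move=> sF; elim: s => [|j s IH].
  by rewrite big_nil -[RHS]tsum0; apply: eq_tsum => x; rewrite big_nil.
rewrite big_cons -IH -tsumD //; last exact: absum_sum.
by apply: eq_tsum => x; rewrite big_cons.
Qed.

Lemma tsum_fin (s : seq T) (h : T -> R) : uniq s -> (forall x, x \notin s -> h x = 0) ->
  tsum h = \sum_(x <- s) h x.
Proof.
move=> us z; pose F a x := if x == a then h x else 0.
have sF a : absum (F a).
  apply: absum_fsupp; apply: sub_finite_set (finite_set1 a) => x /=.
  by rewrite /F; have [//|_] := eqVneq x a; rewrite eqxx.
transitivity (\sum_(a <- s) tsum (F a)).
  rewrite -tsum_sum //; apply: eq_tsum => x.
  have [xs|xs] := boolP (x \in s); last first.
    by rewrite z // big1_seq // => a /andP[_ as_]; rewrite /F; case: eqP => // e; rewrite e as_ in xs.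
  rewrite (bigD1_seq x) //= {1}/F eqxx big1 ?addr0 // => a ax.
  by rewrite /F eq_sym (negPf ax).
apply: eq_bigr => a _; rewrite (tsum_single (a := a)) /F ?eqxx // => x.
by move=> /negPf ->.
Qed.

Lemma sqr_sum_le (J : Type) (s : seq J) (a : J -> R) :
  (\sum_(j <- s) a j) ^+ 2 <= (size s)%:R * \sum_(j <- s) a j ^+ 2.
Proof.
elim: s => [|j s IH]; first by rewrite !big_nil mulr0 expr0n.
have h (b : R) : 2 * b * \sum_(i <- s) a i <= (size s)%:R * b ^+ 2 + \sum_(i <- s) a i ^+ 2.
  elim: s {IH} => [|i s IH]; first by rewrite !big_nil mulr0 mul0r addr0.
  rewrite !big_cons /= -natr1; have := sqr_ge0 (a i - b).
  set S := \sum_(_ <- _) _ in IH *; set Q := \sum_(_ <- _) _ in IH *; lra.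
rewrite !big_cons /= -natr1; have := h (a j).
set S := \sum_(_ <- _) _ in IH h *; set Q := \sum_(_ <- _) _ in IH h *; lra.
Qed.

Lemma l2_sum (J : Type) (s : seq J) (F : J -> T -> R) :
  (forall j, l2 (F j)) -> l2 (fun x => \sum_(j <- s) F j x).
Proof.
move=> sF; elim: s => [|j s IH]; first by apply: le_absum absum0 => x; rewrite big_nil expr0n.
by under eq_fun do rewrite big_cons; exact: l2D.
Qed.

Lemma n2_sum_le (J : Type) (s : seq J) (F : J -> T -> R) : (forall j, l2 (F j)) ->
  n2 (fun x => \sum_(j <- s) F j x) <= (size s)%:R * \sum_(j <- s) n2 (F j).
Proof.
move=> sF; rewrite /n2 -tsum_sum // -tsumZ; last exact: absum_sum.
apply: le_tsum => [||x]; first exact: l2_sum.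
  exact/absumZ/absum_sum.
exact: sqr_sum_le.
Qed.

Lemma dotp_sumr (J : Type) (s : seq J) (f : T -> R) (F : J -> T -> R) :
  l2 f -> (forall j, l2 (F j)) ->
  dotp f (fun x => \sum_(j <- s) F j x) = \sum_(j <- s) dotp f (F j).
Proof.
move=> sf sF; rewrite /dotp -tsum_sum => [|j]; last exact: absum_mul.
by apply: eq_tsum => x; rewrite mulr_sumr.
Qed.

Lemma dotpC (f g : T -> R) : dotp f g = dotp g f.
Proof. by apply: eq_tsum => x; rewrite mulrC. Qed.

Lemma dotpZr a (f g : T -> R) : l2 f -> l2 g -> dotp f (fun x => a * g x) = a * dotp f g.
Proof.
move=> sf sg; rewrite /dotp -tsumZ; last exact: absum_mul.
by apply: eq_tsum => x; rewrite mulrCA.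
Qed.

Lemma dotpDr (f g k : T -> R) : l2 f -> l2 g -> l2 k ->
  dotp f (fun x => g x + k x) = dotp f g + dotp f k.
Proof.
move=> sf sg sk; rewrite /dotp -tsumD; [|exact: absum_mul|exact: absum_mul].
by apply: eq_tsum => x; rewrite mulrDr.
Qed.

End FiniteSums.

Lemma esum_pair (R : realType) (X Y : choiceType) (a : X -> Y -> \bar R) :
  (forall x y, (0 <= a x y)%E) ->
  \esum_(z in [set: X * Y]) a z.1 z.2 = \esum_(x in [set: X]) \esum_(y in [set: Y]) a x y.
Proof.
move=> a0; rewrite esum_esum // (_ : [set: X * Y] = [set: X] `*`` (fun=> [set: Y])) //.
by apply/seteqP; split.
Qed.

Lemma esum_swap (R : realType) (X Y : choiceType) (a : X -> Y -> \bar R) :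
  (forall x y, (0 <= a x y)%E) ->
  \esum_(x in [set: X]) \esum_(y in [set: Y]) a x y = \esum_(y in [set: Y]) \esum_(x in [set: X]) a x y.
Proof.
move=> a0; rewrite -esum_pair // -(esum_pair (a := fun y x => a x y)) //.
pose sw (z : Y * X) := (z.2, z.1).
rewrite (@reindex_esum _ _ _ [set: Y * X] [set: X * Y] sw) // setTT_bijective.
by exists (fun z => (z.2, z.1)) => -[].
Qed.

(** * Sums of two operators acting on different variables *)

Section Tensor.
Context (R : realType) (X Y : choiceType).
Context (K1 : (X -> R) -> X -> R) (B1 : R) (d1 : X -> R).
Context (K2 : (Y -> R) -> Y -> R) (B2 : R) (d2 : Y -> R).
Hypotheses (hK1 : bdsym K1 B1) (hK2 : bdsym K2 B2).

Definition tensor_op (psi : X * Y -> R) (z : X * Y) :=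
  Op K1 d1 (fun x => psi (x, z.2)) z.1 + Op K2 d2 (fun y => psi (z.1, y)) z.2.

Context (I : choiceType) (f : I -> X -> R) (s : I -> R).
Hypotheses (sf : forall k, l2 (f k)) (ef : forall k x, Op K1 d1 (f k) x = s k * f k x).
Hypothesis frame : forall g, l2 g -> \esum_(k in [set: I]) (dotp (f k) g ^+ 2)%:E = nsq g.

Lemma frame_nsq (G : X * Y -> R) : (forall y, l2 (fun x => G (x, y))) ->
  nsq G = \esum_(k in [set: I]) nsq (fun y => dotp (f k) (fun x => G (x, y))).
Proof.
move=> sG; have p0 x y : (0 <= (G (x, y) ^+ 2)%:E)%E by rewrite lee_fin sqr_ge0.
rewrite /nsq (eq_esum (b := fun z => (G (z.1, z.2) ^+ 2)%:E)); last by move=> [].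
rewrite (esum_pair p0) esum_swap //.
rewrite [RHS]esum_swap => [|k y]; last by rewrite lee_fin sqr_ge0.
by apply: eq_esum => y _; rewrite frame.
Qed.

(** On the coefficient [F k] along [f k] the full operator acts as the second one shifted by the
    eigenvalue [s k]. The lower bound at mu - s k holds for each coefficient with the same [c], and
    Parseval sums these bounds. *)
Lemma tensor_bb mu c : 0 < c ->
  (forall k, (exists x, f k x != 0) -> bb K2 d2 c (mu - s k)) ->
  forall psi, fsupp psi -> l2 (fun z => tensor_op psi z - mu * psi z) ->
  c * n2 psi <= n2 (fun z => tensor_op psi z - mu * psi z).
Proof.
move=> c0 hbb psi fpsi lDD.
pose S1 := fst @` [set z | psi z != 0]; pose S2 := snd @` [set z | psi z != 0].
have fS1 : finite_set S1 by exact: finite_image.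
have fS2 : finite_set S2 by exact: finite_image.
have z1 x y : ~ S1 x -> psi (x, y) = 0.
  by move=> nx; apply/eqP; apply: contra_notT nx => h; exists (x, y).
have z2 x y : ~ S2 y -> psi (x, y) = 0.
  by move=> ny; apply/eqP; apply: contra_notT ny => h; exists (x, y).
have fx y : fsupp (fun x => psi (x, y)).
  by apply: sub_finite_set fS1 => x /=; apply: contra_neqP => /z1.
have fy x : fsupp (fun y => psi (x, y)).
  by apply: sub_finite_set fS2 => y /=; apply: contra_neqP => /z2.
pose t : seq X := finmap.enum_fset (fset_set S1).
have ut : uniq t by exact: finmap.fset_uniq.
have nt x : x \notin t -> ~ S1 x.
  by move=> xt Sx; move: xt; rewrite -[x \in t]/(x \in fset_set S1) in_fset_set // mem_set.
have dE k (G : X -> R) : (forall x, ~ S1 x -> G x = 0) ->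
    dotp (f k) G = \sum_(x <- t) f k x * G x.
  by move=> h; apply: tsum_fin => // x /nt/h ->; rewrite mulr0.
pose F k y := dotp (f k) (fun x => psi (x, y)).
have FE k : F k = fun y => \sum_(x <- t) f k x * psi (x, y).
  by apply/funext => y; apply: dE => x; exact: z1.
(* The frame functions may have infinite support, but [psi] vanishes off a finite set, so its
   coefficients stay in the core on which [bb] is stated. *)
have fF k : fsupp (F k).
  apply: sub_finite_set fS2 => y /=; apply: contra_neqP => /z2 h.
  by rewrite FE big1 // => x _; rewrite h mulr0.
pose D z := tensor_op psi z - mu * psi z.
have OpY0 x y : ~ S1 x -> Op K2 d2 (fun y => psi (x, y)) y = 0.
  by move=> nx; rewrite (Op0 d2 hK2) // => y'; exact: z1.
have fOpY y : fsupp (fun x => Op K2 d2 (fun y => psi (x, y)) y).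
  by apply: sub_finite_set fS1 => x /=; apply: contra_neqP => /OpY0.
have lOpX y : l2 (Op K1 d1 (fun x => psi (x, y))).
  have := fsupp_l2_Op d1 hK1 0 (fx y); apply: le_l2 => x.
  by rewrite mul0r subr0.
have OpS k y : Op K2 d2 (F k) y = \sum_(x <- t) f k x * Op K2 d2 (fun y => psi (x, y)) y.
  by rewrite FE (Op_sum d2 hK2).
have lD y : l2 (fun x => D (x, y)).
  apply: l2B (l2Z _ (fsupp_l2 (fx y))).
  exact: l2D (lOpX y) (fsupp_l2 (fOpY y)).
have coefD k y : dotp (f k) (fun x => D (x, y)) = Op K2 d2 (F k) y - (mu - s k) * F k y.
  have -> : (fun x => D (x, y)) = fun x => (Op K1 d1 (fun x => psi (x, y)) x +
      Op K2 d2 (fun y => psi (x, y)) y) + (- mu) * psi (x, y).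
    by apply/funext => x; rewrite /D /tensor_op mulNr.
  have lf := fsupp_l2 (fx y); have lo := fsupp_l2 (fOpY y).
  rewrite dotpDr //; [|exact: l2D|exact: l2Z].
  rewrite dotpDr // dotpZr // -/(F k y) (dE _ (fun x => Op K2 d2 _ y)); last first.
    by move=> x; exact: OpY0.
  rewrite -OpS -(Op_sym hK1) //; last first.
    apply: absum_fsupp; apply: sub_finite_set (fx y) => x /=.
    by apply: contraNN => /eqP ->; rewrite mulr0.
  have -> : dotp (Op K1 d1 (f k)) (fun x => psi (x, y)) = s k * F k y.
    rewrite dotpC /F [dotp (f k) _]dotpC -dotpZr //; congr dotp.
    by apply/funext => x; exact: ef.
  by rewrite mulrBl; ring.
have fpsi2 := fsupp_l2 fpsi.
have h1 : (c%:E * nsq psi <= nsq D)%E.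
  rewrite (frame_nsq (G := psi)) => [|y]; last exact/fsupp_l2/fx.
  rewrite (frame_nsq lD) -esumZ => [||k]; [|exact: ltW|exact: nsq_ge0].
  apply: le_esum => k _; rewrite -/(F k).
  have sF := fsupp_l2 (fF k).
  have -> : (fun y => dotp (f k) (fun x => D (x, y))) =
      fun y => Op K2 d2 (F k) y - (mu - s k) * F k y by apply/funext => y; exact: coefD.
  rewrite -n2_nsq // -n2_nsq; last exact: (fsupp_l2_Op d2 hK2).
  rewrite -EFinM lee_fin.
  have [nz|z] := pselect (exists x, f k x != 0); first exact: (hbb k nz).2.
  have -> : n2 (F k) = 0.
    rewrite -[RHS](@tsum0 R Y); apply: eq_tsum => y; rewrite FE big1 ?expr0n // => x _.
    have -> : f k x = 0 by apply/eqP/negPn/negP => nz; apply: z; exists x.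
    by rewrite mul0r.
  by rewrite mulr0 n2_ge0.
by rewrite -/D -lee_fin EFinM !n2_nsq.
Qed.

End Tensor.

(** * The many-body Hamiltonian and its clusters *)

(** Particles are indexed by any finite type, so that a cluster is again a system of the same
    kind. *)
Definition conf (I : finType) := {ffun I -> int}.

Section Hamiltonian.
Context (R : realType) (g h : R).

Section Operators.
Context (I : finType).
Implicit Types (x : conf I) (q : I * bool) (w : I -> I -> int -> R) (f : conf I -> R).

Definition nb x q : conf I :=
  [ffun j => if j == q.1 then x j + (if q.2 then 1 else -1) else x j].
Definition flip q : I * bool := (q.1, ~~ q.2).

Lemma nbK q : cancel (nb^~ q) (nb^~ (flip q)).
Proof.
move=> x; apply/ffunP => j; rewrite !ffunE /=; case: eqP => // _.
by case: q.2; rewrite /= -addrA ?subrr ?addNr addr0.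
Qed.

Lemma flipK : involutive flip. Proof. by case=> k b; rewrite /flip /= negbK. Qed.

Lemma nb_bij q : bijective (nb^~ q).
Proof. by exists (nb^~ (flip q)); [exact: nbK | move=> x; rewrite -{2}(flipK q) nbK]. Qed.

Definition hop (f : conf I -> R) x : R := - g * \sum_(q : I * bool) f (nb x q).
Definition pos x : int := \sum_i x i.
(** Ordered pairs and one potential per pair: no order on the particles has to be inherited by
    clusters. The interaction of the theorem is [w i j = v] for [i < j] and 0 otherwise. *)
Definition pair_pot w x : R := \sum_i \sum_j w i j (x i - x j).
Definition pot w x : R := - (2 * h * (pos x)%:~R) + pair_pot w x.
Definition nbs : R := (size (index_enum (I * bool)%type))%:R.

Lemma l2_nb f q : l2 f -> l2 (fun x => f (nb x q)).
Proof. by move=> sf; exact: (absum_reindex (h := fun x => f x ^+ 2) (nb_bij q) sf). Qed.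

Lemma n2_nb f q : n2 (fun x => f (nb x q)) = n2 f.
Proof. exact: (tsum_reindex (fun x => f x ^+ 2) (nb_bij q)). Qed.

Lemma bdsym_hop : bdsym hop (g ^+ 2 * nbs ^+ 2).
Proof.
have ls f : l2 f -> l2 (fun x => \sum_(q : I * bool) f (nb x q)).
  by move=> sf; apply: l2_sum => q; exact: l2_nb.
split.
- by rewrite mulr_ge0 ?sqr_ge0.
- move=> a f k x; rewrite /hop !mulr_sumr -big_split /=; apply: eq_bigr => q _; ring.
- by move=> f sf; apply: l2Z; exact: ls.
- move=> f sf; rewrite n2Z; last exact: ls.
  rewrite sqrrN -mulrA ler_wpM2l ?sqr_ge0 //.
  apply: le_trans (n2_sum_le _ (fun q => l2_nb q sf)) _.
  under eq_bigr do rewrite n2_nb.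
  by rewrite big_const_seq count_predT iter_addr_0 -[n2 f *+ _]mulr_natl mulrA -expr2.
- move=> f k sf sk.
  rewrite dotpC !dotpZr //; [|exact: ls|exact: ls]; congr (_ * _).
  rewrite !dotp_sumr // => [|q|q]; [|exact: l2_nb|exact: l2_nb].
  rewrite (reindex_inj (inv_inj flipK)); apply: eq_bigr => q _.
  rewrite /dotp -(tsum_reindex _ (nb_bij q)); apply: eq_tsum => x /=.
  by rewrite nbK mulrC.
Qed.

Definition trans (m : int) x : conf I := [ffun j => x j + m].

Lemma trans_bij m : bijective (trans m).
Proof. by exists (trans (- m)) => x; apply/ffunP => j; rewrite !ffunE ?addrK ?subrK. Qed.

Lemma pos_trans m x : pos (trans m x) = pos x + m *+ #|I|.
Proof.
rewrite /pos; under eq_bigr do rewrite ffunE.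
by rewrite big_split /= sumr_const.
Qed.

Lemma pot_trans w m x : pot w (trans m x) = pot w x - 2 * h * (#|I|%:R * m%:~R).
Proof.
have e : pair_pot w (trans m x) = pair_pot w x.
  apply: eq_bigr => i _; apply: eq_bigr => j _; congr (w i j _).
  by rewrite !ffunE opprD addrACA subrr addr0.
by rewrite /pot e pos_trans intrD -[m *+ _]mulr_natl intrM natz -pmulrn; ring.
Qed.

Lemma nb_trans m x q : nb (trans m x) q = trans m (nb x q).
Proof. by apply/ffunP => j; rewrite !ffunE; case: eqP => // _; rewrite addrAC. Qed.

(** The Wannier-Stark ladder: translating all particles commutes with the hopping, preserves the
    interaction and shifts the linear potential by a constant. *)
Lemma bb_trans w c mu m : bb hop (pot w) c mu -> bb hop (pot w) c (mu - 2 * h * (#|I|%:R * m%:~R)).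
Proof.
move=> [c0 hc]; split => // f ff.
pose f' x := f (trans m x).
have ff' : fsupp f'.
  have [inv k1 k2] := trans_bij m.
  apply: sub_finite_set (finite_image inv ff) => x /= nz.
  by exists (trans m x); rewrite ?k1.
have := hc f' ff'.
rewrite /n2 (tsum_reindex (fun x => f x ^+ 2) (trans_bij m)).
congr (_ <= _); rewrite -[RHS](tsum_reindex _ (trans_bij m)); apply: eq_tsum => x /=.
rewrite /Op /hop pot_trans /f'.
under [in RHS]eq_bigr do rewrite nb_trans.
by congr (_ ^+ 2); ring.
Qed.

Lemma bb_near (w : I -> I -> int -> R) c mu mu' : bb hop (pot w) c mu -> (mu - mu') ^+ 2 <= c / 4 ->
  bb hop (pot w) (c / 4) mu'.
Proof.
move=> [c0 hc] near; split=> [|f ff]; first by rewrite divr_gt0.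
have sf := fsupp_l2 ff.
have h1 : n2 (fun x => Op hop (pot w) f x - mu * f x) <=
   2 * n2 (fun x => Op hop (pot w) f x - mu' * f x) + 2 * ((mu - mu') ^+ 2 * n2 f).
  rewrite -n2Z //; apply: le_trans (n2B_le (fsupp_l2_Op (pot w) bdsym_hop mu' ff) (l2Z _ sf)).
  by rewrite le_eqVlt; apply/orP; left; apply/eqP/eq_tsum => x; congr (_ ^+ 2); ring.
have h2 : (mu - mu') ^+ 2 * n2 f <= c / 4 * n2 f by rewrite ler_wpM2r // n2_ge0.
have := hc f ff; have := n2_ge0 f; nra.
Qed.

End Operators.

Definition hspec (I : finType) (w : I -> I -> int -> R) := spec (@hop I) (pot w).

Section Clusters.
Context (I : finType) (A : {set I}).
Let J := {i in A}.
Let J' := {i in ~: A}.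

Definition comb (z : conf J * conf J') : conf I :=
  [ffun i => if insub i is Some j then z.1 j else if insub i is Some j then z.2 j else 0].

Lemma comb1 z (j : J) : comb z (val j) = z.1 j.
Proof. by rewrite ffunE valK. Qed.
Lemma comb2 z (j : J') : comb z (val j) = z.2 j.
Proof.
rewrite ffunE insubN ?valK //.
by have := valP j; rewrite finset.in_setC.
Qed.

Lemma comb_ext (x y : conf I) : (forall j : J, x (val j) = y (val j)) ->
  (forall j : J', x (val j) = y (val j)) -> x = y.
Proof.
move=> h1 h2; apply/ffunP => i; have [iA|iA] := boolP (i \in A).
  exact: (h1 (Sub i iA)).
have iC : i \in ~: A by rewrite finset.in_setC.
exact: (h2 (Sub i iC)).
Qed.

Lemma comb_bij : bijective comb.
Proof.
exists (fun x : conf I => ([ffun j : J => x (val j)], [ffun j : J' => x (val j)])).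
  move=> [x y]; congr (_, _); apply/ffunP => j; rewrite ffunE.
    by rewrite comb1.
  by rewrite comb2.
by move=> x; apply: comb_ext => j; rewrite ?comb1 ?comb2 ffunE.
Qed.

Lemma cluster_sum (V : nmodType) (F : I -> V) :
  \sum_i F i = \sum_(j : J) F (val j) + \sum_(j : J') F (val j).
Proof.
rewrite (bigID (mem A)) /= -big_sub; congr (_ + _).
rewrite -big_sub; apply: eq_bigl => i; by rewrite finset.in_setC.
Qed.

Lemma val_neq (j : J) (j' : J') : (val j == val j') = false.
Proof.
apply/negP => /eqP e; have := valP j'; rewrite finset.in_setC -e.
by rewrite (valP j).
Qed.

Lemma nb_comb1 z (j : J) b : nb (comb z) (val j, b) = comb (nb z.1 (j, b), z.2).
Proof.
apply: comb_ext => k; rewrite ffunE /= ?comb1 ?comb2.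
  by rewrite ffunE (inj_eq val_inj).
by rewrite eq_sym val_neq.
Qed.

Lemma nb_comb2 z (j : J') b : nb (comb z) (val j, b) = comb (z.1, nb z.2 (j, b)).
Proof.
apply: comb_ext => k; rewrite ffunE /= ?comb1 ?comb2.
  by rewrite val_neq.
by rewrite ffunE (inj_eq val_inj).
Qed.

Lemma hop_comb f z : hop f (comb z) =
  hop (fun x => f (comb (x, z.2))) z.1 + hop (fun y => f (comb (z.1, y))) z.2.
Proof.
rewrite /hop -mulrDr; congr (_ * _).
rewrite -(pair_bigA _ (fun i b => f (nb (comb z) (i, b)))) /= cluster_sum.
rewrite -(pair_bigA _ (fun i b => f (comb (nb z.1 (i, b), z.2)))).
rewrite -(pair_bigA _ (fun i b => f (comb (z.1, nb z.2 (i, b))))) /=.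
by congr (_ + _); apply: eq_bigr => j _; apply: eq_bigr => b _; rewrite ?nb_comb1 ?nb_comb2.
Qed.

(* Removal of the interactions between A and its complement. *)
Definition cut (w : I -> I -> int -> R) i j : int -> R :=
  if (i \in A) == (j \in A) then w i j else fun=> 0.
Definition cut1 (w : I -> I -> int -> R) (i j : J) := w (val i) (val j).
Definition cut2 (w : I -> I -> int -> R) (i j : J') := w (val i) (val j).

Lemma pot_comb w z : pot (cut w) (comb z) = pot (cut1 w) z.1 + pot (cut2 w) z.2.
Proof.
have iJ (j : J) : (val j \in A) = true by exact: valP.
have iJ' (j : J') : (val j \in A) = false by have := valP j; rewrite finset.in_setC => /negPf.
have e1 : pair_pot (cut w) (comb z) = pair_pot (cut1 w) z.1 + pair_pot (cut2 w) z.2.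
  rewrite /pair_pot cluster_sum; congr (_ + _); apply: eq_bigr => i _;
    rewrite cluster_sum.
    rewrite [X in _ + X]big1 ?addr0 => [|j _]; last by rewrite /cut iJ iJ'.
    by apply: eq_bigr => j _; rewrite /cut !iJ !comb1.
  rewrite [X in X + _]big1 ?add0r => [|j _]; last by rewrite /cut iJ iJ'.
  by apply: eq_bigr => j _; rewrite /cut !iJ' !comb2.
have e2 : pos (comb z) = pos z.1 + pos z.2.
  rewrite /pos cluster_sum; congr (_ + _); apply: eq_bigr => j _; by rewrite ?comb1 ?comb2.
by rewrite /pot e1 e2 intrD; ring.
Qed.

(** One [c] has to serve all spectral values of the first cluster; this uniformity is what the
    compactness argument of [cluster_spec_sub] supplies. *)
Lemma cluster_bb w mu c : countable (hspec (cut1 w)) -> 0 < c ->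
  (forall s, hspec (cut1 w) s -> bb (@hop J') (pot (cut2 w)) c (mu - s)) ->
  bb (@hop I) (pot (cut w)) c mu.
Proof.
move=> cs c0 hc; split => // f ff.
have [F [s [sF eF nF frame]]] := eigenfunction_frame (bdsym_hop J) cs.
have [inv k1 k2] := comb_bij.
pose psi z := f (comb z).
have fpsi : fsupp psi.
  by apply: sub_finite_set (finite_image inv ff) => z /= nz; exists (comb z); rewrite ?k1.
have eD z : tensor_op (@hop J) (pot (cut1 w)) (@hop J') (pot (cut2 w)) psi z - mu * psi z =
    Op (@hop I) (pot (cut w)) f (comb z) - mu * f (comb z).
  rewrite /tensor_op /Op /= hop_comb pot_comb /psi; case: z => x y /=; ring.
have := tensor_bb (bdsym_hop J) (bdsym_hop J') sF eF frame c0 (mu := mu) (d2 := pot (cut2 w)).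
move=> /(_ (fun k nz => hc _ (nF k nz)) psi fpsi).
have -> : (fun z => tensor_op (@hop J) (pot (cut1 w)) (@hop J') (pot (cut2 w)) psi z - mu * psi z) =
   (fun x => Op (@hop I) (pot (cut w)) f x - mu * f x) \o comb by apply/funext => z; exact: eD.
rewrite /n2 (tsum_reindex (fun x => f x ^+ 2) comb_bij).
rewrite (tsum_reindex (fun x => (Op (@hop I) (pot (cut w)) f x - mu * f x) ^+ 2) comb_bij).
apply.
exact: (absum_reindex (h := fun x => (Op (@hop I) (pot (cut w)) f x - mu * f x) ^+ 2) comb_bij
  (fsupp_l2_Op _ (bdsym_hop I) _ ff)).
Qed.

End Clusters.
End Hamiltonian.

(** An explicit positive lower bound for finitely many positive numbers, meaningful for the empty
    sequence too. *)
Lemma harmonic_lb (R : realType) (J : eqType) (s : seq J) (c : J -> R) j :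
  (forall i, 0 < c i) -> j \in s ->
  0 < (1 + \sum_(i <- s) (c i)^-1)^-1 /\ (1 + \sum_(i <- s) (c i)^-1)^-1 <= c j.
Proof.
move=> c0 js; have S0 (t : seq J) : 0 <= \sum_(i <- t) (c i)^-1.
  by apply: sumr_ge0 => i _; rewrite invr_ge0 ltW.
have p : 0 < 1 + \sum_(i <- s) (c i)^-1 by have := S0 s; lra.
split; first by rewrite invr_gt0.
rewrite -[c j]invrK lef_pV2 ?posrE ?invr_gt0 //.
rewrite (perm_big _ (perm_to_rem js)) big_cons /=.
by have := S0 (rem j s); lra.
Qed.

(** * Spectrum of two clusters without mutual interaction *)

Section ClusterSpectrum.
Context (R : realType) (g h : R) (I : finType) (A : {set I}).
Hypothesis h0 : h != 0.
Hypotheses (A0 : A != finset.set0) (AT : A != finset.setT).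
Variable w : I -> I -> int -> R.
Let J := {i in A}.
Let J' := {i in ~: A}.
Local Notation bb1 := (bb (@hop R g J) (pot h (cut1 w))).
Local Notation bb2 := (bb (@hop R g J') (pot h (cut2 w))).
Local Notation spec1 := (@hspec R g h J (cut1 w)).
Local Notation spec2 := (@hspec R g h J' (cut2 w)).

(** A common period: the two cluster spectra are invariant under translation by 2h|J| and by 2h|J'|
    respectively. *)
Let P : R := 2 * h * (#|{: J}|%:R * #|{: J'}|%:R).

Let P_neq0 : P != 0.
Proof.
rewrite !mulf_neq0 ?pnatr_eq0 //.
  by rewrite card_sig -[#|_|]/(#|A|) finset.cards_eq0.
rewrite card_sig -[#|_|]/(#|~: A|) finset.cards_eq0.
by apply: contra AT => /eqP e; rewrite -[A]finset.setCK e finset.setC0.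
Qed.

Let per : exists e : int, `|P| = P * e%:~R.
Proof.
have [p|p] := ger0P P; [exists 1 | exists (-1)] => //; first by rewrite mulr1.
by rewrite mulrN1.
Qed.

Let per1 c nu (m : int) : bb1 c nu -> bb1 c (nu + m%:~R * `|P|).
Proof.
have [e ->] := per; move=> /(@bb_trans _ _ _ _ _ _ _ (- (m * e * #|{: J'}|%:Z))).
congr bb; rewrite /P !(mulrNz, intrM) -pmulrn; ring.
Qed.

Let per2 c nu (m : int) : bb2 c nu -> bb2 c (nu + m%:~R * `|P|).
Proof.
have [e ->] := per; move=> /(@bb_trans _ _ _ _ _ _ _ (- (m * e * #|{: J}|%:Z))).
congr bb; rewrite /P !(mulrNz, intrM) -pmulrn; ring.
Qed.

(** If mu is not in the sum set, each real [s] has a neighbourhood with one constant: either it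
    contains no point of [spec1], or mu - s' stays off [spec2]. Finitely many neighbourhoods cover
    one period, and periodicity carries the bound to all of [spec1]. *)
Lemma cluster_spec_sub : countable spec1 ->
  hspec g h (cut A w) `<=` [set s + t | s in spec1 & t in spec2].
Proof.
move=> cs mu smu; apply: contrapT => no.
have no' s : spec1 s -> ~ spec2 (mu - s).
  by move=> s1 s2; apply: no; exists s => //; exists (mu - s) => //; rewrite addrC subrK.
have Pp : 0 < `|P| by rewrite normr_gt0.
have loc (s : R) : exists dc : R * R, [/\ 0 < dc.1, 0 < dc.2 &
    forall s', `|s - s'| < dc.1 -> spec1 s' -> bb2 dc.2 (mu - s')].
  have near (c : R) (s' : R) : 0 < c -> `|s - s'| < Num.min 1 (c / 4) -> (s - s') ^+ 2 <= c / 4.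
    move=> c0; rewrite lt_min => /andP[d1 d2]; rewrite -real_normK ?num_real // expr2.
    by have := normr_ge0 (s - s'); nra.
  have min0 (c : R) : 0 < c -> 0 < Num.min 1 (c / 4).
    by move=> c0; rewrite lt_min ltr01 divr_gt0.
  have [s1|/existsNP[c /contrapT bc]] := pselect (spec1 s).
    have /existsNP[c /contrapT bc] := no' s s1; have c0 := bc.1.
    exists (Num.min 1 (c / 4), c / 4); split => /=; [exact: min0 | by rewrite divr_gt0 |].
    move=> s' /(near _ _ c0) h1 _; apply: bb_near bc _.
    by rewrite (_ : mu - s - (mu - s') = - (s - s')) ?sqrrN //; ring.
  have c0 := bc.1.
  (* No point of [spec1] lies this close to [s], so the second constant is arbitrary. *)
  exists (Num.min 1 (c / 4), 1); split => //=; first exact: min0.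
  by move=> s' /(near _ _ c0) h1 /(_ (c / 4))[]; exact: bb_near bc h1.
have {loc}[dc hdc] := choice loc.
have := @segment_compact R 0 `|P|; rewrite compact_cover.
move=> /(_ R setT (fun s => ball s (dc s).1)) [|s _|D' _ cov].
- by move=> s _; exact: ball_open.
- by exists s => //; apply: ballxx; have [] := hdc s.
have c0 s : 0 < (dc s).2 by have [] := hdc s.
pose c := (1 + \sum_(i <- D') ((dc i).2)^-1)^-1.
have cp : 0 < c.
  rewrite invr_gt0 ltr_wpDr //; apply: sumr_ge0 => i _.
  by rewrite invr_ge0 ltW.
apply: (smu c); apply: cluster_bb => // s s1.
(* Reduce [s] modulo the period into the covered interval; the second cluster is shifted back by the
   same multiple. *)
pose m := Num.floor (s / `|P|).
pose s' := s - m%:~R * `|P|.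
have s1' : spec1 s'.
  by move=> b /(per1 m); rewrite subrK; exact: s1.
have [t /= tD' bt] : cover [set` D'] (fun s => ball s (dc s).1) s'.
  apply: cov; rewrite /= in_itv /= /s'; have := floor_itv (s / `|P|).
  rewrite -/m ler_pdivlMr // ltr_pdivrMr // intrD mulrDl mul1r => /andP[h1 h2].
  by apply/andP; split; lra.
have [_ _ /(_ s' bt s1') b2] := hdc t.
have [_ le] := harmonic_lb c0 tD'.
have := per2 (- m) (bb_le cp le b2).
by congr (bb2 c _); rewrite /s' mulrNz; ring.
Qed.

Lemma countable_cluster_spec : countable spec1 -> countable spec2 -> countable (hspec g h (cut A w)).
Proof.
move=> c1 c2; apply: sub_countable (subset_card_le (cluster_spec_sub c1)) _.
rewrite (_ : [set _ | _ in _ & _ in _] = (fun z => z.1 + z.2) @` (spec1 `*` spec2)).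
  by apply: sub_countable (card_image_le _ _) _; exact: countableX.
apply/seteqP; split => [_ [s hs [t ht <-]]|_ [[s t] [hs ht] <-]]; first by exists (s, t).
by exists s => //; exists t.
Qed.

End ClusterSpectrum.

(** * The essential spectrum *)

Section Geometry.
Context (I : finType).
Implicit Types (x y : conf I).

(** [B r] collects the particles within G r of [i0]. If it stops growing before it is full, a gap of
    size G separates it from the rest; otherwise it gains a particle at each step and is full after
    #|I| steps. *)
Lemma gap_or_clustered x (i0 : I) (G : int) : 0 <= G ->
  (exists A : {set I}, [/\ A != finset.set0, A != finset.setT &
     forall i j, i \in A -> j \notin A -> G <= `|x i - x j|]) \/
  (forall i, `|x i - x i0| <= G * #|I|%:Z).
Proof.
move=> G0; apply: contrapT => /not_orP[nogap nclus].
pose B (r : nat) : {set I} := finset (fun i => `|x i - x i0| <= G * r%:Z).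
have i0B r : i0 \in B r by rewrite finset.inE subrr normr0 mulr_ge0.
have Bn0 r : B r != finset.set0 by apply/finset.set0Pn; exists i0.
have card r : B r = finset.setT \/ (r < #|B r|)%N.
  elim: r => [|r IH]; first by right; apply/card_gt0P; exists i0.
  have sub : B r \subset B r.+1.
    by apply/fintype.subsetP => i; rewrite !finset.inE; nia.
  have [BT|BnT] := eqVneq (B r) finset.setT.
    by left; apply/eqP; rewrite -finset.subTset -BT.
  right; have {IH}[BT|lt] := IH; first by rewrite BT eqxx in BnT.
  apply: leq_ltn_trans lt _; apply: proper_card; rewrite properE sub /=.
  apply: contra_notN nogap => sub'; exists (B r); split => // i j.
  move=> iB jB; rewrite leNgt; apply/negP => lt.
  have /negP[] := jB; apply: (fintype.subsetP sub').
  by move: iB; rewrite !finset.inE; nia.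
case: (card #|I|) => [BT|]; last by rewrite ltnNge max_card.
apply: nclus => i; have : i \in B #|I| by rewrite BT finset.inE.
by rewrite finset.inE.
Qed.

Lemma finite_box (r : nat) : finite_set [set x : conf I | forall i, `|x i| <= r%:Z].
Proof.
pose e (z : {ffun I -> 'I_(r + r).+1}) : conf I := [ffun i => (z i)%:Z - r%:Z].
have fe : finite_set (e @` [set: {ffun I -> 'I_(r + r).+1}]) by exact/finite_image/finite_finset.
apply: (sub_finite_set _ fe) => x /= hx.
exists [ffun i => inord (absz (x i + r%:Z))] => //.
apply/ffunP => i; rewrite !ffunE inordK; have := hx i; lia.
Qed.

(** Without a gap all particles are near [i0], so the total position is nearly #|I| times that of
    [i0]; if it is also small, the configuration lies in a bounded box. *)
Lemma far_or_gap (i0 : I) (M G : int) : 0 <= M -> 0 <= G ->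
  exists F : set (conf I), finite_set F /\ forall x, ~ F x -> M <= `|pos x| \/
    exists A : {set I}, [/\ A != finset.set0, A != finset.setT &
     forall i j, i \in A -> j \notin A -> G <= `|x i - x j|].
Proof.
move=> M0 G0; pose n := #|I|%:Z.
have n0 : 1 <= n by rewrite /n; have : (0 < #|I|)%N by [apply/card_gt0P; exists i0]; lia.
(* The total position and its deviation from n x_i0 bound |x_i0| by M + G n^2; the distance to [i0]
   adds G n. *)
pose r := absz (M + G * n * n + G * n).
exists [set x : conf I | forall i, `|x i| <= r%:Z]; split; first exact: finite_box.
move=> x nF; have [|clus] := gap_or_clustered x i0 G0; first by right.
left; rewrite leNgt; apply/negP => lt; apply: nF => i /=.
have e : pos x - n * x i0 = \sum_j (x j - x i0).
  by rewrite sumrB sumr_const -[x i0 *+ _]mulr_natl natz.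
have b : `|pos x - n * x i0| <= n * (G * n).
  rewrite e; apply: le_trans (ler_norm_sum _ _ _) _.
  apply: le_trans (ler_sum _ (fun j _ => clus j)) _.
  by rewrite sumr_const -[_ *+ #|I|]mulr_natl natz.
have := clus i; rewrite -/n.
have : 0 <= G * n by nia.
have : 0 <= G * n * n by nia.
have : `|x i0| <= `|n * x i0| by rewrite normrM; have := normr_ge0 (x i0); nia.
rewrite /r; move: b; rewrite [n * (G * n)]mulrC; lia.
Qed.

Definition in_box (L : nat) x := [forall i, (0 <= x i) && (x i < L%:Z)].
Definition cshift (k : I) (m : int) x : conf I := [ffun i => if i == k then x i + m else x i].

Lemma cshift_bij k m : bijective (cshift k m).
Proof.
by exists (cshift k (- m)) => x; apply/ffunP => i; rewrite !ffunE; case: eqP => //; rewrite ?addrK ?subrK.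
Qed.

End Geometry.

(** * Localization by translated boxes *)

Section Boxes.
Context (R : realType) (I : finType) (L : nat).
Hypothesis L0 : (0 < L)%N.
Implicit Types (x y z : conf I).

Definition box z : R := (in_box L z)%:R.
Definition face (k : I) (j : int) z : R := (in_box L z && (z k == j))%:R.

Lemma box01 z : box z ^+ 2 = box z.
Proof. by rewrite /box; case: in_box; rewrite ?expr1n ?expr0n. Qed.

Lemma fsupp_box (f : conf I -> R) : (forall z, ~~ in_box L z -> f z = 0) -> fsupp f.
Proof.
move=> h; apply: sub_finite_set (@finite_box I L) => z /=.
apply: contra_neqP => nb'; apply: h; apply/negP => /forallP b; apply: nb' => i.
by have := b i; lia.
Qed.

Lemma absum_box : absum box.
Proof. by apply/absum_fsupp/fsupp_box => z /negPf h; rewrite /box h. Qed.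

Lemma absum_face k j : absum (face k j).
Proof. by apply/absum_fsupp/fsupp_box => z /negPf h; rewrite /face h. Qed.

Lemma tsum_face k (j : nat) : (j < L)%N -> tsum (face k j) = tsum (face k 0).
Proof.
move=> jL; rewrite -(tsum_reindex _ (cshift_bij k j)); apply: eq_tsum => z /=.
congr (nat_of_bool _)%:R; apply/andP/andP => -[/forallP b /eqP e].
  move: e; rewrite ffunE eqxx => e; have zk : z k = 0 by apply: (addIr (j%:Z)); rewrite e add0r.
  split; last by rewrite zk.
  apply/forallP => i; have := b i; rewrite ffunE; case: eqP => // ->; rewrite zk; lia.
split; last by rewrite ffunE eqxx e add0r.
by apply/forallP => i; have := b i; rewrite ffunE; case: eqP => // -> _; rewrite e; lia.
Qed.

Lemma tsum_box k : tsum box = L%:R * tsum (face k 0).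
Proof.
transitivity (\sum_(j <- index_iota 0 L) tsum (face k j%:Z)).
  rewrite -tsum_sum => [|j]; last exact: absum_face.
  apply: eq_tsum => z; rewrite /box /face.
  have [b|nb'] := boolP (in_box L z); last by rewrite big1.
  have := forallP b k => /andP[z0 zL].
  rewrite (bigD1_seq (absz (z k))) /= ?iota_uniq ?mem_index_iota //; last by lia.
  have zE : z k = (absz (z k))%:Z by rewrite gez0_abs.
  rewrite big1 => [|j jz]; first by rewrite -zE eqxx addr0.
  by rewrite {1}zE eqz_nat eq_sym (negPf jz).
rewrite big_nat (eq_bigr (fun=> tsum (face k 0))) => [|j jL]; last exact: tsum_face.
by rewrite -big_nat big_const_nat iter_addr_0 subn0 -[tsum _ *+ _]mulr_natl.
Qed.

Lemma tsum_box_gt0 : 0 < tsum box.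
Proof.
apply: lt_le_trans (ge0_le_tsum (0 : {ffun I -> int}) _ absum_box) => [|z]; last exact: ler0n.
rewrite /box (_ : in_box L _) // .
by apply/forallP => i; rewrite ffunE; lia.
Qed.

Definition edge (q : I * bool) : int := if q.2 then L%:Z - 1 else 0.

Definition jump (q : I * bool) z : R := (box (nb z q) - box z) ^+ 2.

Lemma exit_edge q z : in_box L z -> ~~ in_box L (nb z q) -> z q.1 = edge q.
Proof.
move=> /forallP b; rewrite negb_forall => ex; have [i ni] := fintype.existsP ex.
move: ni; have := b i; have := b q.1; rewrite ffunE /edge.
by case: eqP => [->|]; case: q.2; lia.
Qed.

Lemma jump_le q z : jump q z <= face q.1 (edge q) z + face q.1 (edge (flip q)) (nb z q).
Proof.
rewrite /jump /box /face.
have [b|b] := boolP (in_box L z); have [b'|b'] := boolP (in_box L (nb z q)).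
- by rewrite subrr expr0n addr_ge0.
- by rewrite (exit_edge b b') eqxx /= sub0r sqrrN expr1n addr0.
- have -> : nb z q q.1 = edge (flip q).
    by apply: (exit_edge (q := flip q) b'); rewrite nbK.
  by rewrite eqxx /= subr0 expr1n add0r.
- by rewrite subrr expr0n addr_ge0.
Qed.

Lemma absum_jump q : absum (jump q).
Proof.
apply: le_absum (absumD (absum_face q.1 (edge q))
  (absum_reindex (nb_bij q) (absum_face q.1 (edge (flip q))))) => z /=.
by rewrite !ger0_norm ?sqr_ge0 ?addr_ge0 //; exact: jump_le.
Qed.

(** Surface against volume: a hop crosses the boundary only at two opposite faces, each carrying a
    fraction 1/L of the box. *)
Lemma tsum_jump q : L%:R * tsum (jump q) <= 2 * tsum box.
Proof.
have af' := absum_reindex (nb_bij q) (absum_face q.1 (edge (flip q))).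
have fe q' : q'.1 = q.1 -> L%:R * tsum (face q.1 (edge q')) = tsum box.
  move=> e; rewrite /edge (tsum_box q.1); case: q'.2 => //.
  by rewrite (_ : L%:Z - 1 = L.-1%:Z) ?tsum_face //; lia.
have : tsum (jump q) <= tsum (face q.1 (edge q)) + tsum (face q.1 (edge (flip q))).
  rewrite -[tsum (face _ (edge (flip q)))](tsum_reindex _ (nb_bij q)).
  rewrite -tsumD //; last exact: absum_face.
  apply: le_tsum; [exact: absum_jump | exact: absumD (absum_face _ _) af' | exact: jump_le].
have p : 0 < L%:R :> R by rewrite ltr0n.
move=> /(ler_wpM2l (ltW p)).
have := fe q erefl; have := fe (flip q) erefl; lra.
Qed.

Definition csub x y : conf I := [ffun i => x i - y i].
Lemma csub_bij x : bijective (csub x).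
Proof. by exists (csub x) => y; apply/ffunP => i; rewrite !ffunE opprB addrC subrK. Qed.
Lemma nb_csub x y q : nb (csub x y) q = csub (nb x q) y.
Proof. by apply/ffunP => i; rewrite !ffunE; case: eqP => // _; rewrite addrAC. Qed.

Lemma esum_csub (f : conf I -> R) x : (forall z, 0 <= f z) -> absum f ->
  \esum_(y in [set: conf I]) (f (csub x y))%:E = (tsum f)%:E.
Proof.
move=> f0 sf; rewrite -(tsum_reindex f (csub_bij x)) ge0_tsum_esum // => [z|]; first exact: f0.
exact: (absum_reindex (csub_bij x) sf).
Qed.

(** Every point lies in exactly [tsum box] of the translated boxes, so up to this factor they form a
    quadratic partition of unity. *)
Lemma esum_box_nsq (f : conf I -> R) :
  \esum_(y in [set: conf I]) nsq (fun x => box (csub x y) * f x) = ((tsum box)%:E * nsq f)%E.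
Proof.
rewrite esum_swap => [|x y]; last by rewrite lee_fin sqr_ge0.
rewrite -esumZ => [||x]; [|exact/ltW/tsum_box_gt0|by rewrite lee_fin sqr_ge0].
apply: eq_esum => x _; rewrite muleC -(esum_csub x _ absum_box) => [|z]; last exact: ler0n.
rewrite -esumZ => [||z]; [|exact: sqr_ge0|by rewrite lee_fin; exact: ler0n].
by apply: eq_esum => y _; rewrite exprMn box01 mulrC EFinM.
Qed.

(* Commutator of the hopping term with multiplication by the box translated by y. *)
Definition leak (g : R) (psi : conf I -> R) y x :=
  - g * \sum_q (box (csub (nb x q) y) - box (csub x y)) * psi (nb x q).

(** Cauchy-Schwarz over the neighbours, then [tsum_jump] for the sum over translates: compared with
    the volume factor of [esum_box_nsq], the commutator error is of order 1/L. *)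
Lemma esum_leak g psi : l2 psi ->
  (\esum_(y in [set: conf I]) nsq (leak g psi y) <=
   (g ^+ 2 * nbs R I ^+ 2 * (2 * tsum box / L%:R) * n2 psi)%:E)%E.
Proof.
move=> sp; set b := 2 * tsum box / L%:R.
have p : 0 < L%:R :> R by rewrite ltr0n.
rewrite esum_swap => [|y x]; last by rewrite lee_fin sqr_ge0.
pose u x := g ^+ 2 * (nbs R I * \sum_(q : I * bool) b * psi (nb x q) ^+ 2).
have b0 : 0 <= b by rewrite divr_ge0 ?mulr_ge0 ?ltW ?tsum_box_gt0.
have u0 x : 0 <= u x.
  apply: mulr_ge0 (sqr_ge0 _) (mulr_ge0 (ler0n _ _) _).
  by apply: sumr_ge0 => q _; apply: mulr_ge0 => //; exact: sqr_ge0.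
have su : absum u.
  apply/absumZ/absumZ/absum_sum => q; apply: absumZ; exact: l2_nb.
have -> : g ^+ 2 * nbs R I ^+ 2 * b * n2 psi = tsum u.
  rewrite /u tsumZ; last by apply/absumZ/absum_sum => q; apply: absumZ; exact: l2_nb.
  rewrite tsumZ; last by apply/absum_sum => q; apply: absumZ; exact: l2_nb.
  rewrite tsum_sum => [|q]; last by apply: absumZ; exact: l2_nb.
  rewrite (eq_bigr (fun=> b * n2 psi)) => [|q _]; last first.
    by rewrite tsumZ; [rewrite -(n2_nb psi q) | exact: l2_nb].
  by rewrite big_const_seq count_predT iter_addr_0 -[(b * _) *+ _]mulr_natl -/(nbs R I); ring.
rewrite ge0_tsum_esum //; apply: le_esum => x _.
pose v z := g ^+ 2 * (nbs R I * \sum_(q : I * bool) psi (nb x q) ^+ 2 * jump q z).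
have sv : absum v by apply/absumZ/absumZ/absum_sum => q; exact/absumZ/absum_jump.
have v0 z : 0 <= v z.
  apply: mulr_ge0 (sqr_ge0 _) (mulr_ge0 (ler0n _ _) _).
  by apply: sumr_ge0 => q _; apply: mulr_ge0 => //; exact: sqr_ge0.
apply: (@le_trans _ _ (\esum_(y in [set: conf I]) (v (csub x y))%:E)).
  apply: le_esum => y _; rewrite lee_fin /leak exprMn sqrrN ler_wpM2l ?sqr_ge0 //.
  apply: le_trans (sqr_sum_le _ _) _; rewrite ler_wpM2l ?ler0n //.
  by apply: ler_sum => q _; rewrite exprMn mulrC /jump nb_csub.
rewrite esum_csub // lee_fin /v tsumZ; last by apply/absumZ/absum_sum => q; exact/absumZ/absum_jump.
rewrite tsumZ; last by apply/absum_sum => q; exact/absumZ/absum_jump.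
rewrite tsum_sum => [|q]; last exact/absumZ/absum_jump.
rewrite ler_wpM2l ?sqr_ge0 // ler_wpM2l ?ler0n //; apply: ler_sum => q _.
rewrite tsumZ; last exact: absum_jump.
rewrite [leRHS]mulrC ler_wpM2l ?sqr_ge0 //.
by rewrite /b ler_pdivlMr // mulrC tsum_jump.
Qed.

End Boxes.

Lemma gap_stable (a b a0 b0 l G G' : int) : G + 2 * l <= `|a0 - b0| ->
  `|a - a0| <= l -> `|b - b0| <= l -> G' <= G -> G' <= `|a - b|.
Proof. lia. Qed.

(** * Lower bounds off a finite set of configurations *)

Section HVZ.
Context (R : realType) (g h : R) (I : finType) (i0 : I).
Variables (w : I -> I -> int -> R) (W : R).
Hypothesis h0 : h != 0.
Hypothesis wW : forall i j n, `|w i j n| <= W.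
Hypothesis wdecay : forall e, 0 < e -> exists G : int, 0 <= G /\
  forall i j n, G <= `|n| -> `|w i j n| <= e.
Local Notation H := (Op (@hop R g I) (pot h w)).
Let B := g ^+ 2 * nbs R I ^+ 2.
Let hK := bdsym_hop g I.

Let B0 : 0 <= B. Proof. exact: bdsym_ge0 hK. Qed.

(** Since h is nonzero, the linear potential beats the bounded hopping and interaction far out, with
    any prescribed constant. *)
Lemma bb_far (c mu : R) : exists M : int, 0 <= M /\ forall chi : conf I -> R, fsupp chi ->
  (forall x, chi x != 0 -> M <= `|pos x|) -> c * n2 chi <= n2 (fun x => H chi x - mu * chi x).
Proof.
pose Wt : R := \sum_(i : I) \sum_(j : I) W.
have hWt x : `|pair_pot w x| <= Wt.
  apply: le_trans (ler_norm_sum _ _ _) _; apply: ler_sum => i _.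
  by apply: le_trans (ler_norm_sum _ _ _) _; apply: ler_sum => j _.
(* Splitting off the hopping gives M' |chi|^2 <= 2 |(H - mu) chi|^2 + 2 B |chi|^2, which leaves more
   than |c|. *)
pose M' := 1 + 2 * `|c| + 2 * B.
have M'1 : 1 <= M' by have := normr_ge0 c; have := B0; rewrite /M'; lra.
(* |pos x| >= Q gives |pot - mu| >= 2 |h| Q - Wt - |mu| = M', and M' >= 1 passes this to the
   square. *)
pose Q := (M' + Wt + `|mu|) / (2 * `|h|).
have hp : 0 < `|h| by rewrite normr_gt0.
exists ((Num.truncn Q).+1%:Z); split => // chi fchi far.
have sc := fsupp_l2 fchi.
have big x : chi x != 0 -> M' <= (pot h w x - mu) ^+ 2.
  move=> /far; rewrite -(ler_int R) => le.
  have Ql : Q <= `|(pos x)%:~R|.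
    by rewrite -intr_norm; apply: le_trans le; rewrite -pmulrn ltW // truncnS_gt.
  move: Ql; rewrite /Q ler_pdivrMr ?mulr_gt0 // => Ql.
  have e1 : `|2 * h * (pos x)%:~R| = `|(pos x)%:~R| * (2 * `|h|) :> R.
    by rewrite !normrM (@ger0_norm _ 2) //; ring.
  have e2 : M' <= `|pot h w x - mu|.
    have := hWt x; have := lerB_dist (2 * h * (pos x)%:~R) (pair_pot w x - mu).
    have := ler_normB (pair_pot w x) mu.
    have -> : `|pot h w x - mu| = `|2 * h * (pos x)%:~R - (pair_pot w x - mu)|.
      by rewrite -normrN; congr `|_|; rewrite /pot; ring.
    rewrite e1; lra.
  rewrite -real_normK ?num_real // expr2; nra.
have sD := fsupp_l2_Op (pot h w) hK mu fchi.
have h1 : M' * n2 chi <= n2 (fun x => (H chi x - mu * chi x) - hop g chi x).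
  rewrite /n2 -tsumZ //; apply: le_tsum => [||x]; first exact: absumZ.
    exact: l2B sD (bdsym_l2 hK sc).
  have -> : H chi x - mu * chi x - hop g chi x = (pot h w x - mu) * chi x by rewrite /Op; ring.
  rewrite exprMn; have [->|nz] := eqVneq (chi x) 0; first by rewrite expr0n !mulr0.
  by rewrite ler_wpM2r ?sqr_ge0 // big.
have h2 := le_trans h1 (n2B_le sD (bdsym_l2 hK sc)).
have h3 := bdsym_bd hK sc; rewrite -/B in h3.
have h4 : c * n2 chi <= `|c| * n2 chi by rewrite ler_wpM2r ?n2_ge0 // ler_norm.
have := n2_ge0 chi; rewrite /M' in h2; nra.
Qed.

(** Across a wide gap the removed interactions are uniformly small, so the bound for the cut
    operator survives with a smaller constant. *)
Lemma bb_gap (A : {set I}) (C mu : R) : bb (@hop R g I) (pot h (cut A w)) C mu ->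
  exists G : int, 0 <= G /\ forall chi : conf I -> R, fsupp chi ->
  (forall x, chi x != 0 -> forall i j, i \in A -> j \notin A -> G <= `|x i - x j|) ->
  C / 4 * n2 chi <= n2 (fun x => H chi x - mu * chi x).
Proof.
move=> [C0 hC]; pose S : R := \sum_(i : I) \sum_(j : I) 1.
have S0 : 0 <= S by apply: sumr_ge0 => i _; exact: sumr_ge0.
(* Both bounds on [e1] together give e1^2 <= C/8; dividing by S + 1, with S the number of pairs,
   makes the total removed interaction at most [e1]. *)
pose e1 := Num.min 1 (C / 8); have e10 : 0 < e1 by rewrite lt_min ltr01 divr_gt0.
have S1 : 0 < S + 1 by lra.
have [G [G0 hG]] := wdecay (divr_gt0 e10 S1).
exists G; split => // chi fchi gap; have sc := fsupp_l2 fchi.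
have small x : chi x != 0 -> (pot h w x - pot h (cut A w) x) ^+ 2 <= C / 8.
  move=> nz; have {}gap := gap x nz.
  have -> : pot h w x - pot h (cut A w) x =
      \sum_i \sum_j (w i j (x i - x j) - cut A w i j (x i - x j)).
    transitivity (pair_pot w x - pair_pot (cut A w) x); first by rewrite /pot; ring.
    rewrite /pair_pot -sumrB.
    by apply: eq_bigr => i _; rewrite -sumrB.
  have : `|\sum_i \sum_j (w i j (x i - x j) - cut A w i j (x i - x j))| <= S * (e1 / (S + 1)).
    rewrite /S mulr_suml; apply: le_trans (ler_norm_sum _ _ _) _; apply: ler_sum => i _.
    rewrite mulr_suml; apply: le_trans (ler_norm_sum _ _ _) _; apply: ler_sum => j _.
    rewrite mul1r /cut; case: (boolP (i \in A)); case: (boolP (j \in A)) => ja ia /=;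
      rewrite ?subrr ?normr0 ?subr0; try by apply: ltW; exact: divr_gt0.
      by apply: hG; exact: gap.
    by apply: hG; rewrite distrC; exact: gap.
  have le1 : S * (e1 / (S + 1)) <= e1 by rewrite mulrA ler_pdivrMr //; nra.
  have e11 : e1 <= 1 by rewrite ge_min lexx.
  have e18 : e1 <= C / 8 by rewrite ge_min lexx orbT.
  rewrite -[X in X <= C / 8]real_normK ?num_real // expr2 => le2.
  have := normr_ge0 (\sum_i \sum_j (w i j (x i - x j) - cut A w i j (x i - x j))).
  nra.
have sD := fsupp_l2_Op (pot h w) hK mu fchi.
have se : l2 (fun x => (pot h w x - pot h (cut A w) x) * chi x).
  apply: fsupp_l2; apply: sub_finite_set fchi => x /=.
  by apply: contraNN => /eqP ->; rewrite mulr0.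
have h1 : n2 (fun x => (pot h w x - pot h (cut A w) x) * chi x) <= C / 8 * n2 chi.
  rewrite /n2 -tsumZ //; apply: le_tsum => [//||x]; first exact: absumZ.
  rewrite exprMn; have [->|nz] := eqVneq (chi x) 0; first by rewrite expr0n !mulr0.
  by rewrite ler_wpM2r ?sqr_ge0 // small.
have h2 : n2 (fun x => Op (hop g (I:=I)) (pot h (cut A w)) chi x - mu * chi x) <=
    2 * n2 (fun x => H chi x - mu * chi x) + 2 * (C / 8 * n2 chi).
  have := n2B_le sD se.
  rewrite (_ : (fun x => H chi x - mu * chi x - _) =
    fun x => Op (hop g (I:=I)) (pot h (cut A w)) chi x - mu * chi x); last first.
    by apply/funext => x; rewrite /Op; ring.
  lra.
have h3 := hC chi fchi; have := mulr_ge0 (ltW C0) (n2_ge0 chi); lra.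
Qed.

(* Localization to large boxes: outside a finite set every box lies either far out in the
   direction of the total position or where two clusters are far apart. *)
Theorem hvz (mu : R) : (forall A : {set I}, A != finset.set0 -> A != finset.setT ->
    ~ hspec g h (cut A w) mu) ->
  exists (F : set (conf I)) (c : R), [/\ finite_set F, 0 < c & forall psi : conf I -> R, fsupp psi ->
    (forall x, F x -> psi x = 0) -> c * n2 psi <= n2 (fun x => H psi x - mu * psi x)].
Proof.
move=> hA.
have /choice[cG hcG] : forall A : {set I}, exists cG : R * int, [/\ 0 < cG.1, 0 <= cG.2 &
    A != finset.set0 -> A != finset.setT -> forall chi : conf I -> R, fsupp chi ->
    (forall x, chi x != 0 -> forall i j, i \in A -> j \notin A -> cG.2 <= `|x i - x j|) ->
    cG.1 * n2 chi <= n2 (fun x => H chi x - mu * chi x)].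
  move=> A; have [A0|A0] := eqVneq A finset.set0; first by exists (1, 0); split.
  have [AT|AT] := eqVneq A finset.setT; first by exists (1, 0); split.
  have /existsNP[C /contrapT bC] := hA A A0 AT.
  have [G [G0 hG]] := bb_gap bC.
  by exists (C / 4, G); split => //; rewrite divr_gt0 //; exact: bC.1.
pose C := (1 + \sum_A ((cG A).1)^-1)^-1.
have CA A : 0 < C /\ C <= (cG A).1.
  by apply: harmonic_lb => [i|]; [have [] := hcG i | exact: mem_index_enum].
have C0 : 0 < C := (CA finset.set0).1.
pose G := \sum_A (cG A).2.
have GA A : (cG A).2 <= G.
  by rewrite /G (bigD1 A) //= lerDl sumr_ge0 // => i _; have [] := hcG i.
have G0 : 0 <= G by apply: sumr_ge0 => i _; have [] := hcG i.
have [M [M0 hM]] := bb_far C mu.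
(* This makes the summed commutator error at most a quarter of C times the box volume; its factor 2
   then absorbs half of the left-hand side. *)
pose L := (Num.truncn (8 * B / C)).+1.
have LB : 8 * B / C < L%:R by exact: truncnS_gt.
(* The alternative is decided at a single point of the box, where each coordinate varies by at most
   L; the thresholds are enlarged so that it holds on the whole box. *)
have M0' : 0 <= M + #|I|%:Z * L%:Z by rewrite addr_ge0 // mulr_ge0.
have G0' : 0 <= G + 2 * L%:Z by rewrite addr_ge0 // mulr_ge0.
have [F [fF hF]] := far_or_gap i0 M0' G0'.
exists F, (C / 4); split => //; first by rewrite divr_gt0.
move=> psi fpsi psiF; have sp := fsupp_l2 fpsi.
have L0 : (0 < L)%N by [].
pose psiy y x := box R L (csub x y) * psi x.
have fpy y : fsupp (psiy y).
  by apply: sub_finite_set fpsi => x /=; apply: contraNN => /eqP e; rewrite /psiy e mulr0.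
have key y : C * n2 (psiy y) <= n2 (fun x => H (psiy y) x - mu * psiy y x).
  have [[x0 nz0]|z] := pselect (exists x, psiy y x != 0); last first.
    have -> : n2 (psiy y) = 0.
      rewrite -[RHS](@tsum0 R (conf I)); apply: eq_tsum => x.
      have -> : psiy y x = 0 by apply/eqP/negPn/negP => nz; apply: z; exists x.
      by rewrite expr0n.
    by rewrite mulr0 n2_ge0.
  have inb x : psiy y x != 0 -> forall i, 0 <= x i - y i < L%:Z.
    rewrite /psiy /box; case: (boolP (in_box L _)) => [/forallP b _ i|]; last by rewrite mul0r eqxx.
    by have := b i; rewrite ffunE.
  have nF : ~ F x0 by move=> /psiF e; move: nz0; rewrite /psiy e mulr0 eqxx.
  have close x i : psiy y x != 0 -> `|x i - x0 i| <= L%:Z.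
    by move=> /inb/(_ i); have := inb _ nz0 i; lia.
  case: (hF x0 nF) => [far|[A [A0 AT gapA]]].
    apply: hM => // x nz.
    have : `|pos x - pos x0| <= #|I|%:Z * L%:Z.
      rewrite /pos -sumrB; apply: le_trans (ler_norm_sum _ _ _) _.
      apply: le_trans (ler_sum _ (fun i _ => close x i nz)) _.
      by rewrite sumr_const -[_ *+ #|I|]mulr_natl natz.
    move: far; lia.
  have [_ _ /(_ A0 AT (psiy y) (fpy y))] := hcG A; move=> h1.
  apply: le_trans (h1 _); first by rewrite ler_wpM2r ?n2_ge0 //; exact: (CA A).2.
  move=> x nz i j iA jA.
  exact: gap_stable (gapA i j iA jA) (close x i nz) (close x j nz) (GA A).
pose D x := H psi x - mu * psi x.
have sD : l2 D by exact: (fsupp_l2_Op (pot h w) hK mu fpsi).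
have psiyE y x : H (psiy y) x - mu * psiy y x = box R L (csub x y) * D x + leak L g psi y x.
  rewrite /D /Op /hop /leak /psiy.
  have -> : \sum_q (box R L (csub (nb x q) y) - box R L (csub x y)) * psi (nb x q) =
      \sum_q box R L (csub (nb x q) y) * psi (nb x q) - box R L (csub x y) * \sum_q psi (nb x q).
    by rewrite mulr_sumr -sumrB; apply: eq_bigr => q _; rewrite mulrBl.
  ring.
have sbD y : l2 (fun x => box R L (csub x y) * D x).
  apply: le_l2 sD => x; rewrite normrM /box; case: in_box; rewrite ?normr1 ?mul1r //.
  by rewrite normr0 mul0r.
have sl y : l2 (leak L g psi y).
  have := l2B (fsupp_l2_Op (pot h w) hK mu (fpy y)) (sbD y); apply: le_l2 => x.
  by rewrite psiyE addrAC subrr add0r.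
have key' y : (C%:E * nsq (psiy y) <=
    2%:E * nsq (fun x => (box R L (csub x y) * D x)%R) + 2%:E * nsq (leak L g psi y))%E.
  rewrite -!n2_nsq //; last exact: fsupp_l2.
  rewrite -!EFinM -EFinD lee_fin; apply: le_trans (key y) _.
  by rewrite (_ : (fun x => _) = fun x => box R L (csub x y) * D x + leak L g psi y x);
    [exact: n2D_le | exact/funext/psiyE].
pose a := tsum (@box R I L); have a0 : 0 < a := @tsum_box_gt0 R I L L0.
have total : (C%:E * (a%:E * nsq psi) <= 2%:E * (a%:E * nsq D) + 2%:E *
    (g ^+ 2 * nbs R I ^+ 2 * (2 * a / L%:R) * n2 psi)%:E)%E.
  apply: (@le_trans _ _ (2%:E * (a%:E * nsq D) + 2%:E *
     \esum_(y in [set: conf I]) nsq (leak L g psi y))%E); last first.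
    by rewrite leeD2l // lee_pmul2l ?lte_fin // esum_leak.
  rewrite -!esum_box_nsq // -!esumZ //; try (by move=> y; exact: nsq_ge0); try exact: ltW.
  rewrite -esumD => [|y _|y _]; [|by rewrite mule_ge0 ?nsq_ge0|by rewrite mule_ge0 ?nsq_ge0].
  by apply: le_esum => y _; exact: key'.
rewrite -!n2_nsq // -!EFinM -EFinD lee_fin -/B in total.
have Lp : 0 < L%:R :> R by rewrite ltr0n.
have n0 := n2_ge0 psi.
have BL : B * (2 * a / L%:R) <= C * a / 4.
  rewrite mulrA ler_pdivrMr //; rewrite ltr_pdivrMr // in LB.
  have := ler_wpM2l (ltW a0) (ltW LB); lra.
have last : B * (2 * a / L%:R) * n2 psi <= C * a / 4 * n2 psi by rewrite ler_wpM2r.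
rewrite -(ler_pM2l a0) -/D; lra.
Qed.

End HVZ.

(** * Almost orthonormal families and finiteness of isolated spectrum *)

Section Gram.
Context (R : realType) (T : choiceType) (m : nat) (u : 'I_m -> T -> R).
Hypothesis su : forall i, l2 (u i).

Lemma n2_comb (a : 'I_m -> R) : n2 (fun x => \sum_i a i * u i x) =
  \sum_i \sum_j a i * a j * dotp (u i) (u j).
Proof.
have sF : l2 (fun x => \sum_i a i * u i x) by apply: l2_sum => i; exact: l2Z.
transitivity (dotp (fun x => \sum_i a i * u i x) (fun x => \sum_i a i * u i x)).
  by apply: eq_tsum => x; rewrite expr2.
rewrite dotp_sumr // => [|i]; last exact: l2Z.
apply: eq_bigr => i _; rewrite dotpZr // dotpC dotp_sumr // => [|j]; last exact: l2Z.
by rewrite mulr_sumr; apply: eq_bigr => j _; rewrite dotpZr // mulrA.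
Qed.

Lemma gram_almost_orthonormal (a : 'I_m -> R) eta :
  (forall i j, `|dotp (u i) (u j) - (i == j)%:R| <= eta) ->
  `|n2 (fun x => \sum_i a i * u i x) - \sum_i a i ^+ 2| <= eta * m%:R * \sum_i a i ^+ 2.
Proof.
move=> hd; rewrite n2_comb.
have eS : \sum_i a i ^+ 2 = \sum_i \sum_j a i * a j * (i == j)%:R.
  apply: eq_bigr => i _; rewrite (bigD1 i) //= eqxx mulr1 big1 ?addr0 // => j.
  by rewrite eq_sym => /negPf ->; rewrite mulr0.
have -> : \sum_i \sum_j a i * a j * dotp (u i) (u j) - \sum_i a i ^+ 2 =
    \sum_i \sum_j a i * a j * (dotp (u i) (u j) - (i == j)%:R).
  rewrite eS -sumrB; apply: eq_bigr => i _; rewrite -sumrB; apply: eq_bigr => j _.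
  ring.
apply: (@le_trans _ _ (\sum_i \sum_j eta / 2 * (a i ^+ 2 + a j ^+ 2))).
  apply: le_trans (ler_norm_sum _ _ _) _; apply: ler_sum => i _.
  apply: le_trans (ler_norm_sum _ _ _) _; apply: ler_sum => j _.
  rewrite normrM; have h1 : `|a i * a j| <= (a i ^+ 2 + a j ^+ 2) / 2.
    rewrite ler_norml; have := sqr_ge0 (a i - a j); have := sqr_ge0 (a i + a j); lra.
  apply: le_trans (ler_wpM2l (normr_ge0 _) (hd i j)) _.
  have eta0 : 0 <= eta by exact: le_trans (normr_ge0 _) (hd i j).
  apply: le_trans (ler_wpM2r eta0 h1) _; lra.
rewrite le_eqVlt; apply/orP; left; apply/eqP.
under eq_bigr do rewrite -mulr_sumr big_split /= sumr_const card_ord.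
rewrite -mulr_sumr big_split /= sumr_const card_ord sumrMnl.
by rewrite -[_ *+ m]mulr_natl; field.
Qed.

End Gram.

Section EssentialSpectrum.
Context (R : realType) (T : choiceType) (K : (T -> R) -> T -> R) (B : R) (d : T -> R).
Hypothesis hK : bdsym K B.
Local Notation H := (Op K d).

Lemma fsupp_comb (m : nat) (a : 'I_m -> R) (u : 'I_m -> T -> R) :
  (forall i, fsupp (u i)) -> fsupp (fun x => \sum_i a i * u i x).
Proof.
move=> fu; have : finite_set (\bigcup_(i in [set: 'I_m]) [set x | u i x != 0]).
  by apply: bigcup_finite => // i _; exact: fu.
apply: sub_finite_set => x /= nz; apply: contrapT => no.
move/eqP: nz; apply; apply: big1 => i _.
have -> : u i x = 0 by apply/eqP/negPn/negP => h; apply: no; exists i.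
by rewrite mulr0.
Qed.

Lemma approx_eigen mu t : spec K d mu -> 0 < t -> exists f : T -> R,
  [/\ fsupp f, n2 f = 1 & n2 (fun x => H f x - mu * f x) <= t].
Proof.
move=> smu t0; have := smu t => /not_andP[//|/existsNP[f /not_implyP[ff /negP]]].
rewrite -ltNge => lt; have sf := fsupp_l2 ff.
have p : 0 < n2 f.
  by have := le_lt_trans (n2_ge0 _) lt; rewrite pmulr_rgt0.
pose a := (Num.sqrt (n2 f))^-1.
have a2 : a ^+ 2 * n2 f = 1 by rewrite /a exprVn sqr_sqrtr ?n2_ge0 // mulVf // gt_eqF.
exists (fun x => a * f x); split.
- by apply: sub_finite_set ff => x /=; apply: contraNN => /eqP ->; rewrite mulr0.
- by rewrite n2Z.
have -> : (fun x => H (fun x => a * f x) x - mu * (a * f x)) = fun x => a * (H f x - mu * f x).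
  apply/funext => x; have := Op_lin d hK a f (fun=> 0) x.
  rewrite [H (fun=> 0) x](Op0 d hK) // addr0 => e.
  rewrite (_ : (fun y => a * f y + 0) = fun y => a * f y) in e; last first.
    by apply/funext => y; rewrite addr0.
  by rewrite e; ring.
rewrite n2Z; last exact: (fsupp_l2_Op d hK mu ff).
have : a ^+ 2 * n2 (fun x => H f x - mu * f x) <= a ^+ 2 * (t * n2 f).
  by apply: ler_wpM2l; [exact: sqr_ge0 | exact: ltW].
by rewrite mulrCA a2 mulr1.
Qed.

(* Too many approximate eigenvectors would have a combination vanishing on s. *)
Lemma ess_finite (s : seq T) (c : R) (S : set R) : 0 < c -> S `<=` spec K d ->
  (forall mu, S mu -> forall psi, fsupp psi -> (forall x, x \in s -> psi x = 0) ->
     c * n2 psi <= n2 (fun x => H psi x - mu * psi x)) ->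
  (forall mu mu', S mu -> S mu' -> (mu - mu') ^+ 2 <= c / 8) -> finite_set S.
Proof.
move=> c0 Ssp hS close; apply: contrapT => inf.
(* One vector more than the number of vanishing conditions imposed by [s]. *)
pose m := (size s).+1.
have [E ES mE] := infinite_set_fset m inf.
pose mu (i : 'I_m) := nth 0 (finmap.enum_fset E) i.
have lt (i : 'I_m) : (i < size (finmap.enum_fset E))%N := leq_trans (ltn_ord i) mE.
have muS i : S (mu i) by apply: ES; exact: (mem_nth 0 (lt i)).
have mu_inj i j : i != j -> mu i != mu j.
  by apply: contraNN; rewrite /mu nth_uniq ?finmap.fset_uniq ?lt.
have mp : 0 < m%:R :> R by rewrite ltr0n.
pose sep (ij : 'I_m * 'I_m) := if ij.1 == ij.2 then 1 else `|mu ij.1 - mu ij.2|.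
have sep0 ij : 0 < sep ij.
  by rewrite /sep; case: eqVneq => // /mu_inj h; rewrite normr_gt0 subr_eq0.
pose d0 := (1 + \sum_ij (sep ij)^-1)^-1.
have hd0 ij : 0 < d0 /\ d0 <= sep ij by apply: harmonic_lb => //; exact: mem_index_enum.
have d00 : 0 < d0 := (hd0 (ord0, ord0)).1.
(* Residuals of norm [t]: small against the separation [d0] of the spectral points for near
   orthogonality, and against [c] for the final comparison. *)
pose t := Num.min 1 (Num.min (d0 / (8 * m%:R)) (c / (8 * m%:R))).
have t0 : 0 < t by rewrite !lt_min ltr01 !divr_gt0 // mulr_gt0.
have t1 : t <= 1 by rewrite ge_min lexx.
have td : t * (8 * m%:R) <= d0 by rewrite -ler_pdivlMr ?mulr_gt0 // !ge_min lexx orbT.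
have tc : t * (8 * m%:R) <= c by rewrite -ler_pdivlMr ?mulr_gt0 // !ge_min lexx !orbT.
have /choice[u hu] : forall i, exists f : T -> R,
    [/\ fsupp f, n2 f = 1 & n2 (fun x => H f x - mu i * f x) <= t ^+ 2].
  by move=> i; apply: approx_eigen; [exact/Ssp/muS | exact: exprn_gt0].
have fu i : fsupp (u i) by have [] := hu i.
have su i : l2 (u i) := fsupp_l2 (fu i).
pose r i x := H (u i) x - mu i * u i x.
have sr i : l2 (r i) := fsupp_l2_Op d hK (mu i) (fu i).
have sH i : l2 (H (u i)).
  by have := fsupp_l2_Op d hK 0 (fu i); apply: le_l2 => x; rewrite mul0r subr0.
have young i j : `|dotp (u i) (r j)| <= t.
  have := dot_young (l2_hilbert R T) (mkl2 (su i)) (mkl2 (sr j)) t0.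
  rewrite !sqE; have [_ e1 e2] := (hu i, hu j).1; have [_ _ e3] := hu j.
  have e4 : t^-1 * n2 (r j) <= t.
    by rewrite mulrC ler_pdivrMr // -expr2.
  have -> : n2 (mkl2 (su i)) = 1 by exact: e1.
  have e5 : n2 (mkl2 (sr j)) = n2 (r j) by [].
  rewrite e5 => h; apply: le_trans h _; lra.
(* As for exact eigenvectors, symmetry of the operator turns distinct eigenvalues into
   orthogonality, here up to the residuals. *)
have offdiag i j : (mu i - mu j) * dotp (u i) (u j) = dotp (u i) (r j) - dotp (u j) (r i).
  have rE k : r k = fun x => H (u k) x + (- mu k) * u k x.
    by apply/funext => x; rewrite /r mulNr.
  have [li lj] := (l2Z (- mu i) (su i), l2Z (- mu j) (su j)).
  have ad : absum (fun x => d x * u i x * u j x).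
    apply: absum_fsupp; apply: sub_finite_set (fu i) => x /=.
    by apply: contraNN => /eqP ->; rewrite mulr0 mul0r.
  rewrite (rE j) (rE i) (dotpDr (su i) (sH j) lj) (dotpDr (su j) (sH i) li).
  rewrite (dotpZr (- mu j) (su i) (su j)) (dotpZr (- mu i) (su j) (su i)).
  rewrite (dotpC (u j) (u i)) (dotpC (u j) (H (u i))) (Op_sym hK (su i) (su j) ad).
  ring.
pose eta := 2 * t / d0.
have eta_m : eta * m%:R <= 1 / 4.
  by rewrite /eta mulrAC ler_pdivrMr //; lra.
have gram i j : `|dotp (u i) (u j) - (i == j)%:R| <= eta.
  have [<-|ij] := eqVneq i j.
    have -> : dotp (u i) (u i) = n2 (u i) by apply: eq_tsum => x; rewrite expr2.
    have [_ -> _] := hu i; rewrite subrr normr0 divr_ge0 ?mulr_ge0 //; exact: ltW.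
  rewrite subr0 /eta ler_pdivlMr //.
  have h1 : `|mu i - mu j| * `|dotp (u i) (u j)| <= 2 * t.
    rewrite -normrM offdiag; have := young i j; have := young j i.
    have := ler_normB (dotp (u i) (r j)) (dotp (u j) (r i)); lra.
  have [_] := hd0 (i, j); rewrite /sep /= (negPf ij) => h2.
  have := ler_wpM2r (normr_ge0 (dotp (u i) (u j))) h2; rewrite mulrC; lra.
pose Mx : 'M[R]_(m, size s) := \matrix_(i, k) u i (tnth (in_tuple s) k).
have : kermx Mx != 0.
  rewrite -mxrank_eq0 mxrank_ker subn_eq0 -ltnNge.
  exact: leq_ltn_trans (rank_leq_col _) (ltnSn _).
move=> /rowV0Pn[v /sub_kermxP vM v0].
pose a i := v 0 i.
have S0 : 0 < \sum_i a i ^+ 2.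
  rewrite lt_neqAle sumr_ge0 ?andbT => [|i _]; last exact: sqr_ge0.
  apply: contra_neq v0 => e; apply/rowP => i; rewrite mxE.
  have := psumr_eq0P (fun i _ => sqr_ge0 (a i)) (esym e) (i := i) isT.
  by move/eqP; rewrite sqrf_eq0 => /eqP.
set S2 := \sum_i a i ^+ 2 in S0.
pose U x := \sum_i a i * u i x.
have Us x : x \in s -> U x = 0.
  move=> /seq_tnthP[k ->]; have := congr1 (fun M : 'rV_(size s) => M 0 k) vM.
  rewrite !mxE => e; rewrite -[RHS]e; apply: eq_bigr => i _; by rewrite mxE.
have fU : fsupp U by exact: fsupp_comb.
have h1 := hS _ (muS ord0) U fU Us.
pose b i := a i * (mu i - mu ord0).
have HU x : H U x - mu ord0 * U x = \sum_i b i * u i x + \sum_i a i * r i x.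
  rewrite /U (Op_sum d hK) mulr_sumr -big_split -sumrB /=.
  by apply: eq_bigr => i _; rewrite /b /r; ring.
have s1 : l2 (fun x => \sum_i b i * u i x) by apply: l2_sum => i; exact: l2Z.
have sri i : l2 (fun x => a i * r i x) by exact: l2Z.
have s2 : l2 (fun x => \sum_i a i * r i x) by exact: l2_sum.
have h2 : n2 (fun x => H U x - mu ord0 * U x) <=
    2 * n2 (fun x => \sum_i b i * u i x) + 2 * n2 (fun x => \sum_i a i * r i x).
  rewrite (_ : (fun x => H U x - mu ord0 * U x) = fun x => \sum_i b i * u i x + \sum_i a i * r i x).
    exact: n2D_le.
  exact/funext/HU.
have sz : size (index_enum 'I_m) = m.
  rewrite -[RHS](size_enum_ord m); apply: perm_size; apply: uniq_perm.
  - exact: index_enum_uniq.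
  - exact: enum_uniq.
  - by move=> i; rewrite mem_index_enum mem_enum.
have h3 : n2 (fun x => \sum_i a i * r i x) <= m%:R * (t ^+ 2 * S2).
  apply: le_trans (n2_sum_le _ sri) _; rewrite sz ler_wpM2l ?ler0n // /S2 mulr_sumr.
  apply: ler_sum => i _; rewrite n2Z // mulrC ler_wpM2r ?sqr_ge0 //; by have [] := hu i.
have h4 : \sum_i b i ^+ 2 <= c / 8 * S2.
  rewrite /S2 mulr_sumr; apply: ler_sum => i _.
  rewrite /b exprMn mulrC ler_wpM2r ?sqr_ge0 //; exact: close (muS i) (muS ord0).
have := gram_almost_orthonormal su a gram; rewrite -/S2 -/(U) ler_norml => /andP[h5 _].
have := gram_almost_orthonormal su b gram; rewrite ler_norml => /andP[_ h6].
set Sb := \sum_i b i ^+ 2 in h4 h6.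
have Sb0 : 0 <= Sb by apply: sumr_ge0 => i _; exact: sqr_ge0.
have h7 : eta * m%:R * S2 <= 1 / 4 * S2 by rewrite ler_wpM2r // ltW.
have h8 : eta * m%:R * Sb <= 1 / 4 * Sb by rewrite ler_wpM2r.
have h9 : m%:R * (t ^+ 2 * S2) <= c / 8 * S2.
  rewrite mulrA ler_wpM2r //; first exact: ltW.
  have : t ^+ 2 <= t by rewrite expr2 ger_pMl.
  by move=> /(ler_wpM2l (ltW mp)); lra.
have h10 : c * (3 / 4 * S2) <= c * n2 U by rewrite ler_pM2l // /U; lra.
(* The Gram bounds give 3/4 c S2 <= c |U|^2, while |(H - mu) U|^2 <= 2 (5/4) (c/8) S2 + 2 (c/8) S2 =
   9/16 c S2. *)
have h11 : 0 < c * S2 by rewrite mulr_gt0.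
lra.
Qed.

End EssentialSpectrum.

(** Sort the points by the finite set, listed as a sequence, by an integer [k] with 1/(k+1) <= c,
    and by their cell in a mesh of width 1/(8(k+1)). There are countably many classes, and two
    points of a class satisfy (mu - mu')^2 <= 1/(8(k+1)), so [ess_finite] applies to each. *)
Lemma ess_countable (R : realType) (T : countType) (K : (T -> R) -> T -> R) (B : R) (d : T -> R) :
  bdsym K B ->
  countable [set mu | spec K d mu /\ exists (F : set T) (c : R), [/\ finite_set F, 0 < c &
    forall psi, fsupp psi -> (forall x, F x -> psi x = 0) ->
      c * n2 psi <= n2 (fun x => Op K d psi x - mu * psi x)]].
Proof.
move=> hK.
pose E (z : seq T * nat * int) := [set mu | [/\ spec K d mu,
    Num.floor (mu * (8 * z.1.2.+1%:R)) = z.2 &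
    forall psi, fsupp psi -> (forall x, x \in z.1.1 -> psi x = 0) ->
      z.1.2.+1%:R^-1 * n2 psi <= n2 (fun x => Op K d psi x - mu * psi x)]].
have : countable (\bigcup_(z in [set: seq T * nat * int]) E z).
  apply: bigcup_countable => // -[[s k] j] _; apply: finite_set_countable.
  have k0 : 0 < k.+1%:R :> R by rewrite ltr0n.
  have k1 : 1 <= k.+1%:R :> R by rewrite ler1n.
  apply: (ess_finite hK (d := d) (s := s) (c := k.+1%:R^-1)).
  - by rewrite invr_gt0.
  - by move=> mu [].
  - by move=> mu [].
  move=> mu mu' [_ /= e1 _] [_ /= e2 _].
  have := floor_itv (mu * (8 * k.+1%:R)); have := floor_itv (mu' * (8 * k.+1%:R)).
  rewrite e1 e2 intrD => /andP[a1 a2] /andP[b1 b2].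
  set N := k.+1%:R in k0 k1 a1 a2 b1 b2 *.
  have lt1 : ((mu - mu') * (8 * N)) ^+ 2 <= 1.
    rewrite -real_normK ?num_real // exprn_ile1 // ler_norml; apply/andP; split; lra.
  rewrite -(@ler_pM2r _ ((8 * N) ^+ 2)) ?exprn_gt0 ?mulr_gt0 // -exprMn.
  apply: le_trans lt1 _; have -> : N^-1 / 8 * (8 * N) ^+ 2 = 8 * N by field; rewrite gt_eqF.
  lra.
apply: sub_countable; apply: subset_card_le => mu [smu [F [c [fF c0 hc]]]].
pose k := Num.truncn c^-1.
exists (finmap.enum_fset (fset_set F), k, Num.floor (mu * (8 * k.+1%:R))) => //; split => //= psi fpsi z.
have le : k.+1%:R^-1 <= c.
  by rewrite -[c]invrK lef_pV2 ?posrE ?invr_gt0 // ltW // truncnS_gt.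
apply: le_trans (hc psi fpsi _); first by rewrite ler_wpM2r ?n2_ge0.
move=> x Fx; apply: z; by rewrite -[_ \in _]/(x \in fset_set F) in_fset_set // mem_set.
Qed.

Theorem countable_hspec (R : realType) (g h : R) : h != 0 -> forall (n : nat) (I : finType),
  (#|I| <= n)%N -> (0 < #|I|)%N -> forall (w : I -> I -> int -> R) (W : R),
  (forall i j k, `|w i j k| <= W) ->
  (forall e, 0 < e -> exists G : int, 0 <= G /\ forall i j k, G <= `|k| -> `|w i j k| <= e) ->
  countable (hspec g h w).
Proof.
move=> h0; elim=> [|n IH] I In I0 w W wW wdecay.
  by move: In; rewrite leqn0 => /eqP e; rewrite e in I0.
have /card_gt0P[i0 _] := I0.
pose E (A : {set I}) : set R := if (A != finset.set0) && (A != finset.setT) then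
  hspec g h (cut A w) else set0.
have cE : countable (\bigcup_(A in [set: {set I}]) E A).
  apply: bigcup_countable => // A _; rewrite /E; case: ifP => // /andP[A0 AT].
  have c1 : #|{: {i in A}}| = #|A| by rewrite card_sig.
  have c2 : #|{: {i in ~: A}}| = #|~: A| by rewrite card_sig.
  have p1 : (0 < #|A|)%N by rewrite card_gt0.
  have p2 : (0 < #|~: A|)%N.
    rewrite card_gt0; apply: contra AT => /eqP e.
    by rewrite -[A]finset.setCK e finset.setC0.
  have tot : (#|A| + #|~: A| = #|I|)%N by exact: cardsC.
  have i1 : (#|{: {i in A}}| <= n)%N by rewrite c1; lia.
  have i2 : (#|{: {i in ~: A}}| <= n)%N by rewrite c2; lia.
  rewrite -c1 in p1; rewrite -c2 in p2.
  apply: countable_cluster_spec => //.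
    apply: (IH _ i1 p1 _ W) => [i j k|e /wdecay[G [G0 hG]]]; first exact: wW.
    by exists G; split => // i j k; exact: hG.
  apply: (IH _ i2 p2 _ W) => [i j k|e /wdecay[G [G0 hG]]]; first exact: wW.
  by exists G; split => // i j k; exact: hG.
have := countable_setU cE (@ess_countable R {ffun I -> int} _ _ (pot h w) (bdsym_hop g I)).
apply: sub_countable; apply: subset_card_le => mu smu.
have [[A _ EA]|nE] := pselect ((\bigcup_(A in [set: {set I}]) E A) mu).
  by left; exists A.
right; split=> //; apply: (hvz i0 h0 wW wdecay) => A A0 AT smuA.
by apply: nE; exists A => //; rewrite /E A0 AT.
Qed.

(** * Back to complex functions and the given Hamiltonian *)

Lemma Hact_real (R : realType) (g h : R) (N : nat) (v : int -> R) (f : cfg N -> R) x :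
  Hact g h v (fun y => (f y)%:C%C) x =
  (Op (@hop R g 'I_N) (pot h (fun i j : 'I_N => if (i < j)%N then v else fun=> 0)) f x)%:C%C.
Proof.
set w := fun i j : 'I_N => _.
have e : Op (@hop R g 'I_N) (pot h w) f x =
    g * (\sum_(k < N) - (f (Defs.shift x k (-1)) + f (Defs.shift x k 1))) - (2 * h * (totpos x)%:~R) * f x
    + (\sum_(i < N) \sum_(j < N | (i < j)%N) v (x i - x j)) * f x.
  have -> : \sum_(i < N) \sum_(j < N | (i < j)%N) v (x i - x j) = pair_pot w x.
    apply: eq_bigr => i _; rewrite big_mkcond; apply: eq_bigr => j _.
    by rewrite /w; case: ifP.
  have hopE : hop g f x = g * (\sum_(k < N) - (f (Defs.shift x k (-1)) + f (Defs.shift x k 1))).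
    rewrite /hop -(pair_bigA _ (fun k b => f (nb x (k, b)))) /= mulNr -mulrN -sumrN.
    by congr (_ * _); apply: eq_bigr => k _; rewrite big_bool /= addrC.
  by rewrite /Op hopE /pot /pos; ring.
rewrite e /Hact rmorphD rmorphB; congr (_ - _ + _).
- rewrite rmorphM rmorph_sum; congr (_ * _); apply: eq_bigr => k _.
  by rewrite rmorphN rmorphD.
- by rewrite [RHS]rmorphM.
- by rewrite [RHS]rmorphM.
Qed.

Lemma sqnormc_real (R : realType) (a : R) : sqnormc a%:C%C = a ^+ 2.
Proof. by rewrite /sqnormc /= expr0n addr0. Qed.

(** Membership in the domain follows from the eigenvalue equation: the potential times [f] is
    square-summable, the interaction is bounded, and dividing by 2h isolates the total position. *)
Lemma eigvec_real (R : realType) (g h : R) (N : nat) (v : int -> R) (M : R) (f : cfg N -> R) :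
  h != 0 -> (forall n, `|v n| <= M) -> l2 f -> (exists x, f x != 0) ->
  (exists s, forall x, Op (@hop R g 'I_N)
     (pot h (fun i j : 'I_N => if (i < j)%N then v else fun=> 0)) f x = s * f x) ->
  eigvec g h v (fun x => (f x)%:C%C).
Proof.
set w := fun i j : 'I_N => _; move=> h0 vM sf [x0 nz] [s es].
have l2C (k : cfg N -> R) : l2 k -> in_l2 (fun x => (k x)%:C%C).
  move=> sk; rewrite /in_l2; under eq_esum do rewrite sqnormc_real.
  by rewrite -[X in (X < _)%E]n2_nsq // ltry.
split; first split.
- exact: l2C.
- have so : l2 (Op (@hop R g 'I_N) (pot h w) f).
    by rewrite (_ : Op _ _ _ = fun x => s * f x); [exact: l2Z | exact/funext].
  have sd := l2_dmul (bdsym_hop g 'I_N) sf so.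
  have M0 : 0 <= M by exact: le_trans (normr_ge0 _) (vM 0).
  pose Wt : R := \sum_(i < N) \sum_(j < N) M.
  have pW x : `|pair_pot w x| <= Wt.
    apply: le_trans (ler_norm_sum _ _ _) _; apply: ler_sum => i _.
    apply: le_trans (ler_norm_sum _ _ _) _; apply: ler_sum => j _.
    by rewrite /w; case: ifP => _; rewrite ?normr0.
  have sp : l2 (fun x => pair_pot w x * f x).
    apply: le_l2 (l2Z Wt sf) => x; rewrite !normrM ler_wpM2r //.
    exact: le_trans (pW x) (ler_norm _).
  have := l2C _ (l2Z (- (2 * h)^-1) (l2B sd sp)); rewrite /in_l2.
  congr (_ < _)%E; apply: eq_esum => x _; congr (sqnormc _)%:E.
  rewrite -rmorphM /pot; congr (_%:C)%C.
  by rewrite /pos /totpos; field.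
split; first by exists x0; rewrite -[0]/(0%:C)%C (inj_eq (@complexI R)).
exists s%:C%C => x; by rewrite Hact_real -rmorphM es.
Qed.

Theorem theorem1 (R : realType) (g h : R) (N : nat) (v : int -> R) :
  h != 0 -> (1 <= N)%N ->
  (exists M : R, forall n : int, `|v n| <= M) ->
  (fun n : nat => v n%:Z) @ \oo --> (0 : R) ->
  (fun n : nat => v (- n%:Z)) @ \oo --> (0 : R) ->
  pure_point N g h v.
Proof.
move=> h0 N1 [M vM] /cvgrPdist_le vp /cvgrPdist_le vm phi phi2 eps eps0.
pose w (i j : 'I_N) := if (i < j)%N then v else fun=> 0.
have M0 : 0 <= M by exact: le_trans (normr_ge0 _) (vM 0).
have wM i j k : `|w i j k| <= M by rewrite /w; case: ifP => _; rewrite ?normr0.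
have wdecay e : 0 < e -> exists G : int, 0 <= G /\ forall i j k, G <= `|k| -> `|w i j k| <= e.
  move=> e0; have [n1 _ h1] := vp e e0; have [n2 _ h2] := vm e e0.
  exists (n1 + n2)%:Z; split => // i j k le; rewrite /w; case: ifP => _; last by rewrite normr0 ltW.
  have [k0|k0] := leP 0 k.
    have := h1 (absz k); rewrite /= sub0r normrN gez0_abs //; apply.
    by move: le; clear -k0; lia.
  have := h2 (absz k); rewrite /= sub0r normrN ltz0_abs // opprK; apply.
  by move: le; clear -k0; lia.
have cs : countable (hspec g h w).
  by apply: (@countable_hspec R g h h0 N 'I_N _ _ w M wM wdecay); rewrite card_ord.
have hK := bdsym_hop g 'I_N.
have leC (k : cfg N -> R) : (forall x, k x ^+ 2 <= sqnormc (phi x)) -> l2 k.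
  move=> le; apply: nsq_l2; apply: le_lt_trans phi2.
  by apply: le_esum => x _; rewrite lee_fin.
have s1 : l2 (fun x => complex.Re (phi x)).
  by apply: leC => x; rewrite lerDl sqr_ge0.
have s2 : l2 (fun x => complex.Im (phi x)).
  by apply: leC => x; rewrite lerDr sqr_ge0.
(* The real and imaginary parts are approximated separately by real eigenfunctions, combined below
   with coefficients 1 and i; two errors of eps/4 leave room for the strict inequality. *)
have e4 : 0 < eps / 4 by rewrite divr_gt0.
have [gs1 [hg1 [le1 l1]]] := eigenfunctions_dense hK cs s1 e4.
have [gs2 [hg2 [le2 l2']]] := eigenfunctions_dense hK cs s2 e4.
pose z0 : cfg N -> R := fun=> 0.
pose m1 := size gs1; pose m2 := size gs2.
pose c (i : 'I_(m1 + m2)) : R[i]%C := if fintype.split i is inl _ then 1 else 'i%C.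
pose psi (i : 'I_(m1 + m2)) : cfg N -> R :=
  match fintype.split i with inl j => nth z0 gs1 j | inr j => nth z0 gs2 j end.
exists (m1 + m2)%N, c, (fun i x => (psi i x)%:C%C); split.
  move=> i; rewrite /psi; case: (fintype.split i) => j.
    by have [p1 p2 p3] := hg1 j (ltn_ord j); exact: (eigvec_real h0 vM p1 p2 p3).
  by have [p1 p2 p3] := hg2 j (ltn_ord j); exact: (eigvec_real h0 vM p1 p2 p3).
have sumL x : \sum_(i < m1 + m2) c i * (psi i x)%:C%C =
    (\sum_(k <- gs1) k x)%:C%C + 'i%C * (\sum_(k <- gs2) k x)%:C%C.
  rewrite big_split_ord /=; congr (_ + _).
    rewrite (big_nth z0) big_mkord rmorph_sum; apply: eq_bigr => j _.
    by rewrite /c /psi (unsplitK (inl j)) mul1r.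
  rewrite (big_nth z0) big_mkord rmorph_sum mulr_sumr; apply: eq_bigr => j _.
  by rewrite /c /psi (unsplitK (inr j)).
rewrite (eq_esum (b := fun x => (((complex.Re (phi x) - \sum_(k <- gs1) k x) ^+ 2)%:E +
   ((complex.Im (phi x) - \sum_(k <- gs2) k x) ^+ 2)%:E)%E)); last first.
  move=> x _; rewrite -EFinD sumL; congr (_%:E); rewrite /sqnormc.
  case: (phi x) => a b /=; congr (_ ^+ 2 + _ ^+ 2); ring.
rewrite esumD => [|x _|x _]; [|by rewrite lee_fin sqr_ge0|by rewrite lee_fin sqr_ge0].
rewrite -[X in (X + _)%E]n2_nsq // -[X in (_ + X)%E]n2_nsq // -EFinD lte_fin; lra.
Qed.
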